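(* Let $M_p$, $A_p$ be weight sequences satisfying the standing assumptions and let $\mathcal{V}=(v_n)_{n}$ be a decreasing weight system on $\mathbb{R}^d$ satisfying the standing assumptions (see context). Let $(\ast,\dagger)$ be either $((M_p),(A_p))$ (Beurling case) or $(\{M_p\},\{A_p\})$ (Roumieu case). Let $f \in \mathcal{S}'^\ast_\dagger(\mathbb{R}^d)$. The following statements are equivalent: (i) $f \in \mathcal{B}'^{\ast}_{\mathcal{V}}(\mathbb{R}^d)$. (ii) $f \ast \varphi \in \mathcal{V}^\circ C(\mathbb{R}^d)$ for all $\varphi \in \mathcal{S}^\ast_\dagger(\mathbb{R}^d)$. (iii) $f \ast \varphi \in \mathcal{V}^\circ C(\mathbb{R}^d)$ for all $\varphi \in \mathcal{S}^\ast_\dagger(\mathbb{R}^d)$ and the mapping $\ast_f : \mathcal{S}^\ast_\dagger(\mathbb{R}^d) \rightarrow \mathcal{V}^\circ C(\mathbb{R}^d)$, $\varphi \mapsto f \ast \varphi$, is continuous. (iv) $f \ast \varphi \in \mathcal{B}^\ast_{\mathcal{V}^\circ}(\mathbb{R}^d)$ for all $\varphi \in \mathcal{S}^\ast_\dagger(\mathbb{R}^d)$. (v) $f \ast \varphi \in \mathcal{B}^\ast_{\mathcal{V}^\circ}(\mathbb{R}^d)$ for all $\varphi \in \mathcal{S}^\ast_\dagger(\mathbb{R}^d)$ and the mapping $\ast_f : \mathcal{S}^\ast_\dagger(\mathbb{R}^d) \rightarrow \mathcal{B}^\ast_{\mathcal{V}^\circ}(\mathbb{R}^d)$, $\varphi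 \mapsto f \ast \varphi$, is continuous.
   Context: Weight sequences. For a sequence $(M_p)_{p\in\mathbb{N}}$ of positive reals ($\mathbb N=\{0,1,2,\dots\}$) put $m_p := M_p/M_{p-1}$, $p\ge 1$. It is a weight sequence if $m_p\to\infty$. Write $M_\alpha=M_{|\alpha|}$ for $\alpha\in\mathbb{N}^d$. $(M.1)$: $M_p^2\le M_{p-1}M_{p+1}$, $p\ge1$. $(M.2)$: $M_{p+q}\le C_0H^{p+q}M_pM_q$ for all $p,q$, for some $C_0,H\ge1$. $M_p\prec N_p$ means: for every $h>0$ there is $C>0$ with $M_p\le Ch^pN_p$ for all $p$. The associated function of $A_p$ is $A(t)=\sup_{p}\log(t^pA_0/A_p)$ for $t>0$, $A(0)=0$, and $A(x)=A(|x|)$ for $x\in\mathbb{R}^d$. Gelfand-Shilov spaces. $\mathcal{S}^{M_p,h}_{A_p,\lambda}(\mathbb{R}^d)$ ($h,\lambda>0$) is the Banach space of $\varphi\in C^\infty(\mathbb{R}^d)$ with $\sup_{\alpha}\sup_{x}h^{|\alpha|}|\varphi^{(\alpha)}(x)|e^{A(\lambda x)}/M_\alpha<\infty$; $\mathcal{S}^{(M_p)}_{(A_p)}(\mathbb{R}^d)=\varprojlim_{h\to\infty}\mathcal{S}^{M_p,h}_{A_p,h}(\mathbb{R}^d)$, $\mathcal{S}^{\{M_p\}}_{\{A_p\}}(\mathbb{R}^d)=\varinjlim_{h\to0^+}\mathcal{S}^{M_p,h}_{A_p,h}(\mathbb{R}^d)$; $\mathcal{S}'^\ast_\dagger$ denotes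 the dual of $\mathcal{S}^\ast_\dagger$. Weight systems. An increasing (decreasing) weight system on $\mathbb{R}^d$ is a pointwise increasing (decreasing) sequence of positive continuous functions on $\mathbb R^d$. For a decreasing weight system $\mathcal{V}=(v_n)_n$ the dual weight system is the increasing weight system $\mathcal{V}^\circ=(v_n^{-1})_n$. For a positive continuous $w$ and $h>0$, $\mathcal{B}^{M_p,h}_w(\mathbb{R}^d)$ is the Banach space of $\varphi\in C^\infty(\mathbb{R}^d)$ with $\sup_{\alpha}\sup_{x}h^{|\alpha|}|\varphi^{(\alpha)}(x)|w(x)/M_\alpha<\infty$; $\mathcal{B}^{(M_p)}_w=\varprojlim_{h\to\infty}\mathcal{B}^{M_p,h}_w$, $\mathcal{B}^{\{M_p\}}_w=\varinjlim_{h\to0^+}\mathcal{B}^{M_p,h}_w$. For decreasing $\mathcal{V}=(v_n)_n$: $\mathcal{B}^{\ast}_\mathcal{V}=\varinjlim_n\mathcal{B}^{\ast}_{v_n}$ for $\ast=(M_p)$ or $\{M_p\}$. For increasing $\mathcal{W}=(w_N)_N$: $\mathcal{B}^{M_p,h}_\mathcal{W}=\varprojlim_N\mathcal{B}^{M_p,h}_{w_N}$, $\mathcal{B}^{(M_p)}_\mathcal{W}=\varprojlim_{h\to\infty}\mathcal{B}^{M_p,h}_\mathcal{W}$, $\mathcal{B}^{\{M_p\}}_\mathcal{W}=\varinjlim_{h\to0^+}\mathcal{B}^{M_p,h}_\mathcal{W}$, and $\mathcal{W}C(\mathbb{R}^d)$ is the Fréchet space of $f\in C(\mathbb{R}^d)$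 with $\|f\|_{w_N}=\sup_x|f(x)|w_N(x)<\infty$ for all $N$. Standing assumptions. $M_p$ and $A_p$ satisfy $(M.1)$ and $(M.2)$, $p!\prec M_pA_p$, and $\mathcal{S}^{(M_p)}_{(A_p)}(\mathbb{R}^d)\neq\{0\}$. The decreasing weight system $\mathcal{V}$ satisfies $\forall n\,\exists m>n:\ v_m(x)/v_n(x)=O(|x|^{-(d+1)})$, and is $(A_p)$-admissible in the Beurling case, i.e. $\forall n\,\exists\lambda>0\,\exists m\ge n\,\exists C>0\,\forall x,t\in\mathbb R^d:\ v_m(x+t)\le Cv_n(x)e^{A(\lambda t)}$, respectively $\{A_p\}$-admissible in the Roumieu case, i.e. $\forall n\,\forall\lambda>0\,\exists m\ge n\,\exists C>0\,\forall x,t:\ v_m(x+t)\le Cv_n(x)e^{A(\lambda t)}$. Under these assumptions $\mathcal{S}^\ast_\dagger(\mathbb{R}^d)$ is densely and continuously included in $\mathcal{B}^\ast_\mathcal{V}(\mathbb{R}^d)$, so the dual $\mathcal{B}'^\ast_\mathcal{V}(\mathbb{R}^d)$ is regarded as a subspace of $\mathcal{S}'^\ast_\dagger(\mathbb{R}^d)$. Convolution: $(f\ast\varphi)(x)=\langle f,T_x\check\varphi\rangle=\langle f,\varphi(x-\cdot)\rangle$. *)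

(* Defs.v *)
From mathcomp Require Import all_boot all_order all_algebra complex.
From mathcomp Require Import all_classical all_reals all_analysis.

Set Implicit Arguments.
Unset Strict Implicit.
Unset Printing Implicit Defensive.
Import Order.TTheory GRing.Theory Num.Theory.
Import numFieldNormedType.Exports.

Local Open Scope classical_set_scope.
Local Open Scope complex_scope.
Local Open Scope ring_scope.

Section WeightSequences.
Context {R : realType}.
Implicit Types M N A : R^nat.

Definition weight_sequence M :=
  (forall p, 0 < M p) /\ (M p.+1 / M p @[p --> \oo] --> +oo).

Definition M1 M := forall p, (1 <= p)%N -> M p ^+ 2 <= M p.-1 * M p.+1.

Definition M2 M := exists C0 H : R, [/\ 1 <= C0, 1 <= H &
  forall p q, M (p + q)%N <= C0 * H ^+ (p + q) * M p * M q].

Definition seq_prec M N := forall h : R, 0 < h ->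
  exists2 C : R, 0 < C & forall p, M p <= C * h ^+ p * N p.

(* For a weight sequence [A] the set below is bounded above for every [t > 0],
   so that the real supremum is the genuine one. *)
Definition assoc A (t : R) : R :=
  if 0 < t then sup [set ln (t ^+ p * A 0%N / A p) | p in [set: nat]] else 0.

End WeightSequences.

Section SmoothFunctions.
Context {R : realType} {d : nat}.

(* The library norm on row vectors is the maximum norm. *)
Definition enorm (x : 'rV[R]_d) : R := Num.sqrt (\sum_i x 0 i ^+ 2).

Definition partial (i : 'I_d) (u : 'rV[R]_d -> R) : 'rV[R]_d -> R :=
  fun x => 'D_(delta_mx 0 i) u x.

Definition partials (s : seq 'I_d) (u : 'rV[R]_d -> R) : 'rV[R]_d -> R :=
  foldr partial u s.

(* All partial derivatives of all orders exist and are continuous. *)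
Definition smooth_real (u : 'rV[R]_d -> R) := forall s : seq 'I_d,
  continuous (partials s u) /\
  forall (i : 'I_d) x, derivable (partials s u) x (delta_mx 0 i).

Definition re_part (phi : 'rV[R]_d -> R[i]) : 'rV[R]_d -> R :=
  fun x => complex.Re (phi x).

Definition im_part (phi : 'rV[R]_d -> R[i]) : 'rV[R]_d -> R :=
  fun x => complex.Im (phi x).

Definition smooth (phi : 'rV[R]_d -> R[i]) :=
  smooth_real (re_part phi) /\ smooth_real (im_part phi).

Definition multi_index := {ffun 'I_d -> nat}.

Definition mlength (a : multi_index) : nat := (\sum_i a i)%N.

(* The multi-index [a] written as the list of its indices, with multiplicity. *)
Definition mseq (a : multi_index) : seq 'I_d :=
  flatten [seq nseq (a i) i | i <- enum 'I_d].

Definition mderiv (a : multi_index) (phi : 'rV[R]_d -> R[i]) :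
    'rV[R]_d -> R[i] := fun x =>
  partials (mseq a) (re_part phi) x +i* partials (mseq a) (im_part phi) x.

End SmoothFunctions.

Arguments multi_index d : clear implicits.

Section LocallyConvexSpaces.
Context {R : realType} {d : nat}.

Notation C := (R[i]).
Notation fct := ('rV[R]_d -> C).

(* A locally convex space of functions is given by its elements and by the
   filter of neighbourhoods of the origin; for convenience the latter is a
   filter on the space of all functions, to which [carrier] belongs. *)
Record lcs := Lcs {
  carrier : set fct ;
  nbhs0 : set_system fct }.

Definition lcs_nbhs (E : lcs) (phi : fct) : set_system fct :=
  [set U | nbhs0 E [set psi | U (phi + psi)]].

Definition normed_lcs (D : set fct) (N : fct -> \bar R) : lcs :=
  let E := [set phi | D phi /\ (N phi < +oo)%E] in
  Lcs E (filter_from [set e : R | 0 < e]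
           (fun e => E `&` [set phi | (N phi < e%:E)%E])).

(* Initial topology with respect to the inclusions into the [E i]. *)
Definition projlim (I : eqType) (E : I -> lcs) : lcs :=
  let P := \bigcap_i carrier (E i) in
  Lcs P [set U | exists (s : seq I) (V : I -> set fct),
    (forall i, nbhs0 (E i) (V i)) /\
    P `&` [set phi | forall i, i \in s -> V i phi] `<=` U].

Definition absolutely_convex (V : set fct) := forall phi psi (a b : C),
  V phi -> V psi -> `|a| + `|b| <= 1 -> V (a *: phi + b *: psi).

(* Finest locally convex topology for which the inclusions of the [E i] are
   continuous; only used for directed families [E],
   for which the union below is a vector space. *)
Definition indlim (I : Type) (E : I -> lcs) : lcs :=
  Lcs (\bigcup_i carrier (E i))
    [set U | exists V, [/\ absolutely_convex V,
      (forall i, nbhs0 (E i) V) & V `<=` U]].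

Definition lcs_dual (E : lcs) : set (fct -> C) := [set f |
  (forall phi psi (a : C), carrier E phi -> carrier E psi ->
     f (a *: phi + psi) = a * f phi + f psi) /\
  (forall phi, carrier E phi ->
     (f : fct -> C^o) @ lcs_nbhs E phi --> (f phi : C^o))].

Definition lcs_maps (E F : lcs) (T : fct -> fct) :=
  forall phi, carrier E phi -> carrier F (T phi).

Definition lcs_continuous (E F : lcs) (T : fct -> fct) :=
  forall phi, carrier E phi ->
    T @ lcs_nbhs E phi --> lcs_nbhs F (T phi).

(* [f], a functional on [E], is the restriction to [E] of an element of the
   dual of [F]. *)
Definition in_dual_of (E F : lcs) (f : fct -> C) :=
  exists2 g, lcs_dual F g & forall phi, carrier E phi -> g phi = f phi.

Definition convolution (f : fct -> C) (phi : fct) : fct :=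
  fun x => f (fun t => phi (x - t)).

End LocallyConvexSpaces.

Arguments lcs R d : clear implicits.

(* Beurling case: (M_p), (A_p); Roumieu case: {M_p}, {A_p}. *)
Variant ucase := Beurling | Roumieu.

Section Spaces.
Context {R : realType} {d : nat}.
Implicit Types (c : ucase) (M A : R^nat) (w : 'rV[R]_d -> R).
Implicit Types (V W : nat -> 'rV[R]_d -> R).

Definition ultra_norm M (h : R) w (phi : 'rV[R]_d -> R[i]) : \bar R :=
  ereal_sup [set (h ^+ mlength ax.1 * Normc.normc (mderiv ax.1 phi ax.2)
                  * w ax.2 / M (mlength ax.1))%:E
            | ax in [set: multi_index d * 'rV[R]_d]].

Definition Bh M (h : R) w : lcs R d := normed_lcs smooth (ultra_norm M h w).

Definition Bw c M w : lcs R d :=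
  match c with
  | Beurling => projlim (fun h : {posnum R} => Bh M h%:num w)
  | Roumieu => indlim (fun h : {posnum R} => Bh M h%:num w)
  end.

(* B^*_V for a decreasing weight system V *)
Definition Bind c M V : lcs R d := indlim (fun n => Bw c M (V n)).

(* B^*_W for an increasing weight system W *)
Definition Bproj c M W : lcs R d :=
  let E (h : {posnum R}) := projlim (fun N => Bh M h%:num (W N)) in
  match c with
  | Beurling => projlim E
  | Roumieu => indlim E
  end.

Definition WC W : lcs R d :=
  projlim (fun N => normed_lcs
    [set f | continuous (f : 'rV[R]_d -> R[i]^o)]
    (fun f => ereal_sup [set (Normc.normc (f x) * W N x)%:E | x in setT])).

Definition gelfand_shilov c M A : lcs R d :=
  let E (h : {posnum R}) :=
    Bh M h%:num (fun x => expR (assoc A (h%:num * enorm x))) in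
  match c with
  | Beurling => projlim E
  | Roumieu => indlim E
  end.

Definition decreasing_weight_system V :=
  [/\ forall n x, 0 < V n x, forall n, continuous (V n) &
      forall n x, V n.+1 x <= V n x].

Definition dual_system V : nat -> 'rV[R]_d -> R := fun n x => (V n x)^-1.

Definition decay_condition V := forall n, exists2 m, (n < m)%N &
  exists C r : R, [/\ 0 < C, 0 < r & forall x, r <= enorm x ->
    V m x / V n x <= C * enorm x ^- d.+1].

Definition admissible c A V := forall n,
  match c with
  | Beurling => exists2 lambda : R, 0 < lambda &
      exists2 m, (n <= m)%N & exists2 C : R, 0 < C &
        forall x t, V m (x + t)
          <= C * V n x * expR (assoc A (lambda * enorm t))
  | Roumieu => forall lambda : R, 0 < lambda ->
      exists2 m, (n <= m)%N & exists2 C : R, 0 < C &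
        forall x t, V m (x + t)
          <= C * V n x * expR (assoc A (lambda * enorm t))
  end.

End Spaces.

(* Main.v *)
(* A continuous functional [f] on the Gelfand-Shilov space is controlled by its
   regularisations through a discrete partition of unity.  If [f * phi] is
   bounded by every [v_n] for all [phi], the uniform boundedness principle
   makes the bound proportional to a single norm of [phi].  Translates of one
   [chi] with [sum_k chi(. - k) = 1] over the integer lattice then split a test
   function into windows [chi(. - k) phi]; since [f (chi(. - k) phi)] is a value
   at [k] of a convolution of [f] with a function whose norm is [O(1 / v_m(k))],
   it is summable in [k] by the decay of the weights.  The sum extends [f]
   continuously to the large space, and agrees with [f] because the partial sums
   converge in the Gelfand-Shilov space.  The remaining implications come from
   differentiating [f * phi] under the pairing and from admissibility. *)

(* The standing assumptions admit quasianalytic classes, in which no window has compact support. The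
   partition is therefore made from a nonzero real or imaginary part u of an element of the Beurling
   space: the square of u along a coordinate line is a density of positive mass, and the unit-step
   differences F(s + 1) - F(s) of its antiderivative F telescope over the integers to that mass. The
   tensor power of the normalised profile satisfies its estimates for every h, so one window serves
   both cases. Seminorm bounds are relations (the seminorm is at most K), and the quantifiers over h
   are packaged in [dual_index] and [space_index]. The Beurling and Roumieu cases thus share most
   proofs and separate mainly where a space or a topology is unfolded. All lattice sums use the
   weight prod_i 1 / (1 + k_i^2), because its sum over a box is the d-th power of a one-variable
   sum. Its inverse can grow like |x|^(2d), so the decay of order d + 1 between weights is spent
   twice to obtain it. *)
Require Import Defs.
From mathcomp Require Import all_boot all_order all_algebra complex.
From mathcomp Require Import all_classical all_reals all_analysis.
From mathcomp Require Import ring lra.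

Set Implicit Arguments.
Unset Strict Implicit.
Unset Printing Implicit Defensive.
Import Order.TTheory GRing.Theory Num.Theory.
Import numFieldNormedType.Exports.

Local Open Scope classical_set_scope.
Local Open Scope complex_scope.
Local Open Scope ring_scope.

(** * Partial derivatives *)

Section OneVariable.
Context {R : realType}.
Implicit Types (g dg : R -> R).

Lemma mean_value g dg : (forall t : R, is_derive t (1 : R) g (dg t)) ->
  forall t, exists2 c, `|c| <= `|t| & g t - g 0 = dg c * t.
Proof.
move=> gd t.
have cg : continuous g.
  by move=> s; apply/differentiable_continuous/derivable1_diffP; apply: ex_derive.
have [t0|t0] := leP 0 t.
  have [c] := MVT_segment t0 (fun x _ => gd x) (continuous_subspaceT cg).
  rewrite in_itv /= subr0 => /andP[c0 ct] ->; exists c => //.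
  by rewrite !ger0_norm.
have [c] := MVT_segment (ltW t0) (fun x _ => gd x) (continuous_subspaceT cg).
rewrite in_itv /= => /andP[tc c0] E; exists c; last by move: E; lra.
by rewrite !ler0_norm ?lerN2 // ltW.
Qed.

Lemma lipschitz_of_derive g dg (K t : R) :
  (forall s, is_derive s (1 : R) g (dg s)) ->
  (forall s, `|s| <= `|t| -> `|dg s| <= K) -> `|g t - g 0| <= K * `|t|.
Proof.
move=> gd dgK; have [c ct ->] := mean_value gd t.
by rewrite normrM ler_wpM2r // dgK.
Qed.

(** Two uses of the mean value theorem replace the Taylor formula; this gives K in place of K / 2,
    and only the quadratic order matters below. *)
Lemma taylor2_bound g dg ddg (K t : R) :
  (forall s, is_derive s (1 : R) g (dg s)) ->
  (forall s, is_derive s (1 : R) dg (ddg s)) ->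
  (forall s, `|s| <= `|t| -> `|ddg s| <= K) ->
  `|g t - g 0 - dg 0 * t| <= K * `|t| ^+ 2.
Proof.
move=> gd dgd ddgK; have [c ct ->] := mean_value gd t.
rewrite -mulrBl normrM expr2 mulrA ler_wpM2r //.
apply: (@le_trans _ _ (K * `|c|)).
  by apply: lipschitz_of_derive dgd _ => s sc; apply: ddgK (le_trans sc ct).
by rewrite ler_wpM2l // (le_trans _ (ddgK 0 _)) ?normr0.
Qed.

End OneVariable.

Section Partials.
Context {R : realType} {d : nat}.
Notation rV := 'rV[R]_d.
Implicit Types (u v : rV -> R) (s : seq 'I_d) (x y : rV) (i j : 'I_d).

Notation e i := (delta_mx 0 i : rV).

Lemma close_to_common (w p q eps : R) :
  `|w - p| < eps / 2 -> `|w - q| < eps / 2 -> `|p - q| <= eps.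
Proof.
move=> wp wq; rewrite (_ : p - q = (w - q) - (w - p)); last by ring.
by apply: (le_trans (ler_normB _ _)); rewrite [leRHS]splitr lerD // ltW.
Qed.

(** Reduces directional derivatives to one real variable, where the mean value theorem and the chain
    rule are available. *)
Lemma is_derive_line u x (v : rV) (t df : R) :
  is_derive t (1 : R) (fun r => u (x + r *: v)) df <->
  is_derive (x + t *: v) v u df.
Proof.
have E : (fun h : R => h^-1 *: (((fun r => u (x + r *: v)) \o shift t) (h *: 1) -
     u (x + t *: v))) =
   (fun h : R => h^-1 *: ((u \o shift (x + t *: v)) (h *: v) - u (x + t *: v))).
  apply/funext => h /=; congr (_ *: (u _ - _)).
  by rewrite -[h *: 1]/(h * 1) mulr1 scalerDl addrCA.
by split=> -[d1 d2]; split; move: d1 d2; rewrite /derivable /derive E.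
Qed.

Lemma smooth_is_derive u : smooth_real u ->
  forall s i x, is_derive x (e i) (partials s u) (partials (i :: s) u x).
Proof. by move=> su s i x; split; [have [_] := su s; apply|]. Qed.

Lemma smooth_line u s i x : smooth_real u -> forall t : R,
  is_derive t (1 : R) (fun r => partials s u (x + r *: e i))
    (partials (i :: s) u (x + t *: e i)).
Proof. by move=> su t; apply/is_derive_line; apply: smooth_is_derive. Qed.

(** The way smoothness is proved throughout: all iterated partial derivatives are guessed at once,
    and only one differentiation step and continuity remain to be checked. *)
Lemma smooth_of_family (U : seq 'I_d -> rV -> R) :
  (forall s, continuous (U s)) ->
  (forall s i x, is_derive x (e i) (U s) (U (i :: s) x)) ->
  smooth_real (U [::]) /\ forall s, partials s (U [::]) = U s.
Proof.
move=> cU dU.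
have E s : partials s (U [::]) = U s.
  elim: s => [//|i s IH]; rewrite /= IH; apply/funext => x.
  by rewrite /partial; apply: derive_val.
by split=> // s; rewrite E; split=> // i x; apply: ex_derive.
Qed.

Lemma smooth_continuous u s : smooth_real u -> continuous (partials s u).
Proof. by move=> /(_ s)[]. Qed.

Lemma smooth_partials s u : smooth_real u -> smooth_real (partials s u).
Proof.
move=> su.
by have [] // := @smooth_of_family (fun s' => partials (s' ++ s) u);
  move=> s'; [apply: smooth_continuous|apply: smooth_is_derive].
Qed.

Lemma partials_cat s s' u : partials (s ++ s') u = partials s (partials s' u).
Proof. by rewrite /partials foldr_cat. Qed.

Lemma nbhs_rVP x (P : set rV) : nbhs x P <->
  exists2 r : R, 0 < r & forall y, (forall i, `|y 0 i| < r) -> P (x + y).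
Proof.
split=> [/nbhs_ballP[r /= r0 xP]|[r r0 xP]].
  exists r => // y yr; apply: xP; split=> // i j.
  by rewrite ord1 /ball /= mxE opprD addrA subrr add0r normrN.
apply/nbhs_ballP; exists r => //= y [_ xy].
rewrite -(subrK x y) addrC; apply: xP => i.
by have := xy 0 i; rewrite /ball /= distrC !mxE.
Qed.

(* Both mixed derivatives are the limit of the second difference quotient. *)
Lemma schwarz u i j : smooth_real u ->
  partials [:: i; j] u = partials [:: j; i] u.
Proof.
move=> su; apply/funext => x; apply/eqP; rewrite -subr_eq0 -normr_eq0.
rewrite eq_le normr_ge0 andbT; apply/ler_addgt0Pl => eps eps0.
have near (i' j' : 'I_d) : exists2 r : R, 0 < r & forall a b : R, `|a| < r ->
    `|b| < r -> `|partials [:: i'; j'] u (x + (a *: e i' + b *: e j')) -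
      partials [:: i'; j'] u x| < eps / 2.
  have /(_ x) cu := @smooth_continuous u [:: i'; j'] su.
  have e20 : 0 < eps / 2 by rewrite divr_gt0.
  move/cvgrPdist_lt/(_ _ e20)/nbhs_rVP: cu => [r r0 xr]; exists (r / 2); first by rewrite divr_gt0.
  move=> a b ar br; rewrite distrC; apply: xr => k; rewrite !mxE eqxx /=.
  rewrite (le_lt_trans (ler_normD _ _))// !normrM.
  have h (q : bool) (c : R) : `|c| < r / 2 -> `|c| * `|q%:R : R| < r / 2.
    by case: q => /=; rewrite ?normr1 ?mulr1 // normr0 mulr0 divr_gt0.
  by rewrite [ltRHS]splitr ltrD ?h.
have alg (a b c z : R) : z - a - (b - c) = z - b - (a - c) by ring.
(* The mean value theorem is applied along e_i' to the increment in direction j', then along e_j' to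
   the first derivative. The second difference itself is symmetric in the two directions. *)
have diff2 (i' j' : 'I_d) (t : R) : 0 < t -> exists a b : R,
   [/\ `|a| <= t, `|b| <= t & u (x + t *: e i' + t *: e j') - u (x + t *: e i')
     - (u (x + t *: e j') - u x)
     = partials [:: j'; i'] u (x + (b *: e j' + a *: e i')) * t * t].
  move=> t0.
  pose g (r : R) := u (x + t *: e j' + r *: e i') - u (x + r *: e i').
  have gd (r : R) : is_derive r (1 : R) g
      (partials [:: i'] u (x + t *: e j' + r *: e i') -
       partials [:: i'] u (x + r *: e i')).
    by apply: is_deriveB; apply: (@smooth_line u [::]).
  have [a /= at_] := mean_value gd t; rewrite /g scale0r !addr0.
  have kd (r : R) := @smooth_line u [:: i'] j' (x + a *: e i') su r.
  have [b bt] := mean_value kd t; rewrite scale0r addr0 => E1 E2.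
  rewrite (gtr0_norm t0) in at_ bt; exists a, b; split => //.
  rewrite [x + t *: e i' + _]addrAC.
  rewrite E2; congr (_ * _); rewrite [b *: _ + _]addrC [x + (_ + _)]addrA -E1.
  by rewrite [x + t *: _ + _]addrAC.
have [r1 r10 near1] := near i j; have [r2 r20 near2] := near j i.
have [t [t0 t1 t2]] : exists t : R, [/\ 0 < t, t < r1 & t < r2].
  have m0 : 0 < Num.min r1 r2 by rewrite lt_min r10.
  have : Num.min r1 r2 / 2 < Num.min r1 r2.
    by rewrite ltr_pdivrMr // mulr2n mulrDr mulr1 ltrDl.
  rewrite lt_min => /andP[? ?]; exists (Num.min r1 r2 / 2); split=> //.
  by rewrite divr_gt0.
have [a [b [at_ bt E]]] := diff2 i j t t0.
have [a' [b' [a't b't E']]] := diff2 j i t t0.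
have {E E'} EE : partials [:: j; i] u (x + (b *: e j + a *: e i)) =
   partials [:: i; j] u (x + (b' *: e i + a' *: e j)).
  apply: (mulIf (lt0r_neq0 t0)); apply: (mulIf (lt0r_neq0 t0)).
  by apply: etrans (etrans (esym E) _) E'; rewrite [x + t *: e i + _]addrAC; apply: alg.
have n1 := near1 b' a' (le_lt_trans b't t1) (le_lt_trans a't t1).
have n2 := near2 b a (le_lt_trans bt t2) (le_lt_trans at_ t2).
rewrite EE in n2; rewrite addr0; exact: close_to_common n1 n2.
Qed.

Lemma partials_perm u s s' : smooth_real u -> perm_eq s s' ->
  partials s u = partials s' u.
Proof.
move=> su.
have swap i j l : partials [:: i, j & l] u = partials [:: j, i & l] u.
  have E := @schwarz (partials l u) i j (smooth_partials l su).
  have E1 := partials_cat [:: i; j] l u.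
  have E2 := partials_cat [:: j; i] l u.
  exact: (etrans E1 (etrans E (esym E2))).
have front i l1 l2 : partials (l1 ++ i :: l2) u = partials (i :: l1 ++ l2) u.
  elim: l1 => [//|j l1 IH].
  rewrite -[partials ((j :: l1) ++ _) u]/(partial j (partials (l1 ++ i :: l2) u)).
  by rewrite IH; exact: swap.
elim: s s' => [s'|i s IH s' ss']; first by rewrite perm_sym => /perm_nilP ->.
have is' : i \in s' by rewrite -(perm_mem ss') mem_head.
case/splitPr: is' ss' => l1 l2 ss'.
rewrite front /=; congr partial; apply: IH.
by move: ss'; rewrite perm_sym perm_catC /= perm_cons perm_sym => /perm_trans -> //; rewrite perm_catC.
Qed.

End Partials.

Section OneVariableLimits.
Context {R : realType}.
Implicit Types (g dg : R -> R).

(** A form without quotients, so that t = 0 is not exceptional and the error can be split into a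
    sum. *)
Lemma is_derive0P g l : is_derive (0 : R) (1 : R) g l <->
  forall eps, 0 < eps -> exists2 r, 0 < r &
    forall t, `|t| < r -> `|g t - g 0 - l * t| <= eps * `|t|.
Proof.
pose q (h : R) := h^-1 *: ((g \o shift 0) (h *: (1 : R)) - g 0).
have qE h : q h = h^-1 * (g h - g 0).
  by rewrite /q /= /shift /= -[h *: 1]/(h * 1) mulr1 addr0.
have eqv (t eps : R) : t != 0 -> (`|l - q t| <= eps) = (`|g t - g 0 - l * t| <= eps * `|t|).
  move=> t0; rewrite -ler_pdivrMr ?normr_gt0 // -normfV -normrM qE distrC.
  by congr (`|_| <= _); field.
split=> [[dg gl] eps eps0|H].
  move: dg; rewrite /derivable -/q => /cvgrPdist_le/(_ _ eps0).
  rewrite /derive -/q in gl; rewrite gl /=.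
  move=> /nbhs_ballP[r /= r0 H]; exists r => // t tr.
  have [->|t0] := eqVneq t 0; first by rewrite subrr mulr0 subrr normr0 mulr0.
  by rewrite -eqv //; apply: H => //; rewrite /ball /= sub0r normrN.
have ql : q h @[h --> 0^'] --> l.
  apply/cvgrPdist_le => eps eps0; have [r r0 Hr] := H _ eps0.
  apply/nbhs_ballP; exists r => //= t; rewrite /ball /= sub0r normrN => tr t0.
  by rewrite /= eqv // Hr.
by split; [apply/cvg_ex; exists l|apply/cvg_lim].
Qed.

(** The mean value inequality for g m - g n bounds its increments by eps n |t| uniformly in m.
    Letting m tend to infinity gives the same bound for G - g n, after which the differentiability
    of a single g n suffices. *)
Lemma is_derive0_termwise (g dg : nat -> R -> R) (eps : R^nat) G H :
  (forall n t, is_derive t (1 : R) (g n) (dg n t)) ->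
  (forall n m t, (n <= m)%N -> `|dg m t - dg n t| <= eps n) ->
  eps n @[n --> \oo] --> 0 ->
  (forall t, g n t @[n --> \oo] --> G t) ->
  dg n 0 @[n --> \oo] --> H ->
  is_derive (0 : R) (1 : R) G H.
Proof.
move=> gd dgC eps0 gG dgH; apply/is_derive0P => e e0.
have e40 : 0 < e / 4 by rewrite divr_gt0.
have [n [ne nH]] : exists n, eps n <= e / 4 /\ `|H - dg n 0| <= e / 4.
  have /cvgrPdist_le/(_ _ e40) N1 := eps0; have /cvgrPdist_le/(_ _ e40) N2 := dgH.
  have [n [n1 n2]] := filter_ex (filterI N1 N2).
  exists n; split=> //; rewrite (le_trans (ler_norm _))// (le_trans _ n1)//.
  by rewrite sub0r normrN.
have [r r0 gr] := (is_derive0P (g n) (dg n 0)).1 (gd n 0) _ e40.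
exists r => // t tr.
have Gg : `|(G t - g n t) - (G 0 - g n 0)| <= eps n * `|t|.
  have c : `|(g m t - g n t) - (g m 0 - g n 0)| @[m --> \oo] -->
      `|(G t - g n t) - (G 0 - g n 0)|.
    apply: cvg_norm; apply: cvgB; apply: cvgB (cvg_cst _); exact: gG.
  apply: (cvgr_to_le c); near=> m.
  have := @lipschitz_of_derive R (fun s => g m s - g n s)
    (fun s => dg m s - dg n s) (eps n) t.
  apply=> // s _; apply: dgC; near: m; exact: nbhs_infty_ge.
have l3 (a b c x y z : R) : `|a - b - (x - y)| <= e / 4 * `|t| ->
    `|b - y - c * t| <= e / 4 * `|t| -> `|z - c| <= e / 4 ->
    `|a - x - z * t| <= e * `|t|.
  move=> h1 h2 h3.
  rewrite (_ : a - x - z * t = (a - b - (x - y)) + (b - y - c * t) - (z - c) * t);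
    last by ring.
  apply: le_trans (ler_normB _ _) _; rewrite normrM.
  have := ler_normD (a - b - (x - y)) (b - y - c * t).
  have := ler_wpM2r (normr_ge0 t) h3.
  have := mulr_ge0 (ltW e0) (normr_ge0 t); lra.
apply: l3 (gr _ tr) nH; apply: le_trans Gg _; exact: ler_wpM2r.
Unshelve. all: by end_near. Qed.

End OneVariableLimits.

Section Continuity.
Context {R : realType} {T : topologicalType}.
Implicit Types f g : T -> R.

Lemma continuous_add f g : continuous f -> continuous g ->
  continuous (fun x => f x + g x).
Proof. by move=> cf cg x; apply: (@continuousD _ _ _ f g x (cf x) (cg x)). Qed.

Lemma continuous_mul f g : continuous f -> continuous g ->
  continuous (fun x => f x * g x).
Proof. by move=> cf cg x; exact: (@continuousM _ _ f g x (cf x) (cg x)). Qed.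

Lemma continuous_const (a : R) : continuous (fun _ : T => a).
Proof. by move=> x; exact: cvg_cst. Qed.

End Continuity.

(** * Derivatives of linear combinations, affine substitutions, products and tensor products *)

Section Constructions.
Context {R : realType} {d : nat}.
Notation rV := 'rV[R]_d.
Implicit Types (u v : rV -> R) (s : seq 'I_d) (x y : rV) (i j : 'I_d).

Notation e i := (delta_mx 0 i : rV).

Lemma continuous_affine (a : R) y : continuous (fun x : rV => y + a *: x).
Proof. by move=> x; apply: (@continuousD _ _ _ (cst y) ( *:%R a)); [exact: cst_continuous|exact: scaler_continuous]. Qed.

Lemma smooth_lin (a : R) u v : smooth_real u -> smooth_real v ->
  smooth_real (fun x => a * u x + v x) /\ forall s,
  partials s (fun x => a * u x + v x) =
  (fun x => a * partials s u x + partials s v x).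
Proof.
move=> su sv.
apply: (@smooth_of_family R d (fun s x => a * partials s u x + partials s v x)).
  move=> s; apply: continuous_add; last exact: smooth_continuous.
  by apply: continuous_mul; [exact: continuous_const|exact: smooth_continuous].
move=> s i x; apply: is_deriveD; first apply: is_deriveZ;
  exact: smooth_is_derive.
Qed.

Lemma smooth_affine (a : R) y u : smooth_real u ->
  smooth_real (fun x => u (y + a *: x)) /\ forall s,
  partials s (fun x => u (y + a *: x)) =
  (fun x => a ^+ size s * partials s u (y + a *: x)).
Proof.
move=> su; pose U s x := a ^+ size s * partials s u (y + a *: x).
have -> : (fun x => u (y + a *: x)) = U [::].
  by apply/funext => x; rewrite /U expr0 mul1r.
apply: (@smooth_of_family R d U).
  move=> s; apply: continuous_mul; first exact: continuous_const.
  move=> x; apply: (@continuous_comp _ _ _ (fun x => y + a *: x) (partials s u)).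
    exact: continuous_affine.
  exact: smooth_continuous.
move=> s i x; rewrite -[X in is_derive X](addr0 x) -(scale0r (e i)).
apply/is_derive_line; rewrite /U /= exprSr -mulrA.
apply: is_deriveZ.
have := @is_derive1_comp R (fun r => partials s u (y + a *: x + r *: e i))
  (fun r => a * r) 0 (partials (i :: s) u (y + a *: x)) a.
rewrite (_ : _ \o _ = (fun r => partials s u (y + a *: (x + r *: e i)))); last first.
  by apply/funext => r /=; rewrite scalerDr scalerA addrA.
rewrite [_ * a]mulrC; apply.
  rewrite mulr0; have := @smooth_line R d u s i (y + a *: x) su 0.
  by rewrite scale0r addr0.
by have := is_deriveZ a (is_derive_id (0 : R) (1 : R)); rewrite -[a *: 1]/(a * 1) mulr1.
Qed.

(** The Leibniz rule without binomial coefficients: every derivative in the list goes to one of two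
    factors, and repetitions are kept as 2^|s| separate terms. *)
Fixpoint splits s : seq (seq 'I_d * seq 'I_d) :=
  if s is i :: s' then
    [seq (i :: p.1, p.2) | p <- splits s'] ++ [seq (p.1, i :: p.2) | p <- splits s']
  else [:: ([::], [::])].

Lemma size_splits s : size (splits s) = (2 ^ size s)%N.
Proof. by elim: s => //= i s IH; rewrite size_cat !size_map IH expnS mul2n addnn. Qed.

Lemma splits_size s p : p \in splits s -> (size p.1 + size p.2)%N = size s.
Proof.
elim: s p => [|i s IH] p /=; first by rewrite inE => /eqP ->.
by rewrite mem_cat => /orP[] /mapP[q /IH <- ->] /=; rewrite ?addSn ?addnS.
Qed.

Lemma smooth_mul u v : smooth_real u -> smooth_real v ->
  smooth_real (fun x => u x * v x) /\ forall s,
  partials s (fun x => u x * v x) =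
  (fun x => \sum_(p <- splits s) partials p.1 u x * partials p.2 v x).
Proof.
move=> su sv.
pose U s x := \sum_(p <- splits s) partials p.1 u x * partials p.2 v x.
have -> : (fun x => u x * v x) = U [::].
  by apply/funext => x; rewrite /U big_seq1.
apply: (@smooth_of_family R d U).
  move=> s; rewrite /U; elim: (splits s) => [|p l IH].
    by under eq_fun do rewrite big_nil; exact: continuous_const.
  under eq_fun do rewrite big_cons.
  apply: continuous_add IH.
  by apply: continuous_mul; exact: smooth_continuous.
move=> s i x; rewrite /U /= big_cat !big_map /= -big_split /=.
elim: (splits s) => [|p l IH].
  under eq_fun do rewrite big_nil; rewrite big_nil; exact: is_derive_cst.
under eq_fun do rewrite big_cons.
rewrite big_cons; apply: is_deriveD.
apply: (is_derive_eq (is_deriveM (@smooth_is_derive R d u su p.1 i x)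
  (@smooth_is_derive R d v sv p.2 i x))).
by rewrite addrC; congr (_ + _); apply: mulrC.
Qed.

Lemma smooth_tensor (c : nat -> R -> R) :
  (forall n t, is_derive t (1 : R) (c n) (c n.+1 t)) ->
  smooth_real (fun x : rV => \prod_i c 0 (x 0 i)) /\ forall s,
  partials s (fun x => \prod_i c 0 (x 0 i)) =
  (fun x => \prod_i c (count_mem i s) (x 0 i)).
Proof.
move=> dc; apply: (@smooth_of_family R d (fun s x => \prod_i c (count_mem i s) (x 0 i))).
  move=> s; elim: (index_enum _) => [|i l IH].
    by under eq_fun do rewrite big_nil; exact: continuous_const.
  under eq_fun do rewrite big_cons.
  apply: continuous_mul IH => x.
  apply: (@continuous_comp _ _ _ (fun x : rV => x 0 i)); first exact: coord_continuous.
  by apply/differentiable_continuous/derivable1_diffP; apply: ex_derive.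
move=> s i x; rewrite -[X in is_derive X](addr0 x) -(scale0r (e i)).
apply/is_derive_line.
rewrite (_ : (fun r => _) = (fun r => \prod_(k | k != i) c (count_mem k s) (x 0 k)
   * c (count_mem i s) (x 0 i + r))); last first.
  apply/funext => r; rewrite (bigD1 i) //= mulrC !mxE !eqxx mulr1; congr (_ * _).
  by apply: eq_bigr => k ki; rewrite !mxE (negbTE ki) andbF mulr0 addr0.
rewrite [X in is_derive _ _ _ X](_ : _ =
   \prod_(k | k != i) c (count_mem k s) (x 0 k) * c (count_mem i s).+1 (x 0 i));
  last first.
  rewrite (bigD1 i) //= eqxx add1n mulrC; congr (_ * _).
  by apply: eq_bigr => k ki; rewrite eq_sym (negbTE ki) add0n.
apply: is_deriveZ.
have := @is_derive1_comp R (c (count_mem i s)) (fun r => x 0 i + r) 0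
  (c (count_mem i s).+1 (x 0 i)) 1.
rewrite mulr1; apply; first by rewrite addr0.
by have := is_deriveD (is_derive_cst (x 0 i) (0 : R) (1 : R)) (is_derive_id (0 : R) (1 : R));
  rewrite add0r.
Qed.

End Constructions.

Section RealSequences.
Context {R : realType}.
Implicit Types (a eps : R^nat).

Lemma cvg_of_cauchy_bound a eps : eps n @[n --> \oo] --> 0 ->
  (forall n m, (n <= m)%N -> `|a m - a n| <= eps n) -> cvg (a n @[n --> \oo]).
Proof.
move=> eps0 aC; apply: cauchy_cvg; apply: cauchy_exP => e e0.
have /cvgrPdist_lt/(_ _ e0)[N _ NP] := eps0.
exists (a N); exists N => // m /= Nm; rewrite /ball /= distrC.
apply: le_lt_trans (aC _ _ Nm) _; apply: le_lt_trans (ler_norm _) _.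
by have := NP N (leqnn N); rewrite /= sub0r normrN.
Qed.

Lemma limit_cauchy_bound a eps l :
  (forall n m, (n <= m)%N -> `|a m - a n| <= eps n) -> a n @[n --> \oo] --> l ->
  forall n, `|l - a n| <= eps n.
Proof.
move=> aC al n.
have c : `|a m - a n| @[m --> \oo] --> `|l - a n|.
  by apply: cvg_norm; apply: cvgB al (cvg_cst _).
apply: (cvgr_to_le c); near=> m; apply: aC; near: m; exact: nbhs_infty_ge.
Unshelve. all: by end_near. Qed.

End RealSequences.

Section BoundedPartials.
Context {R : realType} {d : nat}.
Notation rV := 'rV[R]_d.
Implicit Types (u v : rV -> R) (s : seq 'I_d) (x y : rV) (i j : 'I_d).

Notation e i := (delta_mx 0 i : rV).

(* The increment is split along the coordinate directions: [z n] keeps the first [n] coordinates. *)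
Lemma lipschitz_of_partials v (D : 'I_d -> rV -> R) x (r K Y : R) :
  (forall i x, is_derive x (e i) v (D i x)) ->
  (forall z : rV, (forall i, `|z 0 i| < r) -> forall i, `|D i (x + z)| <= K) ->
  Y < r -> forall y : rV, (forall i, `|y 0 i| <= Y) -> `|v (x + y) - v x| <= d%:R * K * Y.
Proof.
move=> dv DK Yr y yY.
have [d0|d0] := posnP d.
  have -> : y = 0 by apply/rowP => i; have := ltn_ord i; rewrite {2}d0.
  by rewrite addr0 subrr normr0 d0 !mul0r.
have Y0 : 0 <= Y by apply: le_trans (yY (Ordinal d0)); exact: normr_ge0.
have K0 : 0 <= K.
  apply: le_trans (DK 0 _ (Ordinal d0)) => // i.
  by rewrite mxE normr0 (le_lt_trans Y0).
pose z n : rV := \row_j (if (j < n)%N then y 0 j else 0).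
have step n : (n <= d)%N -> `|v (x + z n) - v x| <= n%:R * K * Y.
  elim: n => [_|n IH nd].
    rewrite (_ : z 0%N = 0); last by apply/rowP => j; rewrite !mxE.
    by rewrite addr0 subrr normr0 !mul0r.
  pose i := Ordinal nd.
  have zS : z n.+1 = z n + y 0 i *: e i.
    apply/rowP => j; rewrite !mxE eqxx /= ltnS leq_eqVlt.
    rewrite -[(j == i)]/(j == n :> nat).
    have [jn|jn] := eqVneq (j : nat) n; last by rewrite mulr0 addr0.
    rewrite jn ltnn mulr1 add0r /=; congr (y 0 _); exact: val_inj.
  have g (t : R) := (is_derive_line v (x + z n) (e i) t _).2 (dv i _).
  have := lipschitz_of_derive g (K := K) (t := y 0 i) _.
  rewrite scale0r addr0 zS addrA => h.
  have {}h : `|v (x + z n + y 0 i *: e i) - v (x + z n)| <= K * `|y 0 i|.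
    apply: h => s sy; rewrite -addrA; apply: DK => j; rewrite !mxE eqxx /=.
    rewrite -[(j == i)]/(j == n :> nat); case: ltnP => jn.
      by rewrite (ltn_eqF jn) mulr0 addr0 (le_lt_trans (yY j)).
    rewrite add0r normrM (le_lt_trans _ Yr) //; apply: le_trans (yY i).
    apply: le_trans sy; rewrite -[leRHS]mulr1 ler_wpM2l //.
    by case: (_ == _); rewrite ?normr1 ?normr0.
  have h2 : K * `|y 0 i| <= K * Y by apply: ler_wpM2l.
  have := IH (ltnW nd); rewrite -natr1 => h3.
  have -> : v (x + z n + y 0 i *: e i) - v x =
    (v (x + z n + y 0 i *: e i) - v (x + z n)) + (v (x + z n) - v x).
    by rewrite addrA subrK.
  apply: le_trans (ler_normD _ _) _.
  apply: le_trans (lerD (le_trans h h2) h3) _.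
  by rewrite !mulrDl mul1r addrC.
have := step d (leqnn d); rewrite (_ : z d = y) //.
by apply/rowP => j; rewrite mxE ltn_ord.
Qed.

(** Locally bounded partial derivatives make v locally Lipschitz. For the derivatives of a
    convolution, local bounds come directly from the continuity of the functional, and this turns
    them into continuity. *)
Lemma continuous_of_bounded_partials v (D : 'I_d -> rV -> R) :
  (forall i x, is_derive x (e i) v (D i x)) ->
  (forall x, exists r K : R, 0 < r /\
     forall z : rV, (forall i, `|z 0 i| < r) -> forall i, `|D i (x + z)| <= K) ->
  continuous v.
Proof.
move=> dv DK x; apply/(@cvgrPdist_lt _ _ _ (nbhs x)) => eps eps0.
have [r [K [r0 rK]]] := DK x.
pose K' := `|K| + 1; have K'0 : 0 < K' by rewrite ltr_wpDl.
have den : 0 < d%:R * K' + 1 by rewrite ltr_wpDl // mulr_ge0 // ltW.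
apply/nbhs_rVP; exists (Num.min (r / 2) (eps / (d%:R * K' + 1))).
  by rewrite lt_min !divr_gt0.
move=> y yr; rewrite distrC.
set Y := Num.min _ _ in yr.
have Y0 : 0 < Y by rewrite lt_min !divr_gt0.
have Yr : Y < r.
  by rewrite /Y gt_min; apply/orP; left; rewrite ltr_pdivrMr // ltr_pMr // ltr1n.
have rK' (z : rV) : (forall i, `|z 0 i| < r) -> forall i, `|D i (x + z)| <= K'.
  move=> zr i; apply: le_trans (rK z zr i) _; rewrite /K'.
  by rewrite (le_trans (ler_norm _)) // lerDl.
have := lipschitz_of_partials dv rK' Yr (fun i => ltW (yr i)).
move=> /le_lt_trans; apply.
have Ye : Y <= eps / (d%:R * K' + 1) by rewrite /Y ge_min lexx orbT.
rewrite -[ltRHS](@divfK _ (d%:R * K' + 1)) ?gt_eqF // mulrC.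
apply: le_lt_trans (ler_wpM2r _ Ye) _; first by rewrite mulr_ge0 // ltW.
by rewrite ltr_pM2l ?divr_gt0 // ltrDl.
Qed.

Lemma three_eps (a b p q e' t : R) : `|a - p| <= t -> `|b - q| <= t ->
  `|p - q| < e' / 3 -> t < e' / 3 -> `|a - b| < e'.
Proof.
move=> h1 h2 h3 h4; rewrite (_ : a - b = (a - p) + (p - q) - (b - q)); last by ring.
have := ler_normB (a - p + (p - q)) (b - q).
have := ler_normD (a - p) (p - q); lra.
Qed.

(** Each partial derivative converges uniformly, hence to a continuous limit; termwise
    differentiation along coordinate lines shows that these limits are derivatives of one
    another. *)
Lemma smooth_limit (u : nat -> rV -> R) (eps : seq 'I_d -> R^nat) phi :
  (forall n, smooth_real (u n)) ->
  (forall s, eps s n @[n --> \oo] --> 0) ->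
  (forall s n m x, (n <= m)%N -> `|partials s (u m) x - partials s (u n) x| <= eps s n) ->
  (forall x, u n x @[n --> \oo] --> phi x) ->
  smooth_real phi /\ forall s x, partials s (u n) x @[n --> \oo] --> partials s phi x.
Proof.
move=> su eps0 uC uphi.
pose U s x := lim (partials s (u n) x @[n --> \oo]).
have cU s x : partials s (u n) x @[n --> \oo] --> U s x.
  by apply: (@cvg_of_cauchy_bound R _ (eps s)) => // n m nm; exact: uC.
have UE s x n : `|U s x - partials s (u n) x| <= eps s n.
  by apply: (limit_cauchy_bound (eps := eps s)) (cU s x) n => n m; exact: uC.
have E0 : phi = U [::].
  apply/funext => x; exact: (cvg_unique (@norm_hausdorff _ _) (uphi x) (cU [::] x)).
have [] := @smooth_of_family R d U.
- move=> s x; apply/(@cvgrPdist_lt _ _ _ (nbhs x)) => e e0.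
  have e30 : 0 < e / 3 by rewrite divr_gt0.
  have /cvgrPdist_lt/(_ _ e30)[N _ /(_ N (leqnn N))] := eps0 s.
  rewrite sub0r normrN => /(le_lt_trans (ler_norm _)) eN.
  have /cvgrPdist_lt/(_ _ e30) := @smooth_continuous _ _ (u N) s (su N) x.
  apply: filterS => y xy.
  move: (UE s x N) (UE s y N) => h1 h2.
  exact: three_eps h1 h2 xy eN.
- move=> s i x; rewrite -[X in is_derive X](addr0 x) -(scale0r (e i)).
  apply/is_derive_line.
  apply: (@is_derive0_termwise R (fun n r => partials s (u n) (x + r *: e i))
    (fun n r => partials (i :: s) (u n) (x + r *: e i)) (eps (i :: s))) => //.
  + by move=> n t; apply: smooth_line.
  + by move=> n m t nm; apply: uC.
  + by rewrite scale0r addr0; exact: cU.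
- by move=> sU UU; rewrite E0; split=> // s x; rewrite UU.
Qed.

End BoundedPartials.

(** * The associated function *)

Section WeightSequenceTheory.
Context {R : realType}.
Implicit Types (M A : R^nat) (t B : R).

(** Under (M.1) the quotients M_{p+1} / M_p are nondecreasing, which is [ratio] without
    denominators; the p quotients below M_p are therefore at most those between M_q and M_{p+q}. *)
Lemma M1_superadditive M : (forall p, 0 < M p) -> M1 M ->
  forall p q, M p * M q <= M 0%N * M (p + q)%N.
Proof.
move=> M0 M1M.
have ratio p q : M p.+1 * M (p + q)%N <= M p * M (p + q).+1.
  elim: q => [|q IH]; first by rewrite addn0 mulrC.
  rewrite addnS -(ler_pM2r (M0 (p + q)%N)) -(ler_pM2l (M0 (p + q).+1)).
  have := M1M (p + q).+1 isT; rewrite /= => h.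
  have h1 := ler_wpM2l (ltW (mulr_gt0 (M0 (p + q).+1) (M0 (p + q).+1))) IH.
  have h2 := ler_wpM2l (ltW (mulr_gt0 (M0 p) (M0 (p + q).+1))) h.
  nra.
move=> p; elim: p => [q|p IH q]; first by rewrite add0n.
have := ratio p q; rewrite addSn => h.
rewrite -(ler_pM2r (M0 p)); have := ler_wpM2l (ltW (M0 0%N)) h.
have := ler_wpM2l (ltW (M0 p.+1)) (IH q); nra.
Qed.

(** For t > 0 this is sup_p t^p A_0 / A_p, and 1 otherwise. Working with the exponential replaces
    logarithms by comparisons with single terms. *)
Definition expassoc A t := expR (assoc A t).

(** Once A_{p+1} / A_p >= t the terms decrease, so the sum of the terms up to that index bounds all
    of them. *)
Lemma weight_term_bounded A t : weight_sequence A -> 0 < t ->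
  exists B, forall p, t ^+ p * A 0%N / A p <= B.
Proof.
move=> [A0 Ay] t0; have /cvgryPge/(_ t)[N _ NP] := Ay.
have term0 p : 0 <= t ^+ p * A 0%N / A p.
  by rewrite divr_ge0 ?mulr_ge0 ?exprn_ge0 // ltW.
have le_sum p : (p <= N)%N -> t ^+ p * A 0%N / A p <=
    \sum_(q < N.+1) t ^+ q * A 0%N / A q.
  move=> pN; rewrite (bigD1 (inord p : 'I_N.+1)) //= inordK // lerDl.
  by apply: sumr_ge0 => *; apply: term0.
exists (\sum_(q < N.+1) t ^+ q * A 0%N / A q) => p.
have [/le_sum//|/ltnW Np] := leqP p N.
apply: le_trans (le_sum N (leqnn N)).
rewrite -(subnK Np); elim: (p - N)%N => // n IH; apply: le_trans IH.
rewrite addSn exprS -[_ * _ * A 0%N / _]mulrA -[t * _ * _]mulrA mulrC -mulrA.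
have /= := NP (n + N)%N (leq_addl _ _); rewrite ler_pdivlMr // => h.
rewrite -!mulrA ler_wpM2l ?exprn_ge0 ?(ltW t0) // ler_wpM2l ?(ltW (A0 _)) //.
by rewrite mulrC ler_pdivrMr // mulrC ler_pdivlMr // mulrC.
Qed.

Variable (A : R^nat).
Hypothesis wA : weight_sequence A.
Let A0 := wA.1.
Notation E := (expassoc A).

Lemma expassoc_ge_term t p : 0 <= t -> t ^+ p * A 0%N / A p <= E t.
Proof.
rewrite le_eqVlt => /predU1P[<-|t0]; rewrite /expassoc /assoc.
  rewrite ltxx expR0; case: p => [|p].
    by rewrite expr0 mul1r divff // gt_eqF.
  by rewrite expr0n /= !mul0r.
have tp : 0 < t ^+ p * A 0%N / A p by rewrite divr_gt0 ?mulr_gt0 ?exprn_gt0.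
rewrite t0 -[leLHS]lnK ?posrE // ler_expR; apply: sup_upper_bound; last by exists p.
split; first by exists (ln (t ^+ p * A 0%N / A p)), p.
have [B HB] := weight_term_bounded wA t0.
exists (ln B) => _ [q _ <-]; rewrite ler_ln ?posrE //.
  by rewrite divr_gt0 ?mulr_gt0 ?exprn_gt0.
by apply: lt_le_trans (HB q); rewrite divr_gt0 ?mulr_gt0 ?exprn_gt0.
Qed.

Lemma expassoc_le t B : 1 <= B -> (forall p, t ^+ p * A 0%N / A p <= B) -> E t <= B.
Proof.
move=> B1 HB; rewrite /expassoc /assoc; case: ifP => [t0|_]; last by rewrite expR0.
have B0 : 0 < B by apply: lt_le_trans B1.
rewrite -[leRHS]lnK ?posrE // ler_expR; apply: sup_le_ub.
  by exists (ln (t ^+ 0 * A 0%N / A 0%N)), 0%N.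
move=> _ [p _ <-]; rewrite ler_ln ?posrE //.
by rewrite divr_gt0 ?mulr_gt0 ?exprn_gt0.
Qed.

Lemma expassoc_ge1 t : 1 <= E t.
Proof.
have [t0|t0] := leP 0 t; last by rewrite /expassoc /assoc (ltNge 0 t) (ltW t0) expR0.
by have := expassoc_ge_term 0 t0; rewrite expr0 mul1r divff // gt_eqF.
Qed.

Lemma expassoc_gt0 t : 0 < E t. Proof. exact: expR_gt0. Qed.

Lemma expassoc_mono s t : 0 <= s -> s <= t -> E s <= E t.
Proof.
move=> s0 st; apply: expassoc_le => [|p]; first exact: expassoc_ge1.
apply: le_trans (expassoc_ge_term p (le_trans s0 st)).
by rewrite -!mulrA ler_wpM2r ?divr_ge0 ?(ltW (A0 _)) // lerXn2r ?nnegrE // (le_trans s0).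
Qed.

(** By (M.2), the product of the terms of order p and q at t is at most C0 A_0 times the term of
    order p + q at H t. The suprema over p and q are then taken one after the other. *)
Lemma expassoc_sqr : M2 A -> exists C H : R, [/\ 1 <= C, 1 <= H &
  forall t, 0 <= t -> E t * E t <= C * E (H * t)].
Proof.
move=> [C0 [H [C01 H1 MA]]]; exists (C0 * A 0%N + 1), H.
have C0A : 0 < C0 * A 0%N by rewrite mulr_gt0 // (lt_le_trans ltr01).
split; [by rewrite lerDr ltW|exact: H1|].
move=> t; rewrite le_eqVlt => /predU1P[<-|t0].
  rewrite mulr0 /expassoc /assoc ltxx expR0 !mulr1 lerDr ltW //.
have Ht0 : 0 <= H * t by rewrite mulr_ge0 ?(ltW t0) ?(le_trans ler01).
set B := (_ + _) * _.
have term0 p : 0 < t ^+ p * A 0%N / A p by rewrite divr_gt0 ?mulr_gt0 ?exprn_gt0.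
have termM p q : (t ^+ p * A 0%N / A p) * (t ^+ q * A 0%N / A q) <= B.
  have h : (t ^+ p * A 0%N / A p) * (t ^+ q * A 0%N / A q) <=
     (C0 * A 0%N) * ((H * t) ^+ (p + q) * A 0%N / A (p + q)%N).
    rewrite (_ : _ * (t ^+ q * _ / _) =
      (t ^+ (p + q) * A 0%N ^+ 2) * ((A p * A q)^-1)); last first.
      by rewrite exprD; field; rewrite !gt_eqF.
    rewrite (_ : C0 * _ * _ = (t ^+ (p + q) * A 0%N ^+ 2) *
      (C0 * H ^+ (p + q) / A (p + q)%N)); last first.
      by rewrite exprMn; field; rewrite !gt_eqF.
    rewrite ler_wpM2l ?mulr_ge0 ?exprn_ge0 ?(ltW t0) ?(ltW (A0 _)) //.
    rewrite ler_pdivlMr // mulrC ler_pdivrMr ?mulr_gt0 // mulrA; exact: MA.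
  apply: le_trans h _; apply: ler_pM => //; first exact: ltW.
  - by rewrite divr_ge0 ?mulr_ge0 ?exprn_ge0 // ltW.
  - by rewrite lerDl.
  - exact: expassoc_ge_term.
have E0 := expassoc_gt0 t.
clearbody B.
have h q : E t <= B / (t ^+ q * A 0%N / A q).
  apply: expassoc_le => [|p]; last by rewrite ler_pdivlMr.
  rewrite ler_pdivlMr // mul1r; apply: le_trans (termM 0%N q).
  by rewrite expr0 mul1r divff ?mul1r // gt_eqF.
rewrite -ler_pdivlMr //; apply: expassoc_le => [|p].
  by rewrite ler_pdivlMr // mul1r; have := h 0%N; rewrite expr0 mul1r divff ?gt_eqF // divr1.
by rewrite ler_pdivlMr // mulrC -ler_pdivlMr.
Qed.

End WeightSequenceTheory.

Section EuclideanNorm.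
Context {R : realType} {d : nat}.
Implicit Types (x y : 'rV[R]_d) (i : 'I_d).

Lemma enorm_ge0 x : 0 <= enorm x. Proof. exact: sqrtr_ge0. Qed.

Lemma enorm_sqr x : enorm x ^+ 2 = \sum_i x 0 i ^+ 2.
Proof. by rewrite sqr_sqrtr // sumr_ge0 // => i _; rewrite sqr_ge0. Qed.

Lemma enormN x : enorm (- x) = enorm x.
Proof. by congr Num.sqrt; apply: eq_bigr => i _; rewrite mxE sqrrN. Qed.

Lemma enorm_sign (a : R) x : a ^+ 2 = 1 -> enorm (a *: x) = enorm x.
Proof.
by move=> a1; congr Num.sqrt; apply: eq_bigr => i _; rewrite mxE exprMn a1 mul1r.
Qed.

Lemma coord_le_enorm x i : `|x 0 i| <= enorm x.
Proof.
rewrite -sqrtr_sqr ler_sqrt; last by rewrite sumr_ge0 // => j _; rewrite sqr_ge0.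
by rewrite (bigD1 i) //= lerDl sumr_ge0 // => j _; rewrite sqr_ge0.
Qed.

Lemma enorm_le_coord x (Y : R) : (forall i, `|x 0 i| <= Y) -> enorm x <= d%:R * Y.
Proof.
move=> xY; have [d0|d0] := posnP d.
  by rewrite /enorm big1 ?sqrtr0 ?d0 ?mul0r // => i; have := ltn_ord i; rewrite {2}d0.
have Y0 : 0 <= Y by apply: le_trans (xY (Ordinal d0)); exact: normr_ge0.
rewrite -[leRHS]ger0_norm ?mulr_ge0 // -sqrtr_sqr ler_sqrt ?sqr_ge0 //.
apply: (@le_trans _ _ (\sum_(i < d) Y ^+ 2)).
  by apply: ler_sum => i _; rewrite -real_normK ?num_real // lerXn2r ?nnegrE.
rewrite sumr_const card_ord -[leLHS]mulr_natl exprMn ler_wpM2r ?sqr_ge0 //.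
by rewrite -natrX ler_nat -{1}(expn1 d) leq_pexp2l.
Qed.

(** Lets a single one-variable factor of a tensor product carry the whole weight in the Euclidean
    norm. *)
Lemma enorm_coord_attained x : (0 < d)%N -> exists i, enorm x <= d%:R * `|x 0 i|.
Proof.
move=> d0; case: (@arg_maxP _ _ _ (Ordinal d0) xpredT (fun i => `|x 0 i|)) => // i _ xi.
by exists i; apply: enorm_le_coord => j; apply: xi.
Qed.

(** Coordinatewise (a + b)^2 <= 2 a^2 + 2 b^2. The form with a maximum suits a monotone weight >= 1:
    its value at the maximum is one of two values, and the other can be multiplied in. *)
Lemma enorm_add_le_max x y : enorm (x + y) <= 2 * Num.max (enorm x) (enorm y).
Proof.
set m := Num.max _ _; have m0 : 0 <= m by rewrite le_max enorm_ge0.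
rewrite -[leRHS]ger0_norm ?mulr_ge0 // -sqrtr_sqr ler_sqrt ?sqr_ge0 //.
have xm : enorm x ^+ 2 <= m ^+ 2 by rewrite lerXn2r ?nnegrE ?enorm_ge0 // le_max lexx.
have ym : enorm y ^+ 2 <= m ^+ 2.
  by rewrite lerXn2r ?nnegrE ?enorm_ge0 // le_max lexx orbT.
rewrite !enorm_sqr in xm ym.
apply: (@le_trans _ _ (\sum_i (2 * x 0 i ^+ 2 + 2 * y 0 i ^+ 2))).
  by apply: ler_sum => i _; rewrite mxE; have := sqr_ge0 (x 0 i - y 0 i); nra.
rewrite big_split /= -!mulr_sumr; nra.
Qed.

End EuclideanNorm.

Section ExpassocEnorm.
Context {R : realType} {d : nat} (A : R^nat) (wA : weight_sequence A).
Implicit Types (x y : 'rV[R]_d) (h l : R).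
Notation E := (expassoc A).

Lemma expassoc_enorm_add x y h : 0 <= h ->
  E (h * enorm (x + y)) <= E (2 * h * enorm x) * E (2 * h * enorm y).
Proof.
move=> h0.
apply: (@le_trans _ _ (E (h * (2 * Num.max (enorm x) (enorm y))))).
  by apply: expassoc_mono => //; rewrite ?mulr_ge0 ?enorm_ge0 // ler_wpM2l // enorm_add_le_max.
rewrite mulrCA mulrA; case: (leP (enorm x) (enorm y)) => _.
  by rewrite ler_peMl ?expassoc_ge1 // ltW // expassoc_gt0.
by rewrite ler_peMr ?expassoc_ge1 // ltW // expassoc_gt0.
Qed.

Lemma prod_sqr_le x : \prod_i (1 + x 0 i ^+ 2) <= 2 ^+ d * (1 + enorm x ^+ (2 * d)).
Proof.
have s0 : 0 <= enorm x ^+ 2 by exact: sqr_ge0.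
apply: (@le_trans _ _ ((1 + enorm x ^+ 2) ^+ d)).
  rewrite -[X in _ ^+ X]card_ord -prodr_const; apply: ler_prod => i _.
  rewrite addr_ge0 ?sqr_ge0 //= lerD2l -real_normK ?num_real //.
  by rewrite lerXn2r ?nnegrE ?enorm_ge0 // coord_le_enorm.
rewrite exprM; move: (enorm x ^+ 2) s0 => s s0.
have p1 : 0 <= 1 + s by lra.
have p2 : 0 <= 2 * s by lra.
have [s1|s1] := leP s 1.
  apply: (@le_trans _ _ (2 ^+ d)); first by rewrite lerXn2r ?nnegrE //; lra.
  by rewrite ler_peMr ?exprn_ge0 // lerDl exprn_ge0.
apply: (@le_trans _ _ ((2 * s) ^+ d)); first by rewrite lerXn2r ?nnegrE //; lra.
by rewrite exprMn ler_wpM2l ?exprn_ge0 // lerDr.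
Qed.

(** The exponential weight dominates its terms of order 0 and 2 d, and these two control the
    product. *)
Lemma prod_sqr_le_expassoc l : 0 < l ->
  exists2 C : R, 0 < C & forall x, \prod_i (1 + x 0 i ^+ 2) <= C * E (l * enorm x).
Proof.
move=> l0; pose K := A (2 * d)%N / A 0%N / l ^+ (2 * d).
have K0 : 0 < K by rewrite !divr_gt0 ?exprn_gt0 //; case: wA.
exists (2 ^+ d * (1 + K)); first by rewrite mulr_gt0 ?exprn_gt0 ?addr_gt0.
move=> x; apply: le_trans (prod_sqr_le x) _; rewrite -mulrA ler_wpM2l ?exprn_ge0 //.
rewrite mulrDl mul1r lerD ?expassoc_ge1 //.
have := expassoc_ge_term wA (2 * d)%N (mulr_ge0 (ltW l0) (enorm_ge0 x)).
move=> /(ler_wpM2l (ltW K0)); apply: le_trans.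
rewrite /K exprMn le_eqVlt; apply/orP; left; apply/eqP; field.
by rewrite !gt_eqF ?exprn_gt0 //; case: wA.
Qed.

End ExpassocEnorm.

(** * Weighted bounds on derivatives *)

Section RealBounds.
Context {R : realType} {d : nat} (M : R^nat) (M_gt0 : forall p, 0 < M p).
Notation rV := 'rV[R]_d.
Implicit Types (u v w : rV -> R) (s : seq 'I_d) (x y : rV) (h K C : R).

(* Quantifying over all lists of indices instead of multi-indices costs nothing,
   by Schwarz' theorem, and makes iterated derivatives compose. *)
Definition snorm_le h w u K := smooth_real u /\ forall s x,
  h ^+ size s * `|partials s u x| * w x <= K * M (size s).

Lemma snorm_le_ge0 h w u K : 0 <= w 0 -> snorm_le h w u K -> 0 <= K.
Proof.
move=> w0 [_ /(_ [::] 0)]; rewrite /= expr0 mul1r => h1.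
by rewrite -(pmulr_lge0 _ (M_gt0 0%N)) (le_trans _ h1) // mulr_ge0.
Qed.

Lemma snorm_le_weaken h h' w w' u K K' C : 0 <= h' -> h' <= h -> 0 <= C ->
  (forall x, 0 <= w' x <= C * w x) -> C * K <= K' -> snorm_le h w u K -> snorm_le h' w' u K'.
Proof.
move=> h'0 h'h C0 w'w CK [su uK]; split=> // s x; have /andP[w'0 w'C] := w'w x.
apply: (@le_trans _ _ (C * K * M (size s))); last by rewrite ler_wpM2r // ltW.
apply: (@le_trans _ _ (C * (h ^+ size s * `|partials s u x| * w x))); last first.
  by rewrite -[leRHS]mulrA ler_wpM2l.
rewrite mulrCA; apply: ler_pM => //.
  by rewrite mulr_ge0 ?exprn_ge0.
by rewrite ler_wpM2r // lerXn2r ?nnegrE // (le_trans h'0).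
Qed.

Lemma snorm_le_lin h w u v K K' (a : R) : 0 <= h -> (forall x, 0 <= w x) ->
  snorm_le h w u K -> snorm_le h w v K' -> snorm_le h w (fun x => a * u x + v x) (`|a| * K + K').
Proof.
move=> h0 w0 [su uK] [sv vK]; have [sl lE] := smooth_lin a su sv.
split=> // s x; rewrite lE mulrDl.
apply: (@le_trans _ _ (`|a| * (h ^+ size s * `|partials s u x| * w x)
    + h ^+ size s * `|partials s v x| * w x)); last first.
  by rewrite lerD // -[leRHS]mulrA ler_wpM2l.
rewrite [leRHS](_ : _ = h ^+ size s * (`|a * partials s u x| + `|partials s v x|) * w x);
  last by rewrite normrM; ring.
by rewrite ler_wpM2r // ler_wpM2l ?exprn_ge0 // ler_normD.
Qed.

Lemma snorm_le_affine h w u K (a : R) y : a ^+ 2 = 1 -> snorm_le h w u K ->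
  snorm_le h (fun x => w (y + a *: x)) (fun x => u (y + a *: x)) K.
Proof.
move=> a1 [su uK]; have [sa aE] := smooth_affine a y su; split=> // s x.
have na : `|a| = 1.
  by apply/eqP; rewrite -(@pexpr_eq1 _ _ 2) // -normrX a1 normr1.
by rewrite aE normrM normrX na expr1n mul1r; apply: uK.
Qed.

(** The 2^n Leibniz terms are absorbed by passing from h to h / 2, and M_p M_q <= M_0 M_{p+q}
    recombines the two bounds. *)
Lemma snorm_le_mul h w w1 w2 u v K1 K2 : M1 M -> 0 < h -> (forall x, 0 <= w1 x) ->
  (forall x, 0 <= w2 x) -> (forall x, 0 <= w x <= w1 x * w2 x) ->
  snorm_le h w1 u K1 -> snorm_le h w2 v K2 ->
  snorm_le (h / 2) w (fun x => u x * v x) (M 0%N * K1 * K2).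
Proof.
move=> M1M h0 w10 w20 w12 ubu ubv; have [su uK] := ubu; have [sv vK] := ubv.
have K10 := snorm_le_ge0 (w10 0) ubu; have K20 := snorm_le_ge0 (w20 0) ubv.
have [sm mE] := smooth_mul su sv; split=> // s x; rewrite mE.
have /andP[wx0 wx12] := w12 x.
set n := size s.
have h20 : 0 <= (h / 2) ^+ n by rewrite exprn_ge0 // divr_ge0 // ltW.
apply: (@le_trans _ _ ((h / 2) ^+ n *
    (\sum_(p <- splits s) `|partials p.1 u x| * `|partials p.2 v x|) * (w1 x * w2 x))).
  apply: ler_pM; rewrite ?mulr_ge0 ?normr_ge0 // ler_wpM2l //.
  apply: le_trans (ler_norm_sum _ _ _) _.
  by rewrite le_eqVlt; apply/orP; left; apply/eqP; apply: eq_bigr => p _; rewrite normrM.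
rewrite [leLHS](_ : _ = \sum_(p <- splits s) (1 / 2) ^+ n *
    ((h ^+ size p.1 * `|partials p.1 u x| * w1 x) *
     (h ^+ size p.2 * `|partials p.2 v x| * w2 x))); last first.
  rewrite mulr_sumr mulr_suml !big_seq; apply: eq_bigr => p /splits_size ps.
  by rewrite exprMn exprVn expr_div_n expr1n mul1r /n -ps exprD; ring.
apply: (@le_trans _ _ (\sum_(p <- splits s) (1 / 2) ^+ n * (M 0%N * K1 * K2 * M n))).
  rewrite !big_seq; apply: ler_sum => p /splits_size ps.
  rewrite ler_wpM2l ?exprn_ge0 //.
  apply: (@le_trans _ _ ((K1 * M (size p.1)) * (K2 * M (size p.2)))).
    by apply: ler_pM; rewrite ?mulr_ge0 ?exprn_ge0 ?(ltW h0).
  rewrite (_ : _ * (K2 * _) = K1 * K2 * (M (size p.1) * M (size p.2))); last by ring.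
  rewrite (_ : M 0%N * _ * _ * _ = K1 * K2 * (M 0%N * M n)); last by ring.
  rewrite ler_wpM2l ?mulr_ge0 // /n -ps; exact: M1_superadditive.
rewrite big_const_seq count_predT size_splits iter_addr_0 -[leLHS]mulr_natl natrX mulrA -exprMn.
by rewrite (_ : 2 * (1 / 2) = 1 :> R) ?expr1n ?mul1r //; field.
Qed.

(** (M.2) separates the order of s0 from the remaining order; the factor H to the remaining order is
    absorbed by passing from h to h / H. *)
Lemma snorm_le_partials (C0 H : R) h w u K s0 : 1 <= C0 -> 1 <= H ->
  (forall p q, M (p + q)%N <= C0 * H ^+ (p + q) * M p * M q) ->
  0 < h -> (forall x, 0 <= w x) -> snorm_le h w u K ->
  snorm_le (h / H) w (partials s0 u) (K * (C0 * (H / h) ^+ size s0 * M (size s0))).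
Proof.
move=> C01 H1 MM h0 w0 ubu; have [su uK] := ubu; have K0 := snorm_le_ge0 (w0 0) ubu.
have H0 : 0 < H by apply: lt_le_trans H1.
split=> [|s x]; first exact: smooth_partials.
rewrite -partials_cat; have := uK (s ++ s0) x; rewrite size_cat => h1.
have hp : 0 < H ^+ size s * h ^+ size s0 by rewrite mulr_gt0 ?exprn_gt0.
rewrite -(ler_pM2l hp).
rewrite [leLHS](_ : _ = h ^+ (size s + size s0) * `|partials (s ++ s0) u x| * w x); last first.
  by rewrite expr_div_n exprD; field; rewrite expf_neq0 // gt_eqF.
apply: le_trans h1 _; rewrite [leRHS](_ : _ = K * (C0 * H ^+ (size s + size s0)
  * M (size s) * M (size s0))); first by rewrite ler_wpM2l.
by rewrite expr_div_n exprD; field; rewrite expf_neq0 // gt_eqF.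
Qed.

Lemma partials_sub u v : smooth_real u -> smooth_real v ->
  smooth_real (fun x => u x - v x) /\ forall s,
  partials s (fun x => u x - v x) = (fun x => partials s u x - partials s v x).
Proof.
move=> su sv; have [] := smooth_lin (-1) sv su.
rewrite (_ : (fun x => -1 * v x + u x) = (fun x => u x - v x)); last first.
  by apply/funext => x; rewrite mulN1r addrC.
by move=> h1 h2; split=> // s; rewrite h2; apply/funext => x; rewrite mulN1r addrC.
Qed.

(** As w >= 1, the weighted Cauchy bounds are in particular uniform, so the limit is smooth with the
    expected derivatives. The weighted bounds then pass to the limit at each point. *)
Lemma snorm_le_limit h w (u : nat -> rV -> R) (eps : R^nat) phi :
  0 < h -> (forall x, 1 <= w x) -> (forall n, smooth_real (u n)) ->
  eps n @[n --> \oo] --> 0 ->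
  (forall n m, (n <= m)%N -> snorm_le h w (fun x => u m x - u n x) (eps n)) ->
  (forall x, u n x @[n --> \oo] --> phi x) ->
  forall n, snorm_le h w (fun x => phi x - u n x) (eps n).
Proof.
move=> h0 w1 su eps0 uC uphi.
have w0 x : 0 < w x by apply: lt_le_trans (w1 x).
pose c s := M (size s) / h ^+ size s.
have uC' s n m x : (n <= m)%N ->
    `|partials s (u m) x - partials s (u n) x| <= eps n * M (size s) / h ^+ size s / w x.
  move=> nm; have [_ /(_ s x)] := uC n m nm.
  rewrite (partials_sub (su m) (su n)).2 => b.
  by rewrite ler_pdivlMr // ler_pdivlMr ?exprn_gt0 // mulrC mulrA.
have e0 n : 0 <= eps n by apply: (snorm_le_ge0 (ltW (w0 0)) (uC n n (leqnn n))).
have c0 s : 0 <= c s by rewrite divr_ge0 ?exprn_ge0 // ltW.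
have epsc s : eps n * c s @[n --> \oo] --> 0.
  by rewrite -(mul0r (c s)); apply: cvgMr_tmp; exact: eps0.
have uC2 s n m x : (n <= m)%N -> `|partials s (u m) x - partials s (u n) x| <= eps n * c s.
  move=> nm; apply: le_trans (uC' s n m x nm) _.
  by rewrite ler_pdivrMr // -[eps n * _ / _]mulrA ler_peMr // mulr_ge0 // c0.
have [sphi pphi] := @smooth_limit R d u (fun s n => eps n * c s) phi su epsc uC2 uphi.
move=> n; have [sd dE] := partials_sub sphi (su n); split=> // s x.
rewrite dE -ler_pdivlMr // mulrC -ler_pdivlMr ?exprn_gt0 //.
rewrite -mulrA [_^-1 * _^-1]mulrC mulrA.
have := limit_cauchy_bound (eps := fun n => eps n * M (size s) / h ^+ size s / w x)
  (fun n m nm => uC' s n m x nm) (pphi s x) n.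
by rewrite -!mulrA [X in _ * (_ * X)]mulrC.
Qed.

End RealBounds.

(** * The quantifiers over h in the Beurling and Roumieu cases *)

Section Cases.
Context {R : realType}.
Implicit Types (c : ucase) (P Q : R -> Prop).

(* The parameters [h] at which functionals on the projective (Beurling) or
   inductive (Roumieu) limit are bounded. *)
Definition dual_index c P := match c with
  | Beurling => exists2 h0, 0 < h0 & forall h, h0 <= h -> P h
  | Roumieu => forall h, 0 < h -> P h
  end.

(* The parameters [h] at which elements of the limit have finite norm. *)
Definition space_index c P := match c with
  | Beurling => forall h, 0 < h -> P h
  | Roumieu => exists2 h, 0 < h & P h
  end.

(** The bridge that keeps the cases together: an estimate for a functional and a finite norm of an
    element always have a common parameter. *)
Lemma dual_index_fr c P Q : dual_index c P -> space_index c Q -> exists h, [/\ 0 < h, P h & Q h].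
Proof.
case: c => /=.
  by move=> [h h0 Ph] Qh; exists h; split=> //; [exact: Ph|exact: Qh].
by move=> Ph [h h0 Qh]; exists h; split=> //; exact: Ph.
Qed.

Lemma dual_index_imp c P Q : (forall h, 0 < h -> P h -> Q h) -> dual_index c P -> dual_index c Q.
Proof.
move=> PQ; case: c => /=.
  by move=> [h h0 Ph]; exists h => // h' hh'; apply: PQ; [exact: lt_le_trans hh'|exact: Ph].
by move=> Ph h h0; apply: PQ => //; apply: Ph.
Qed.

Lemma dual_index_and c P Q : dual_index c P -> dual_index c Q -> dual_index c (fun h => P h /\ Q h).
Proof.
case: c => /=; last by move=> p q h h0; split; [exact: p|exact: q].
move=> [h h0 p] [h' h'0 q]; exists (Num.max h h'); first by rewrite lt_max h0.
by move=> k; rewrite ge_max => /andP[hk h'k]; split; [exact: p|exact: q].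
Qed.

Lemma dual_index_scale c P (L : R) : 0 < L -> dual_index c P -> dual_index c (fun h => P (L * h)).
Proof.
move=> L0; case: c => /=; last by move=> p h h0; apply: p; rewrite mulr_gt0.
move=> [h h0 p]; exists (h / L); first by rewrite divr_gt0.
by move=> k; rewrite ler_pdivrMr // mulrC => hk; exact: p.
Qed.

Lemma space_index_scale c P Q (L : R) : 0 < L ->
  (forall h, 0 < h -> P (L * h) -> Q h) -> space_index c P -> space_index c Q.
Proof.
move=> L0 PQ; case: c => /=.
  by move=> p h h0; apply: PQ => //; apply: p; rewrite mulr_gt0.
move=> [h h0 p]; exists (h / L); first by rewrite divr_gt0.
by apply: PQ; rewrite ?divr_gt0 // mulrC divfK // gt_eqF.
Qed.

Lemma space_index_and c P Q : (forall h h', 0 < h' -> h' <= h -> P h -> P h') ->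
  (forall h h', 0 < h' -> h' <= h -> Q h -> Q h') ->
  space_index c P -> space_index c Q -> space_index c (fun h => P h /\ Q h).
Proof.
move=> dP dQ; case: c => /=; first by move=> p q h h0; split; [exact: p|exact: q].
move=> [h h0 p] [h' h'0 q]; have m0 : 0 < Num.min h h' by rewrite lt_min h0.
exists (Num.min h h') => //; split.
  by apply: dP p => //; rewrite ge_min lexx.
by apply: dQ q => //; rewrite ge_min lexx orbT.
Qed.

End Cases.

(** * Complex-valued functions and comparison with the defining norms *)

Section ComplexBounds.
Context {R : realType} {d : nat} (M : R^nat) (M_gt0 : forall p, 0 < M p).
Notation rV := 'rV[R]_d.
Notation fct := (rV -> R[i]).
Implicit Types (w : rV -> R) (phi psi : fct) (s : seq 'I_d) (x y : rV) (h K : R).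

(** Bounding the two components separately changes the norm by a factor of at most 2, hence gives
    the same spaces and neighbourhoods. *)
Definition csnorm_le h w phi K := snorm_le M h w (re_part phi) K /\ snorm_le M h w (im_part phi) K.

Definition cpartials s phi : fct :=
  fun x => partials s (re_part phi) x +i* partials s (im_part phi) x.

Lemma fct_eq phi psi : re_part phi = re_part psi -> im_part phi = im_part psi -> phi = psi.
Proof.
move=> /funeqP re /funeqP im; apply/funext => x; move: (re x) (im x).
by rewrite /re_part /im_part; case: (phi x) (psi x) => a b [a' b'] /= -> ->.
Qed.

Lemma re_lin (a : R[i]) phi psi : re_part (a *: phi + psi) =
  (fun x => complex.Re a * re_part phi x + (- complex.Im a * im_part phi x + re_part psi x)).
Proof.
apply/funext => x; rewrite /re_part /im_part.
rewrite -[(a *: phi + psi) x]/(a * phi x + psi x).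
by case: a (phi x) (psi x) => a b [p q] [r t] /=; ring.
Qed.

Lemma im_lin (a : R[i]) phi psi : im_part (a *: phi + psi) =
  (fun x => complex.Re a * im_part phi x + (complex.Im a * re_part phi x + im_part psi x)).
Proof.
apply/funext => x; rewrite /re_part /im_part.
rewrite -[(a *: phi + psi) x]/(a * phi x + psi x).
by case: a (phi x) (psi x) => a b [p q] [r t] /=; ring.
Qed.

Definition abs1 (a : R[i]) : R := `|complex.Re a| + `|complex.Im a|.

Lemma csnorm_le_lin h w (a : R[i]) phi psi K K' : 0 <= h -> (forall x, 0 <= w x) ->
  csnorm_le h w phi K -> csnorm_le h w psi K' -> csnorm_le h w (a *: phi + psi) (abs1 a * K + K').
Proof.
move=> h0 w0 [p1 p2] [q1 q2]; split.
  rewrite re_lin /abs1 mulrDl -addrA; apply: snorm_le_lin => //.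
  by rewrite -(normrN (complex.Im a)); apply: snorm_le_lin.
by rewrite im_lin /abs1 mulrDl -addrA; apply: snorm_le_lin => //; apply: snorm_le_lin.
Qed.

Lemma csnorm_le_weaken h h' w w' phi K K' C : 0 <= h' -> h' <= h -> 0 <= C ->
  (forall x, 0 <= w' x <= C * w x) -> C * K <= K' -> csnorm_le h w phi K -> csnorm_le h' w' phi K'.
Proof.
move=> h'0 h'h C0 w'w CK [p q].
by split; [exact: (snorm_le_weaken M_gt0 h'0 h'h C0 w'w CK p)|exact: (snorm_le_weaken M_gt0 h'0 h'h C0 w'w CK q)].
Qed.

Lemma csnorm_le_le h w phi K K' : 0 <= h -> (forall x, 0 <= w x) -> K <= K' ->
  csnorm_le h w phi K -> csnorm_le h w phi K'.
Proof.
by move=> h0 w0 KK; apply: (@csnorm_le_weaken _ _ _ _ _ _ _ 1); rewrite ?mul1r // => x;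
  rewrite mul1r w0 lexx.
Qed.

Lemma csnorm_le_ge0 h w phi K : 0 <= w 0 -> csnorm_le h w phi K -> 0 <= K.
Proof. by move=> w0 [p _]; apply: (snorm_le_ge0 M_gt0 w0 p). Qed.

Lemma csnorm_le_affine h w phi K (a : R) y : a ^+ 2 = 1 -> csnorm_le h w phi K ->
  csnorm_le h (fun x => w (y + a *: x)) (fun x => phi (y + a *: x)) K.
Proof.
by move=> a1 [p q]; split;
  [exact: (snorm_le_affine y a1 p)|exact: (snorm_le_affine y a1 q)].
Qed.

Lemma csnorm_le_mul h w w1 w2 (u : rV -> R) phi K1 K2 : M1 M -> 0 < h -> (forall x, 0 <= w1 x) ->
  (forall x, 0 <= w2 x) -> (forall x, 0 <= w x <= w1 x * w2 x) ->
  snorm_le M h w1 u K1 -> csnorm_le h w2 phi K2 ->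
  csnorm_le (h / 2) w (fun x => (u x)%:C%C * phi x) (M 0%N * K1 * K2).
Proof.
move=> M1M h0 w10 w20 w12 uK [p q]; split.
  rewrite (_ : re_part _ = (fun x => u x * re_part phi x)).
    exact: (snorm_le_mul M_gt0 M1M h0 w10 w20 w12 uK p).
  by apply/funext => x; rewrite /re_part; case: (phi x) => a b /=; rewrite mul0r subr0.
rewrite (_ : im_part _ = (fun x => u x * im_part phi x)).
  exact: (snorm_le_mul M_gt0 M1M h0 w10 w20 w12 uK q).
by apply/funext => x; rewrite /im_part; case: (phi x) => a b /=; rewrite mul0r addr0.
Qed.

Lemma csnorm_le_partials (C0 H : R) h w phi K s0 : 1 <= C0 -> 1 <= H ->
  (forall p q, M (p + q)%N <= C0 * H ^+ (p + q) * M p * M q) ->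
  0 < h -> (forall x, 0 <= w x) -> csnorm_le h w phi K ->
  csnorm_le (h / H) w (cpartials s0 phi) (K * (C0 * (H / h) ^+ size s0 * M (size s0))).
Proof.
by move=> C01 H1 MM h0 w0 [p q]; split; exact: snorm_le_partials.
Qed.

Lemma csnorm_le_limit h w (u : nat -> fct) (eps : R^nat) phi :
  0 < h -> (forall x, 1 <= w x) -> (forall n, smooth (u n)) ->
  eps n @[n --> \oo] --> 0 ->
  (forall n m, (n <= m)%N -> csnorm_le h w (u m - u n) (eps n)) ->
  (forall x, re_part (u n) x @[n --> \oo] --> re_part phi x) ->
  (forall x, im_part (u n) x @[n --> \oo] --> im_part phi x) ->
  forall n, csnorm_le h w (phi - u n) (eps n).
Proof.
move=> h0 w1 su eps0 uC re im n.
have reB (p q : fct) : re_part (p - q) = (fun x => re_part p x - re_part q x).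
  apply/funext => x; rewrite /re_part -[(p - q) x]/(p x - q x).
  by case: (p x) (q x) => ? ? [].
have imB (p q : fct) : im_part (p - q) = (fun x => im_part p x - im_part q x).
  apply/funext => x; rewrite /im_part -[(p - q) x]/(p x - q x).
  by case: (p x) (q x) => ? ? [].
split.
  rewrite reB; apply: (snorm_le_limit M_gt0 h0 w1 _ eps0 _ re) => [k|k m km].
    exact: (su k).1.
  by have [] := uC _ _ km; rewrite reB.
rewrite imB; apply: (snorm_le_limit M_gt0 h0 w1 _ eps0 _ im) => [k|k m km].
  exact: (su k).2.
by have [] := uC _ _ km; rewrite imB.
Qed.

Lemma count_mseq (a : multi_index d) j : count_mem j (mseq a) = a j.
Proof.
rewrite /mseq count_flatten -map_comp.
rewrite (eq_map (g := fun i => ((i == j) * a i)%N)) => [|i]; last first.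
  by rewrite /= count_nseq.
rewrite sumnE big_map big_enum /= (bigD1 j) //= eqxx mul1n big1 ?addn0 // => i ij.
by rewrite (negbTE ij).
Qed.

Lemma size_mseq (a : multi_index d) : size (mseq a) = mlength a.
Proof.
rewrite /mseq size_flatten /shape -map_comp sumnE big_map big_enum /=.
by apply: eq_bigr => i _; rewrite size_nseq.
Qed.

(** With the symmetry of mixed derivatives, this identifies derivatives along arbitrary lists with
    those along multi-indices. *)
Lemma perm_mseq s : perm_eq s (mseq [ffun i => count_mem i s]).
Proof. by apply/allP => i _ /=; rewrite count_mseq ffunE. Qed.

Lemma normc_le (z : R[i]) : Normc.normc z <= `|complex.Re z| + `|complex.Im z|.
Proof.
case: z => a b /=; rewrite -[leRHS]ger0_norm ?addr_ge0 // -sqrtr_sqr.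
rewrite ler_sqrt ?sqr_ge0 // sqrrD !real_normK ?num_real //.
by rewrite lerD2r lerDl mulrn_wge0 // mulr_ge0.
Qed.

Lemma normc_ge_re (z : R[i]) : `|complex.Re z| <= Normc.normc z.
Proof.
by case: z => a b /=; rewrite -sqrtr_sqr ler_sqrt ?addr_ge0 ?sqr_ge0 // lerDl sqr_ge0.
Qed.

Lemma normc_ge_im (z : R[i]) : `|complex.Im z| <= Normc.normc z.
Proof.
by case: z => a b /=; rewrite -sqrtr_sqr ler_sqrt ?addr_ge0 ?sqr_ge0 // lerDr sqr_ge0.
Qed.

Lemma ultra_norm_le h w phi K : 0 <= h -> (forall x, 0 <= w x) ->
  csnorm_le h w phi K -> (ultra_norm M h w phi <= (2 * K)%:E)%E.
Proof.
move=> h0 w0 [[_ pK] [_ qK]]; apply: ge_ereal_sup => _ [[a x] _ <-] /=.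
rewrite lee_fin ler_pdivrMr // -size_mseq.
have := pK (mseq a) x; have := qK (mseq a) x.
have := ler_wpM2r (w0 x) (ler_wpM2l (exprn_ge0 (size (mseq a)) h0) (normc_le (mderiv a phi x))).
rewrite /= mulrDr mulrDl -mulrA => h1 h2 h3; apply: le_trans h1 _.
by rewrite mulr2n mulrDl mul1r mulrDl lerD.
Qed.

Lemma csnorm_le_of_ultra_norm h w phi K : 0 <= h -> (forall x, 0 <= w x) -> smooth phi ->
  (ultra_norm M h w phi <= K%:E)%E -> csnorm_le h w phi K.
Proof.
move=> h0 w0 sp nK.
have H s x : h ^+ size s * Normc.normc (mderiv [ffun i => count_mem i s] phi x) * w x
    <= K * M (size s).
  have szE : mlength [ffun i => count_mem i s] = size s.
    by rewrite -size_mseq -(perm_size (perm_mseq s)).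
  rewrite -ler_pdivrMr // -lee_fin; apply: le_trans nK; apply: ereal_sup_ubound.
  by exists ([ffun i => count_mem i s], x) => //=; rewrite szE.
have [sr si] := sp.
split; split=> // s x; rewrite (partials_perm _ (perm_mseq s)) //;
  apply: le_trans (H s x); rewrite ler_wpM2r // ler_wpM2l ?exprn_ge0 //.
  exact: (normc_ge_re (mderiv _ _ _)).
exact: (normc_ge_im (mderiv _ _ _)).
Qed.

Lemma carrier_BhP h w phi : 0 <= h -> (forall x, 0 <= w x) ->
  carrier (Bh M h w) phi <-> exists K, csnorm_le h w phi K.
Proof.
move=> h0 w0; split=> [[sp]|[K pK]]; last first.
  split; first by have [[sr _] [si _]] := pK.
  by apply: le_lt_trans (ultra_norm_le h0 w0 pK) _; rewrite ltry.
case E : (ultra_norm M h w phi) => [K| |] // _.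
  by exists K; apply: csnorm_le_of_ultra_norm; rewrite // E.
by exists 0; apply: csnorm_le_of_ultra_norm; rewrite // E leNye.
Qed.

Lemma nbhs0_BhP h w (U : set fct) : 0 <= h -> (forall x, 0 <= w x) ->
  nbhs0 (Bh M h w) U <-> exists2 e : R, 0 < e & forall phi, csnorm_le h w phi e -> U phi.
Proof.
move=> h0 w0; split=> [[e /= e0 eU]|[e e0 eU]].
  (* The defining norm is at most twice the bound, and e / 4 leaves room for the strict
     inequality. *)
  exists (e / 4); first by rewrite divr_gt0.
  move=> phi pe; apply: eU; split; first by apply/carrier_BhP => //; exists (e / 4).
  apply: le_lt_trans (ultra_norm_le h0 w0 pe) _; rewrite lte_fin; lra.
exists e => // phi [[sp _] /= /ltW pe]; apply: eU; exact: csnorm_le_of_ultra_norm.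
Qed.

Lemma carrier_BwP c w phi : (forall x, 0 <= w x) ->
  carrier (Bw c M w) phi <-> space_index c (fun h => exists K, csnorm_le h w phi K).
Proof.
move=> w0; case: c => /=; split.
- by move=> H h h0; apply/carrier_BhP => //; [exact: ltW|exact: (H (PosNum h0))].
- by move=> H h _; apply/carrier_BhP => //; exact: (H h%:num (gt0 h)).
- by move=> [h _ H]; exists h%:num => //; apply/carrier_BhP.
- by move=> [h h0 H]; exists (PosNum h0) => //; apply/(carrier_BhP _ (ltW h0) w0).
Qed.

Variable (A : R^nat).

Definition gs_snorm_le h phi K := csnorm_le h (fun x => expassoc A (h * enorm x)) phi K.

Lemma carrier_gsP c phi :
  carrier (gelfand_shilov c M A) phi <-> space_index c (fun h => exists K, gs_snorm_le h phi K).
Proof.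
have w0 h (x : rV) : 0 <= expassoc A (h * enorm x) by exact/ltW/expassoc_gt0.
case: c => /=; split.
- by move=> H h h0; apply/(carrier_BhP _ (ltW h0) (w0 h)); exact: (H (PosNum h0)).
- by move=> H h _; apply/(carrier_BhP _ (ge0 h) (w0 h%:num)); exact: (H h%:num (gt0 h)).
- by move=> [h _ /(carrier_BhP _ (ge0 h) (w0 h%:num)) H]; exists h%:num.
- move=> [h h0 H]; exists (PosNum h0) => //; exact/(carrier_BhP _ (ltW h0) (w0 h)).
Qed.

End ComplexBounds.

(** * A partition of unity *)

Section Antiderivative.
Context {R : realType}.
Implicit Types f F : R -> R.
Notation mu := (@lebesgue_measure R).

(** The fundamental theorem is applied on bounded intervals. The base point -(|y| + 1) lies to the
    left of both 0 and y, and subtracting the integral up to 0 removes the dependence on it. *)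
Lemma antiderivative f : continuous f ->
  exists F, forall x : R, is_derive x (1 : R) F (f x).
Proof.
have alg (p q r t : R) : p - q = r - t -> p - r = q - t by move=> h; lra.
move=> cf; pose G a y := (\int[mu]_(t in [set` `[(- a), y]]) f t)%R.
have int a b : mu.-integrable `[a, b] (EFin \o f).
  apply: continuous_compact_integrable; first exact: segment_compact.
  exact: continuous_subspaceT.
have GE a b y : a <= b -> - a <= y ->
    G b y - G a y = (\int[mu]_(t in [set` `[(- b), (- a)]]) f t)%R.
  move=> ab ay.
  have := @Rintegral_itvB R f (BLeft (- b)) (BRight y) (- a) (int _ _).
  rewrite !bnd_simp lerN2 => /(_ ab ay).
  rewrite Rintegral_itv_obnd_cbnd; last first.
    by apply: integrableS (int (- a) y) => //; apply: subset_itvr; rewrite bnd_simp.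
  by rewrite -/(G b y) -/(G a y) => <-; ring.
exists (fun y => G (`|y| + 1) y - G (`|y| + 1) 0) => x.
(* Large enough that -a is a common base point for all y within distance 1 of x. *)
pose a : R := `|x| + 3.
have [d1 d2] : derivable (G a) x 1 /\ derive1 (G a) x = f x.
  apply: (@continuous_FTC1_closed R f (- a) x (x + 1)) => //.
  - by rewrite ltrDl.

  - rewrite /a; have := ler_norm (- x); rewrite normrN; lra.
  - exact: cf.
have da : is_derive x (1 : R) (G a) (f x) by split; [exact: d1|rewrite -d2 derive1E].
have db := is_deriveB da (is_derive_cst (G a 0) x (1 : R)).
rewrite subr0 in db; apply: near_eq_is_derive db.
near=> y.
have xy : `|y| + 1 <= a.
  have : `|x - y| < 1 by near: y; apply: nbhsx_ballx.
  rewrite /a; have := ler_normD x (y - x); rewrite addrC subrK distrC; lra.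
have ny : - (`|y| + 1) <= y by have := ler_norm (- y); rewrite normrN; lra.
have n0 : - (`|y| + 1) <= 0 by have := normr_ge0 y; lra.
exact: (alg _ _ _ _ (etrans (GE _ _ _ xy ny) (esym (GE _ _ _ xy n0)))).
Unshelve. all: by end_near. Qed.

Lemma nondecreasing_of_derive F f : (forall x : R, is_derive x (1 : R) F (f x)) ->
  (forall x, 0 <= f x) -> {homo F : x y / x <= y}.
Proof.
move=> dF f0 x y xy.
have cF : continuous F.
  by move=> t; apply/differentiable_continuous/derivable1_diffP; apply: ex_derive.
have [c _ E] := MVT_segment xy (fun x _ => dF x) (continuous_subspaceT cF).
by rewrite -subr_ge0 E mulr_ge0 // subr_ge0.
Qed.

Lemma nondecreasing_shift_cvg F (B s : R) : {homo F : x y / x <= y} ->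
  (forall x, F x <= B) -> F (s + n%:R) @[n --> \oo] --> sup (range F).
Proof.
move=> Fh FB; have sF : has_sup (range F).
  by split; [exists (F 0), 0|exists B => _ [x _ <-]].
apply/cvgrPdist_lt => e e0.
have [_ [t _ <-] Ft] := sup_adherent e0 sF.
have [N tN] : exists N : nat, t - s <= N%:R.
  exists (Num.truncn `|t - s|).+1; apply: le_trans (ler_norm _) _.
  exact/ltW/truncnS_gt.
exists N => // n /= Nn.
have h1 : F (s + n%:R) <= sup (range F) by apply: sup_upper_bound => //; exists (s + n%:R).
have h2 : F t <= F (s + n%:R).
  apply: Fh; have : N%:R <= n%:R :> R by rewrite ler_nat.
  lra.
rewrite ger0_norm; lra.
Qed.

(* 0, -1, 1, -2, 2, ...: the first [2 N] values are the integers [k] with [-N <= k < N]. *)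
Definition zenum (j : nat) : R := if odd j then - (j./2.+1)%:R else (j./2)%:R.

Lemma zenum_even N : zenum (2 * N) = N%:R.
Proof. by rewrite /zenum mul2n odd_double doubleK. Qed.

Lemma zenum_odd N : zenum (2 * N).+1 = - (N%:R + 1).
Proof.
rewrite /zenum mul2n /= odd_double /= (_ : uphalf _ = N) ?natr1 //.
by rewrite uphalf_double.
Qed.

Lemma telescope_zenum F (s : R) N :
  \sum_(j < 2 * N) (F (s - zenum j + 1) - F (s - zenum j)) =
  F (s + N%:R + 1) - F (s - N%:R + 1).
Proof.
elim: N => [|N IH]; first by rewrite muln0 big_ord0 addr0 subr0 subrr.
rewrite mulnS 2!big_ord_recr /= IH zenum_even zenum_odd -natr1.
have -> : s - (N%:R + 1) + 1 = s - N%:R by ring.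
have -> : s - - (N%:R + 1) + 1 = s + (N%:R + 1) + 1 by ring.
have -> : s - - (N%:R + 1) = s + N%:R + 1 by ring.
ring.
Qed.

End Antiderivative.

Section PartitionOfUnity.
Context {R : realType} (M A : R^nat).
Hypotheses (M_gt0 : forall p, 0 < M p) (M1M : M1 M) (wA : weight_sequence A).
Notation E := (expassoc A).

Lemma expassoc_norm_add (h s t : R) : 0 <= h ->
  E (h * `|s + t|) <= E (2 * h * `|s|) * E (2 * h * `|t|).
Proof.
move=> h0; have [st|ts] := leP `|s| `|t|.
  apply: (@le_trans _ _ (E (2 * h * `|t|))); last first.
    by rewrite ler_peMl ?expassoc_ge1 // ltW // expassoc_gt0.
  apply: expassoc_mono => //; rewrite ?mulr_ge0 // -mulrA mulrCA ler_wpM2l //.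
  have := ler_normD s t; lra.
apply: (@le_trans _ _ (E (2 * h * `|s|))); last first.
  by rewrite ler_peMr ?expassoc_ge1 // ltW // expassoc_gt0.
apply: expassoc_mono => //; rewrite ?mulr_ge0 // -mulrA mulrCA ler_wpM2l //.
have := ler_normD s t; lra.
Qed.

Lemma inv_expassoc_le (t : R) : exists2 K : R, 0 < K &
  forall s, (E `|s|)^-1 <= K / (1 + s ^+ 2).
Proof.
have A0 := wA.1; pose K := 1 + A 2%N / A 0%N.
have K0 : 0 < K by rewrite addr_gt0 // divr_gt0.
exists K => // s.
have s1 : 0 < 1 + s ^+ 2 by rewrite ltr_pwDl // sqr_ge0.
rewrite ler_pdivlMr // mulrC ler_pdivrMr ?expassoc_gt0 // mulrDl mul1r.
rewrite lerD ?expassoc_ge1 //.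
have := expassoc_ge_term wA 2 (normr_ge0 s); rewrite real_normK ?num_real //.
rewrite ler_pdivrMr // => h.
by rewrite mulrAC ler_pdivlMr // [A 2%N * _]mulrC.
Qed.

(** Both F and K atan - F are nondecreasing, so F varies no more than the bounded function K
    atan. *)
Lemma bounded_antiderivative (F f : R -> R) (K : R) :
  (forall x : R, is_derive x (1 : R) F (f x)) ->
  (forall x, 0 <= f x <= K / (1 + x ^+ 2)) -> exists B, forall x, `|F x| <= B.
Proof.
move=> dF fK.
have dG (x : R) : is_derive x (1 : R) (fun x => K * atan x - F x) (K / (1 + x ^+ 2) - f x).
  by apply: is_deriveB; apply: is_deriveZ.
have Fh := nondecreasing_of_derive dF (fun x => proj1 (andP (fK x))).
have Gh := nondecreasing_of_derive dG (fun x => ltac:(by rewrite subr_ge0; case/andP: (fK x))).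
have K0 : 0 <= K by have /andP[f0] := fK 0; rewrite expr0n addr0 divr1; apply: le_trans.
exists (`|F 0| + K * pi) => x.
have a1 := atan_ltpi2 x; have a2 := atan_gtNpi2 x.
have k1 : K * atan x <= K * pi by rewrite ler_wpM2l // (le_trans (ltW a1)) //; have := pi_ge0 R; lra.
have k2 : - (K * pi) <= K * atan x.
  by rewrite -mulrN ler_wpM2l // (le_trans _ (ltW a2)) //; have := pi_ge0 R; lra.
have [x0|x0] := leP 0 x.
  have := Fh _ _ x0; have := Gh _ _ x0; rewrite atan0 mulr0 => g1 g2.
  have := ler_norm (F 0); have := ler_norm (- F 0); rewrite normrN => n1 n2.
  rewrite ler_norml; apply/andP; split; lra.
have := Fh _ _ (ltW x0); have := Gh _ _ (ltW x0); rewrite atan0 mulr0 => g1 g2.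
have := ler_norm (F 0); have := ler_norm (- F 0); rewrite normrN => n1 n2.
rewrite ler_norml; apply/andP; split; lra.
Qed.

(** The profile is the integral of the density over [s, s + 1], divided by the total mass. Integer
    translates telescope to F(+oo) - F(-oo), which is that mass. *)
Lemma partition_of_unity1 (th : nat -> R -> R) :
  (forall n (t : R), is_derive t (1 : R) (th n) (th n.+1 t)) ->
  (forall h, 0 < h -> exists K, forall n s, h ^+ n * `|th n s| * E (h * `|s|) <= K * M n) ->
  (forall s, 0 <= th 0%N s) -> th 0%N 0 != 0 ->
  exists c : nat -> R -> R, [/\
    forall n (t : R), is_derive t (1 : R) (c n) (c n.+1 t),
    forall h, 0 < h -> exists2 K, 0 <= K &
       forall n s, h ^+ n * `|c n s| * E (h * `|s|) <= K * M n &
    forall s : R, \sum_(j < 2 * N) c 0%N (s - zenum j) @[N --> \oo] --> (1 : R)].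
Proof.
move=> dth thK th0 th00.
have cth n : continuous (th n).
  by move=> t; apply/differentiable_continuous/derivable1_diffP; apply: ex_derive.
have [F dF] := antiderivative (cth 0%N).
have [K1 HK1] := thK 1 ltr01; have [K2 K20 HK2] := inv_expassoc_le 0.
have K10 : 0 <= K1 * M 0%N.
  by apply: le_trans (HK1 0%N 0); rewrite expr0 mul1r mulr_ge0 // ltW // expassoc_gt0.
have [B FB] : exists B, forall x, `|F x| <= B.
  apply: (@bounded_antiderivative F (th 0%N) (K1 * M 0%N * K2)) => // x.
  rewrite th0 /= -mulrA; apply: le_trans (ler_wpM2l K10 (HK2 x)).
  rewrite ler_pdivlMr ?expassoc_gt0 //; have := HK1 0%N x.
  by rewrite expr0 !mul1r ger0_norm.
have Fh := nondecreasing_of_derive dF th0.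
(* The reflection turns the limit of F at -oo into one at +oo; the sum [Lp + Lm] is then the total
   mass. *)
pose G x := - F (- x).
have Gh : {homo G : x y / x <= y} by move=> x y xy; rewrite lerN2 Fh // lerN2.
have cF (s : R) := nondecreasing_shift_cvg s Fh (fun x => le_trans (ler_norm _) (FB x)).
have cG (s : R) : G (s + n%:R) @[n --> \oo] --> sup (range G).
  apply: (nondecreasing_shift_cvg (B := B)) => // x.
  by rewrite /G (le_trans (ler_norm _)) // normrN.
set Lp := sup (range F) in cF; set Lm := sup (range G) in cG.
have I0 : Lp + Lm != 0.
  (* With mass zero, sup F = inf F, so F is constant and the density vanishes at 0. *)
  apply/eqP => I0; move/eqP: th00; apply.
  have Fp x : F x <= Lp.
    apply: sup_upper_bound; last by exists x.
    by split; [exists (F 0), 0|exists B => _ [y _ <-]; apply: le_trans (ler_norm _) (FB y)].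
  have Gp x : G x <= Lm.
    apply: sup_upper_bound; last by exists x.
    split; first by exists (G 0), 0.
    by exists B => _ [y _ <-]; rewrite /G (le_trans (ler_norm _)) // normrN.
  have Fc : F = cst Lp.
    apply/funext => x /=; have := Fp x; have := Gp (- x); rewrite /G opprK; lra.
  have := dF 0; rewrite Fc => dc.
  have := derive_val; move=> /(_ _ _ _ _ _ _ _ dc) <-.
  by have := is_derive_cst Lp (0 : R) (1 : R) => d2; apply: derive_val.
pose T n := if n is m.+1 then th m else F.
have dT n (t : R) : is_derive t (1 : R) (T n) (T n.+1 t) by case: n => [|n]; [exact: dF|exact: dth].
pose c n s := (Lp + Lm)^-1 * (T n (s + 1) - T n s).
have dc1 n (t : R) : is_derive t (1 : R) (fun s => T n (s + 1)) (T n.+1 (t + 1)).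
  have := @is_derive1_comp R (T n) (fun s => s + 1) t (T n.+1 (t + 1)) 1 (dT _ _).
  rewrite mulr1; apply.
  by have := is_deriveD (is_derive_id (t : R) (1 : R)) (is_derive_cst (1 : R) t (1 : R)); rewrite addr0.
exists c; split.
- move=> n t; apply: is_deriveZ; apply: is_deriveB; exact: dc1.
- move=> h h0; have [K HK] := thK _ (mulr_gt0 (ltr0Sn R 1) h0).
  have K0 : 0 <= K.
    rewrite -(pmulr_lge0 _ (M_gt0 0%N)); apply: le_trans (HK 0%N 0).
    by rewrite expr0 mul1r mulr_ge0 // ltW // expassoc_gt0.
  exists (`|(Lp + Lm)^-1| * (K * E (2 * h))).
    by rewrite !mulr_ge0 // ltW // expassoc_gt0.
  move=> n s; rewrite /c normrM mulrCA -!mulrA ler_wpM2l //.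
  have dl (t : R) : is_derive t (1 : R) (fun t => T n (s + t)) (T n.+1 (s + t)).
    have := @is_derive1_comp R (T n) (fun t => s + t) t (T n.+1 (s + t)) 1 (dT _ _).
    rewrite mulr1; apply.
    by have := is_deriveD (is_derive_cst s t (1 : R)) (is_derive_id (t : R) (1 : R)); rewrite add0r.
  (* The difference of [T n] over a unit step is a value of its derivative th n near s. The bound
     therefore involves M_n with no shift of the order. *)
  have [xi xi1] := mean_value dl 1; rewrite addr0 mulr1 => ->.
  rewrite normr1 in xi1; rewrite -[T n.+1]/(th n).
  have Es : E (h * `|s|) <= E (2 * h * `|s + xi|) * E (2 * h).
    rewrite -{1}(addrK xi s); apply: le_trans (expassoc_norm_add _ _ (ltW h0)) _.
    rewrite ler_wpM2l ?(ltW (expassoc_gt0 _ _)) // normrN expassoc_mono ?mulr_ge0 ?(ltW h0) //.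
    by rewrite -[leRHS]mulr1 ler_wpM2l ?mulr_ge0 ?(ltW h0).
  have step : h ^+ n * `|th n (s + xi)| * (E (2 * h * `|s + xi|) * E (2 * h)) <=
      K * M n * E (2 * h).
    rewrite mulrA; apply: ler_wpM2r; first exact/ltW/expassoc_gt0.
    apply: le_trans (HK n (s + xi)).
    apply: ler_wpM2r; first exact/ltW/expassoc_gt0.
    apply: ler_wpM2r => //; apply: lerXn2r; rewrite ?nnegrE ?mulr_ge0 ?(ltW h0) //.
    by rewrite ler_peMl ?(ltW h0) // ler1n.
  have fin : K * (E (2 * h) * M n) = K * M n * E (2 * h) by ring.
  rewrite fin mulrA; apply: le_trans step; apply: ler_wpM2l => //.
  by rewrite mulr_ge0 // exprn_ge0 // ltW.
move=> s.
have E1 : (fun N => \sum_(j < 2 * N) c 0%N (s - zenum j)) =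
   (fun N => (Lp + Lm)^-1 * (F (s + 1 + N%:R) + G (- s - 1 + N%:R))).
  apply/funext => N; rewrite /c -mulr_sumr /= telescope_zenum /G; congr (_ * (F _ - F _)); ring.
rewrite E1 -[X in _ --> X](mulVf I0); apply: cvgMl_tmp; apply: cvgD; [exact: cF|exact: cG].
Qed.

End PartitionOfUnity.

Section TestFunctions.
Context {R : realType} {d : nat} (M A : R^nat).
Hypotheses (d_gt0 : (0 < d)%N) (M_gt0 : forall p, 0 < M p) (M1M : M1 M).
Hypothesis wA : weight_sequence A.
Notation E := (expassoc A).
Notation rV := 'rV[R]_d.
Implicit Types (x y : rV) (h K : R).

Lemma expassoc_ge0 t : 0 <= E t. Proof. exact/ltW/expassoc_gt0. Qed.

Lemma enorm_delta i (t : R) : enorm (t *: delta_mx 0 i : rV) = `|t|.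
Proof.
rewrite /enorm (bigD1 i) //= big1 => [|j ji]; last first.
  by rewrite !mxE (negbTE ji) andbF mulr0 expr0n.
by rewrite !mxE !eqxx mulr1 addr0 sqrtr_sqr.
Qed.

(** Squaring makes the restriction nonnegative while keeping it nonzero at the origin of the line,
    so its mass cannot vanish. Moving the origin to x0 costs a doubling of h and the constant E(2 h
    |x0|). *)
Lemma line_density (u : rV -> R) x0 (i : 'I_d) : u x0 != 0 ->
  (forall h, 0 < h -> exists K, snorm_le M h (fun x => E (h * enorm x)) u K) ->
  exists th : nat -> R -> R, [/\
    forall n (t : R), is_derive t (1 : R) (th n) (th n.+1 t),
    forall h, 0 < h -> exists K, forall n s, h ^+ n * `|th n s| * E (h * `|s|) <= K * M n,
    forall s, 0 <= th 0%N s & th 0%N 0 != 0].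
Proof.
move=> ux0 uK.
have [K1 [su _]] := uK 1 ltr01.
have [sv _] := smooth_mul su su.
pose v x := u x * u x.
have vK h : 0 < h -> exists K, snorm_le M h (fun x => E (h * enorm x)) v K.
  move=> h0; have h20 : 0 < 2 * h by rewrite mulr_gt0.
  have [K HK] := uK _ h20.
  exists (M 0%N * K * K).
  rewrite -[X in snorm_le M X](@mulfK _ 2) // [h * 2]mulrC.
  apply: (snorm_le_mul M_gt0 M1M h20 _ _ _ HK HK) => x; rewrite ?expassoc_ge0 //=.
  apply: (@le_trans _ _ (E (2 * h * enorm x))).
    apply: expassoc_mono => //; first by rewrite mulr_ge0 ?enorm_ge0 ?(ltW h0).
    by rewrite ler_wpM2r ?enorm_ge0 // ler_peMl ?(ltW h0) // ler1n.
  by rewrite ler_peMr ?expassoc_ge0 // expassoc_ge1.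
exists (fun n t => partials (nseq n i) v (x0 + t *: delta_mx 0 i)); split.
- by move=> n t; apply: smooth_line.
- move=> h h0; have h20 : 0 < 2 * h by rewrite mulr_gt0.
  have [K [_ HK]] := vK _ h20.
  exists (K * E (2 * h * enorm x0)) => n s.
  have := HK (nseq n i) (x0 + s *: delta_mx 0 i); rewrite size_nseq => hK.
  have Es : E (h * `|s|) <= E (2 * h * enorm (x0 + s *: delta_mx 0 i)) * E (2 * h * enorm x0).
    rewrite -(enorm_delta i) -[X in enorm X](addKr x0) addrC -(enormN x0).
    exact/expassoc_enorm_add/ltW.
  rewrite [leRHS]mulrAC; apply: (@le_trans _ _ ((2 * h) ^+ n *
     `|partials (nseq n i) v (x0 + s *: delta_mx 0 i)| *
     (E (2 * h * enorm (x0 + s *: delta_mx 0 i)) * E (2 * h * enorm x0)))); last first.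
    by rewrite [leLHS]mulrA; apply: ler_wpM2r hK; exact: expassoc_ge0.
  apply: ler_pM => //; rewrite ?expassoc_ge0 ?mulr_ge0 ?exprn_ge0 ?(ltW h0) //.
  apply: ler_wpM2r => //; apply: lerXn2r; rewrite ?nnegrE ?(ltW h0) ?(ltW h20) //.
  by rewrite ler_peMl ?(ltW h0) // ler1n.
- by move=> s /=; rewrite /v -expr2 sqr_ge0.
- by rewrite /= scale0r addr0 /v mulf_neq0.
Qed.

Lemma M_prod (I : eqType) (l : seq I) (n : I -> nat) :
  M 0%N * \prod_(i <- l) M (n i) <= M 0%N ^+ size l * M (\sum_(i <- l) n i)%N.
Proof.
elim: l => [|i l IH]; first by rewrite !big_nil mulr1 mul1r.
rewrite !big_cons mulrCA; apply: le_trans (ler_wpM2l (ltW (M_gt0 _)) IH) _.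
rewrite mulrCA /= exprSr -mulrA ler_wpM2l ?exprn_ge0 ?(ltW (M_gt0 _)) //.
exact: M1_superadditive.
Qed.

Lemma tensor_snorm_le (c : nat -> R -> R) :
  (forall n (t : R), is_derive t (1 : R) (c n) (c n.+1 t)) ->
  (forall h, 0 < h -> exists2 K, 0 <= K &
       forall n s, h ^+ n * `|c n s| * E (h * `|s|) <= K * M n) ->
  forall h, 0 < h -> exists K,
    snorm_le M h (fun x => E (h * enorm x)) (fun x => \prod_i c 0%N (x 0 i)) K.
Proof.
move=> dc cK h h0; have [sc cE] := @smooth_tensor R d c dc.
have d1 : 1 <= d%:R :> R by rewrite ler1n.
(* Since |x| <= d |x_i| for the largest coordinate, the factor of that coordinate at parameter h d
   carries the full weight; the other factors of the weight are at least 1. *)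
pose h1 := h * d%:R.
have hh1 : h <= h1 by rewrite /h1 ler_peMr // ltW.
have h10 : 0 < h1 by apply: lt_le_trans hh1.
have [K K0 HK] := cK _ h10.
exists (K ^+ d * (M 0%N ^+ d / M 0%N)); split=> // s x; rewrite cE.
have [i0 xi0] := enorm_coord_attained x d_gt0.
have cnt : (\sum_i count_mem i s)%N = size s.
  rewrite (perm_size (perm_mseq s)) size_mseq /mlength.
  by apply: eq_bigr => i _; rewrite ffunE.
apply: (@le_trans _ _ (\prod_i (h1 ^+ count_mem i s * `|c (count_mem i s) (x 0 i)| *
    E (h1 * `|x 0 i|)))).
  rewrite big_split big_split /=; apply: ler_pM; rewrite ?mulr_ge0 ?exprn_ge0 ?expassoc_ge0 ?(ltW h0) //.
    rewrite normr_prod; apply: ler_wpM2r; first by apply: prodr_ge0.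
    rewrite -cnt expr_sum; apply: ler_prod => i _.
    rewrite exprn_ge0 ?(ltW h0) //=; apply: lerXn2r; rewrite ?nnegrE ?(ltW h0) ?(ltW h10) //.
  rewrite (bigD1 i0) //=; apply: (@le_trans _ _ (E (h1 * `|x 0 i0|))).
    apply: expassoc_mono => //; first by rewrite mulr_ge0 ?enorm_ge0 ?(ltW h0).
    by rewrite /h1 -mulrA ler_wpM2l ?(ltW h0).
  rewrite ler_peMr ?expassoc_ge0 //.
  elim/big_ind: _ => // [p q p1 q1|i _]; last exact: expassoc_ge1.
  by rewrite -[1]mulr1 ler_pM.
apply: (@le_trans _ _ (\prod_i (K * M (count_mem i s)))).
  apply: ler_prod => i _; rewrite HK andbT.
  by rewrite !mulr_ge0 ?exprn_ge0 ?expassoc_ge0 ?(ltW h10).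
rewrite big_split /= prodr_const card_ord -mulrA ler_wpM2l ?exprn_ge0 //.
have := M_prod (enum 'I_d) (fun i => count_mem i s).
rewrite !big_enum size_enum_ord /= cnt => hM.
by rewrite mulrAC ler_pdivlMr // mulrC.
Qed.

(* The profile [c] of a partition of unity [sum_k prod_i c (x_i - k_i) = 1]. *)
Lemma exists_partition (phi : rV -> R[i]) :
  carrier (gelfand_shilov Beurling M A) phi -> phi <> 0 ->
  exists c : R -> R,
    (forall h, 0 < h -> exists K,
      snorm_le M h (fun x => E (h * enorm x)) (fun x => \prod_i c (x 0 i)) K) /\
    (forall s : R, \sum_(j < 2 * N) c (s - zenum j) @[N --> \oo] --> (1 : R)).
Proof.
move=> /(carrier_gsP M_gt0)/= pK p0.
have [u [x0 ux0 uK]] : exists u : rV -> R, exists2 x0, u x0 != 0 &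
    forall h, 0 < h -> exists K, snorm_le M h (fun x => E (h * enorm x)) u K.
  apply: contrapT => H; apply: p0; apply: fct_eq; apply/funext => x; apply/eqP.
    apply/negP => /negP px; apply: H; exists (re_part phi), x => // h h0.
    by have [K [HK _]] := pK h h0; exists K.
  apply/negP => /negP px; apply: H; exists (im_part phi), x => // h h0.
  by have [K [_ HK]] := pK h h0; exists K.
have [th [dth thK th0 th00]] := line_density (Ordinal d_gt0) ux0 uK.
have [c [dc cK c1]] := partition_of_unity1 M_gt0 wA dth thK th0 th00.
by exists (c 0%N); split=> //; exact: tensor_snorm_le.
Qed.

End TestFunctions.

(** * Sums over boxes of lattice points *)

Section BoxSums.
Context {R : comNzRingType}.

(** The small box is cut out inside the functions into ['I_m], so that boxes of different sizes
    share an index type and can be subtracted. *)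
Lemma prod_sum_box (I : finType) (f : I -> nat -> R) n m : (n <= m)%N ->
  \prod_i \sum_(j < n) f i j =
  \sum_(F : {ffun I -> 'I_m} | [forall i, (F i < n)%N]) \prod_i f i (F i).
Proof.
move=> nm.
rewrite (eq_bigr (fun i => \sum_(j < m | (j < n)%N) f i j)); last first.
  by move=> i _; rewrite (big_ord_widen _ _ nm).
rewrite bigA_distr_big; apply: eq_bigl => F.
by apply/ffun_onP/forallP => h i; have := h i.
Qed.

Lemma prod_sum_box_diff (I : finType) (f : I -> nat -> R) n m : (n <= m)%N ->
  \prod_i \sum_(j < m) f i j - \prod_i \sum_(j < n) f i j =
  \sum_(F : {ffun I -> 'I_m} | ~~ [forall i, (F i < n)%N]) \prod_i f i (F i).
Proof.
move=> nm; rewrite (prod_sum_box f nm) (prod_sum_box f (leqnn m)).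
rewrite (eq_bigl xpredT) => [|F]; last by apply/forallP => i; exact: ltn_ord.
by rewrite [X in X - _](bigID (fun F : {ffun I -> 'I_m} => [forall i, (F i < n)%N])) /= [LHS]addrC addKr.
Qed.

End BoxSums.

Section LatticeWeights.
Context {R : realType}.

Definition zweight (j : nat) : R := (1 + (zenum j : R) ^+ 2)^-1.

Lemma zweight_gt0 j : 0 < zweight j.
Proof. by rewrite invr_gt0 ltr_pwDl // sqr_ge0. Qed.

Lemma zenum_lower j : j%:R / 2 <= `|zenum j : R|.
Proof.
rewrite ler_pdivrMr // /zenum -{1}(odd_double_half j) natrD -muln2 natrM.
case: (odd j) => /=; last by rewrite add0r normr_nat.
rewrite normrN normr_nat -natr1; lra.
Qed.

Lemma zweight_sum n : \sum_(j < n) zweight j <= 8.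
Proof.
(* A strengthening fit for induction: |zenum n| >= n / 2 gives [zweight n] <= 8 / ((n + 1) (n + 2)),
   and the right-hand side telescopes. *)
suff : \sum_(j < n) zweight j <= 8 - 8 / n.+1%:R.
  by move/le_trans; apply; rewrite lerBlDr lerDl divr_ge0.
elim: n => [|n IH]; first by rewrite big_ord0 divr1 subrr.
rewrite big_ord_recr /=; apply: le_trans (lerD IH (lexx _)) _.
have q : (n%:R / 2) ^+ 2 <= (zenum n : R) ^+ 2.
  rewrite -[X in _ <= X]real_normK ?num_real //.
  by apply: lerXn2r; rewrite ?nnegrE ?divr_ge0 // zenum_lower.
have : zweight n <= 8 / ((n%:R + 1) * (n%:R + 2)).
  have n0 : 0 <= n%:R :> R by [].
  rewrite /zweight -[leLHS]mul1r ler_pdivrMr ?ltr_pwDl ?sqr_ge0 //.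
  rewrite mulrAC ler_pdivlMr ?mulr_gt0 ?ltr_wpDl // mul1r.
  move: q n0; move: (n%:R : R) (zenum n : R) => t z; nra.
move/(lerD (lexx (8 - 8 / n.+1%:R)))/le_trans; apply.
rewrite -[n.+2%:R]natr1 -[n.+1%:R]natr1.
have n1 : 0 < n%:R + 1 :> R by rewrite ltr_wpDl.
rewrite le_eqVlt; apply/orP; left; apply/eqP; field.
by rewrite !gt_eqF // ltr_wpDl.
Qed.

Definition box_weight (d N : nat) : R := (\sum_(j < 2 * N) zweight j) ^+ d.

(** The tail of a bounded nondecreasing sequence. Up to constants, this is the only rate of
    convergence used for cutoffs and for the extension. *)
Lemma box_weight_cvg d : exists2 eps : R^nat, eps n @[n --> \oo] --> 0 &
  forall n m, (n <= m)%N -> box_weight d m - box_weight d n <= eps n.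
Proof.
have hom : {homo box_weight d : n m / (n <= m)%N >-> n <= m}.
  move=> n m nm; apply: lerXn2r; rewrite ?nnegrE ?sumr_ge0 //.
  - by move=> j _; exact/ltW/zweight_gt0.
  - by move=> j _; exact/ltW/zweight_gt0.
  have n2m : (2 * n <= 2 * m)%N by rewrite leq_mul2l.
  rewrite (big_ord_widen _ _ n2m) [leRHS](bigID (fun j : 'I_(2 * m) => (j < 2 * n)%N)) /=.
  by rewrite lerDl sumr_ge0 // => j _; exact/ltW/zweight_gt0.
have ub8 n : box_weight d n <= 8 ^+ d.
  apply: lerXn2r; rewrite ?nnegrE ?zweight_sum //.
  by rewrite sumr_ge0 // => j _; exact/ltW/zweight_gt0.
have hb : has_ubound (range (box_weight d)) by exists (8 ^+ d) => _ [n _ <-].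
have c := nondecreasing_cvgn hom hb.
exists (fun n => sup (range (box_weight d)) - box_weight d n).
  rewrite -(subrr (sup (range (box_weight d)))); apply: cvgB c; exact: cvg_cst.
move=> n m _; rewrite lerD2r; apply: sup_upper_bound; last by exists m.
by split=> //; exists (box_weight d 0), 0%N.
Qed.

End LatticeWeights.

(** * Functionals and cutoffs *)

Section LinearFunctionals.
Context {R : realType} {d : nat}.
Notation rV := 'rV[R]_d.
Notation fct := (rV -> R[i]).
Notation normc := Normc.normc.
Implicit Types (S : set fct) (f : fct -> R[i]) (phi psi : fct).

Definition vsubspace S := S 0 /\ forall (a : R[i]) phi psi, S phi -> S psi -> S (a *: phi + psi).

Definition linear_on S f := forall phi psi (a : R[i]), S phi -> S psi ->
  f (a *: phi + psi) = a * f phi + f psi.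

Lemma subspace_add S phi psi : vsubspace S -> S phi -> S psi -> S (phi + psi).
Proof. by move=> [_ h] p q; rewrite -[phi]scale1r; apply: h. Qed.

Lemma subspace_scale S (a : R[i]) phi : vsubspace S -> S phi -> S (a *: phi).
Proof. by move=> [h0 h] p; rewrite -[_ *: _]addr0; apply: h. Qed.

Lemma subspace_sub S phi psi : vsubspace S -> S phi -> S psi -> S (phi - psi).
Proof. by move=> sS p q; rewrite addrC -scaleN1r; apply: sS.2. Qed.

Lemma subspace_sum S (I : Type) (r : seq I) (P : pred I) (F : I -> fct) : vsubspace S ->
  (forall i, P i -> S (F i)) -> S (\sum_(i <- r | P i) F i).
Proof.
move=> sS SF; elim/big_ind: _ => //; first exact: sS.1.
by move=> p q; apply: subspace_add.
Qed.

Section Linear.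
Variables (S : set fct) (f : fct -> R[i]).
Hypotheses (sS : vsubspace S) (lf : linear_on S f).

Lemma linear_on0 : f 0 = 0.
Proof.
have := lf 1 sS.1 sS.1; rewrite scale1r addr0 mul1r => /eqP.
by rewrite -subr_eq0 opprD addrA subrr sub0r oppr_eq0 => /eqP.
Qed.

Lemma linear_on_add phi psi : S phi -> S psi -> f (phi + psi) = f phi + f psi.
Proof. by move=> p q; rewrite -{1}[phi]scale1r lf // mul1r. Qed.

Lemma linear_on_scale (a : R[i]) phi : S phi -> f (a *: phi) = a * f phi.
Proof. by move=> p; rewrite -[_ *: _]addr0 lf ?linear_on0 ?addr0 //; exact: sS.1. Qed.

Lemma linear_on_sub phi psi : S phi -> S psi -> f (phi - psi) = f phi - f psi.
Proof. by move=> p q; rewrite addrC -scaleN1r lf // mulN1r addrC. Qed.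

Lemma linear_on_sum (I : Type) (r : seq I) (P : pred I) (F : I -> fct) :
  (forall i, P i -> S (F i)) ->
  f (\sum_(i <- r | P i) F i) = \sum_(i <- r | P i) f (F i).
Proof.
move=> SF.
suff [] : S (\sum_(i <- r | P i) F i) /\
  f (\sum_(i <- r | P i) F i) = \sum_(i <- r | P i) f (F i) by [].
elim/big_ind2: _ => [|p p' q q' [h1 h2] [h3 h4]|i Pi].
- by split; [exact: sS.1|exact: linear_on0].
- by split; [exact: subspace_add|rewrite linear_on_add // h2 h4].
- by split=> //; apply: SF.
Qed.

End Linear.

Lemma normc_sum (I : Type) (r : seq I) (P : pred I) (F : I -> R[i]) :
  normc (\sum_(i <- r | P i) F i) <= \sum_(i <- r | P i) normc (F i).
Proof.
elim/big_ind2: _ => [|p p' q q' h1 h2|//]; first by rewrite Normc.normc0.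
by apply: le_trans (le_normcD _ _) _; rewrite lerD.
Qed.

Lemma normc_ge0 (z : R[i]) : 0 <= normc z.
Proof. by case: z => a b; exact: sqrtr_ge0. Qed.

Lemma normcR (a : R) : normc a%:C = `|a|.
Proof. by rewrite /normc /= expr0n /= addr0 sqrtr_sqr. Qed.

Lemma normcE_norm (z : R[i]) : `|z| = (normc z)%:C.
Proof. by rewrite normc_def; case: z. Qed.

End LinearFunctionals.

Section CubSums.
Context {R : realType} {d : nat} (M : R^nat) (M_gt0 : forall p, 0 < M p).
Notation rV := 'rV[R]_d.
Notation fct := (rV -> R[i]).
Implicit Types (w : rV -> R) (phi psi : fct) (h K : R).

Lemma cub0 h w : csnorm_le M h w (0 : fct) 0.
Proof.
have [s0 E0] : smooth_real (fun _ : rV => 0 : R) /\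
    forall s, partials s (fun _ : rV => 0 : R) = (fun _ => 0).
  apply: (@smooth_of_family R d (fun _ _ => 0)) => s.
  exact: continuous_const.
by split; split=> // s x; rewrite E0 normr0 mulr0 !mul0r.
Qed.

Lemma abs1_1 : abs1 (1 : R[i]) = 1.
Proof. by rewrite /abs1 /= normr1 normr0 addr0. Qed.

Lemma csnorm_le_add h w phi psi K K' : 0 <= h -> (forall x, 0 <= w x) ->
  csnorm_le M h w phi K -> csnorm_le M h w psi K' -> csnorm_le M h w (phi + psi) (K + K').
Proof.
move=> h0 w0 p q; rewrite -[phi]scale1r -[K]mul1r -abs1_1; exact: csnorm_le_lin.
Qed.

Lemma csnorm_le_scale h w (a : R[i]) phi K : 0 <= h -> (forall x, 0 <= w x) ->
  csnorm_le M h w phi K -> csnorm_le M h w (a *: phi) (abs1 a * K).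
Proof.
move=> h0 w0 p; rewrite -[_ *: _]addr0 -[_ * K]addr0; apply: csnorm_le_lin => //; exact: cub0.
Qed.

Lemma csnorm_le_sum h w (I : Type) (r : seq I) (P : pred I) (F : I -> fct) (K : I -> R) :
  0 <= h -> (forall x, 0 <= w x) -> (forall i, P i -> csnorm_le M h w (F i) (K i)) ->
  csnorm_le M h w (\sum_(i <- r | P i) F i) (\sum_(i <- r | P i) K i).
Proof.
move=> h0 w0 FK; elim/big_ind2: _ => //; first exact: cub0.
by move=> *; apply: csnorm_le_add.
Qed.

Lemma space_index_cub_subspace c (w : R -> rV -> R) :
  (forall h x, 0 <= w h x) ->
  (forall h h', 0 < h' -> h' <= h -> forall x, w h' x <= w h x) ->
  vsubspace [set phi | space_index c (fun h => exists K, csnorm_le M h (w h) phi K)].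
Proof.
move=> w0 wmono; have down phi h h' : 0 < h' -> h' <= h ->
    (exists K, csnorm_le M h (w h) phi K) -> exists K, csnorm_le M h' (w h') phi K.
  move=> h'0 h'h [K HK]; exists (1 * K).
  apply: (csnorm_le_weaken M_gt0 (ltW h'0) h'h ler01 _ (lexx _) HK) => x.
  by rewrite w0 mul1r wmono.
split.
  have H h : exists K, csnorm_le M h (w h) 0 K by exists 0; exact: cub0.
  by case: c => /= [h _|]; [exact: H|exists 1; [exact: ltr01|exact: H]].
move=> a phi psi /= p q.
have := space_index_and (down phi) (down psi) p q; apply: (@space_index_scale _ _ _ _ 1 ltr01).
move=> h h0; rewrite mul1r => -[[K HK] [K' HK']].
by exists (abs1 a * K + K'); apply: csnorm_le_lin => //; exact: ltW.
Qed.

End CubSums.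

Section Cutoffs.
Context {R : realType} {d : nat} (M : R^nat) (M_gt0 : forall p, 0 < M p).
Hypothesis d_gt0 : (0 < d)%N.
Notation rV := 'rV[R]_d.
Notation fct := (rV -> R[i]).
Notation normc := Normc.normc.
Implicit Types (w u : rV -> R) (phi psi : fct) (h K : R) (k x : rV) (c : R -> R).

Definition cmul u phi : fct := fun x => (u x)%:C * phi x.

Definition cbump c k : rV -> R := fun x => \prod_i c (x 0 i - k 0 i).

Definition zvec m (F : {ffun 'I_d -> 'I_m}) : rV := \row_i zenum (F i).

(** By distributivity this is the sum of the bumps over a lattice box; as a product of one-variable
    sums it visibly converges to 1. *)
Definition cutoff c N : rV -> R := fun x => \prod_i \sum_(j < 2 * N) c (x 0 i - zenum j).

Definition kweight k : R := \prod_i (1 + k 0 i ^+ 2)^-1.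

Lemma cmul_cutoff_diff c phi n m : (n <= m)%N ->
  cmul (cutoff c m) phi - cmul (cutoff c n) phi =
  \sum_(F : {ffun 'I_d -> 'I_(2 * m)} | ~~ [forall i, (F i < 2 * n)%N])
    cmul (cbump c (zvec F)) phi.
Proof.
move=> nm; have nm2 : (2 * n <= 2 * m)%N by rewrite leq_mul2l.
apply/funext => x; rewrite fct_sumE -[LHS]/(_ * phi x - _ * phi x) -mulrBl -rmorphB.
rewrite /cutoff (prod_sum_box_diff (fun i j => c (x 0 i - zenum j)) nm2) rmorph_sum mulr_suml; apply: eq_bigr => F _.
by rewrite /cmul /cbump; congr (_%:C * _); apply: eq_bigr => i _; rewrite mxE.
Qed.

Lemma kweight_box n m : (n <= m)%N ->
  \sum_(F : {ffun 'I_d -> 'I_(2 * m)} | ~~ [forall i, (F i < 2 * n)%N]) kweight (zvec F) =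
  box_weight d m - box_weight d n.
Proof.
move=> nm; have nm2 : (2 * n <= 2 * m)%N by rewrite leq_mul2l.
have e N : box_weight d N = \prod_(i < d) \sum_(j < 2 * N) zweight j :> R.
  by rewrite prodr_const card_ord.
rewrite !e (prod_sum_box_diff (fun _ => zweight) nm2).
by apply: eq_bigr => F _; apply: eq_bigr => i _; rewrite mxE.
Qed.

(** Here d > 0 matters, as an empty product would be 1. A cutoff is thereby a difference of two
    cutoffs, to which the bounds on differences apply. *)
Lemma cmul_cutoff0 c phi : cmul (cutoff c 0) phi = 0.
Proof.
apply/funext => x; rewrite /cmul /cutoff (bigD1 (Ordinal d_gt0)) //=.
by rewrite muln0 big_ord0 mul0r mul0r.
Qed.

Lemma csnorm_le_cutoff_diff h w c phi K n m : 0 <= h -> (forall x, 0 <= w x) ->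
  (forall k, csnorm_le M h w (cmul (cbump c k) phi) (K * kweight k)) -> (n <= m)%N ->
  csnorm_le M h w (cmul (cutoff c m) phi - cmul (cutoff c n) phi)
    (K * (box_weight d m - box_weight d n)).
Proof.
move=> h0 w0 bK nm; rewrite cmul_cutoff_diff // -(kweight_box nm) mulr_sumr.
exact: csnorm_le_sum.
Qed.

Lemma subspace_cutoff (S : set fct) c phi n : vsubspace S ->
  (forall k, S (cmul (cbump c k) phi)) -> S (cmul (cutoff c n) phi).
Proof.
move=> sS Sb; rewrite -[cmul _ _]subr0 -(cmul_cutoff0 c phi) cmul_cutoff_diff //.
exact: subspace_sum.
Qed.

Lemma functional_cutoff_diff (S : set fct) (f : fct -> R[i]) c phi K n m :
  vsubspace S -> linear_on S f -> (forall k, S (cmul (cbump c k) phi)) ->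
  (forall k, normc (f (cmul (cbump c k) phi)) <= K * kweight k) -> (n <= m)%N ->
  normc (f (cmul (cutoff c m) phi) - f (cmul (cutoff c n) phi)) <=
    K * (box_weight d m - box_weight d n).
Proof.
move=> sS lf Sb fK nm.
rewrite -(linear_on_sub lf); try exact: subspace_cutoff.
rewrite cmul_cutoff_diff // (linear_on_sum sS lf) // -(kweight_box nm) mulr_sumr.
apply: le_trans (normc_sum _ _ _) _; apply: ler_sum => F _; exact: fK.
Qed.

Lemma cutoff_cvg c x :
  (forall s : R, \sum_(j < 2 * N) c (s - zenum j) @[N --> \oo] --> (1 : R)) ->
  cutoff c N x @[N --> \oo] --> (1 : R).
Proof.
move=> c1; have H (l : seq 'I_d) :
    \prod_(i <- l) \sum_(j < 2 * N) c (x 0 i - zenum j) @[N --> \oo] --> (1 : R).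
  elim: l => [|i l IH].
    rewrite (_ : (fun _ => _) = fun=> 1); first exact: cvg_cst.
    by apply/funext => N; rewrite big_nil.
  have E : (fun N => \prod_(k <- i :: l) \sum_(j < 2 * N) c (x 0 k - zenum j)) =
      (fun N => (\sum_(j < 2 * N) c (x 0 i - zenum j)) *
        \prod_(k <- l) \sum_(j < 2 * N) c (x 0 k - zenum j)).
    by apply/funext => N; rewrite big_cons.
  have h := cvgM (c1 (x 0 i)) IH; rewrite mulr1 in h.
  by rewrite E; exact: h.
exact: H.
Qed.

End Cutoffs.

(** * Uniform boundedness *)

Section UniformBoundedness.
Context {R : realType} {d : nat}.
Notation rV := 'rV[R]_d.
Notation fct := (rV -> R[i]).
Notation normc := Normc.normc.
Variables (S : set fct) (p : nat -> fct -> R -> Prop) (J : Type) (L : J -> fct -> R[i]).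
Hypotheses (sS : vsubspace S) (lL : forall j, linear_on S (L j)).
Hypothesis p_ge0 : forall k phi K, p k phi K -> 0 <= K.
Hypothesis p_le : forall k phi K K', K <= K' -> p k phi K -> p k phi K'.
Hypothesis p_scale : forall k (a : R) phi K, p k phi K -> p k (a%:C *: phi) (`|a| * K).
Hypothesis L_bounded : forall j, exists2 C : R, 0 <= C &
  forall phi K, S phi -> p 0 phi K -> normc (L j phi) <= C * K.
Hypothesis L_pointwise : forall phi, S phi -> exists B, forall j, normc (L j phi) <= B.
Hypothesis p_complete : forall (s : nat -> fct) (eps : R^nat),
  (forall k, S (s k)) -> (forall k, 0 < eps k) -> (forall k, eps k.+1 <= eps k / 2) ->
  (forall k, p k (s k.+1 - s k) (eps k)) ->
  exists phi, S phi /\ forall k, p 0 (phi - s k) (2 * eps k).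

(* Sokal's form of the gliding hump: one of [L (s + phi)], [L (s - phi)] is at
   least as large as [L phi]. *)
Lemma uniform_boundedness : exists k, exists2 C : R, 0 <= C &
  forall j phi K, S phi -> p k phi K -> normc (L j phi) <= C * K.
Proof.
apply: contrapT => noC.
(* If no constant works at level k, rescaling an offending element makes it as small as desired in
   [p k] while some L j stays large on it. *)
have big k (r eps : R) : 0 < r -> 0 < eps ->
    exists j phi, [/\ S phi, p k phi eps & r <= normc (L j phi)].
  move=> r0 eps0; apply: contrapT => nj; apply: noC; exists k, (r / eps).
    by rewrite divr_ge0 // ltW.
  move=> j phi K Sphi pK; rewrite leNgt; apply/negP => lt_a; apply: nj.
  have K0 := p_ge0 pK; set a := normc _ in lt_a.
  have a0 : 0 < a by apply: le_lt_trans lt_a; rewrite mulr_ge0 // divr_ge0 // ltW.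
  exists j, ((r / a)%:C *: phi); split; first exact: subspace_scale sS Sphi.
    apply: p_le (p_scale (r / a) pK); rewrite ger0_norm ?divr_ge0 ?(ltW a0) ?(ltW r0) //.
    rewrite mulrAC ler_pdivrMr // [eps * a]mulrC -ler_pdivrMr // mulrAC; exact: ltW.
  rewrite (linear_on_scale sS (lL j)) // Normc.normcM normcR ger0_norm ?divr_ge0 ?(ltW a0) ?(ltW r0) //.
  by rewrite divfK // gt_eqF.
(* A state is a point and a tolerance. The step moves the point by at most the old tolerance so that
   some L j becomes large there. The new tolerance is at most half the old one and so small that
   later moves change this L j by at most 1. *)
pose Q (k : nat) (st st' : fct * R) := S st.1 -> 0 < st.2 ->
  [/\ S st'.1, 0 < st'.2 <= st.2 / 2, p k (st'.1 - st.1) st.2 & exists j, exists C,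
    [/\ forall phi K, S phi -> p 0 phi K -> normc (L j phi) <= C * K,
      C * (2 * st'.2) <= 1 & k%:R + 1 <= normc (L j st'.1)]].
have exQ (kst : nat * (fct * R)) : exists st', Q kst.1 kst.2 st'.
  case: kst => k [s eps]; apply: contrapT => nQ.
  have [Ss eps0] : S s /\ 0 < eps.
    split; apply: contrapT => ns; apply: nQ; exists (0, 0) => //.
  have r0 : 0 < k%:R + 1 :> R by rewrite ltr_wpDl.
  have [j [phi [Sphi pphi rphi]]] := big k _ _ r0 eps0.
  have [C C0 HC] := L_bounded j.
  pose eps' := Num.min (eps / 2) (2 * C + 1)^-1.
  have C1 : 0 < 2 * C + 1 by rewrite ltr_wpDl // mulr_ge0.
  have e'0 : 0 < eps' by rewrite lt_min divr_gt0 // invr_gt0.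
  have e'e : eps' <= eps / 2 by rewrite ge_min lexx.
  have e'C : C * (2 * eps') <= 1.
    have : eps' <= (2 * C + 1)^-1 by rewrite ge_min lexx orbT.
    move/(ler_wpM2l (mulr_ge0 (ler0n R 2) C0)).
    rewrite mulrCA mulrA => /le_trans; apply.
    by rewrite ler_pdivrMr // mul1r lerDl.
  have sgn (b : bool) : k%:R + 1 <= normc (L j (((-1) ^+ b)%:C *: phi + s)) -> False.
    move=> lb; apply: nQ; exists (((-1) ^+ b)%:C *: phi + s, eps') => _ _; split=> /=.
    - exact: sS.2.
    - by rewrite e'0.
    - by rewrite addrK; have := p_scale ((-1) ^+ b) pphi; rewrite normr_sign mul1r.
    - by exists j, C.
  have h1 := sgn false; have h2 := sgn true.
  have : 2 * (k%:R + 1) <= normc (L j (((-1) ^+ false)%:C *: phi + s)) +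
      normc (L j (((-1) ^+ true)%:C *: phi + s)).
    rewrite !(lL j) //.
    rewrite -[normc (_ + L j s) in X in _ <= _ + X]normcN.
    apply: le_trans (le_normcD _ _).
    rewrite (_ : _ + - _ = 2%:C * L j phi); last by rewrite /= expr0 expr1 rmorphN rmorph1; ring.
    by rewrite Normc.normcM normcR ger0_norm // ler_wpM2l.
  move=> h3; have [|] := leP (k%:R + 1) (normc (L j (((-1) ^+ false)%:C *: phi + s))) => // h4.
  by apply: h2; lra.
have [step stepQ] := choice exQ.
pose st := fix st k := if k is k'.+1 then step (k', st k') else ((0 : fct), 1 : R).
have stP k : S (st k).1 /\ 0 < (st k).2.
  elim: k => [|k [IH1 IH2]]; first by split=> //; exact: sS.1.
  by have [] := stepQ (k, st k) IH1 IH2 => ? /andP[].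
have stQ k := stepQ (k, st k) (stP k).1 (stP k).2.
have [phi [Sphi phiP]] := @p_complete (fun k => (st k).1) (fun k => (st k).2)
  (fun k => (stP k).1) (fun k => (stP k).2)
  (fun k => ltac:(by have [_ /andP[]] := stQ k)) (fun k => ltac:(by have [] := stQ k)).
have [B HB] := L_pointwise Sphi.
(* At this stage |L j| is at least truncn |B| + 2 at the new point, hence exceeds |B| + 1; the limit
   loses at most 1, contradicting the bound B. *)
have [_ _ _ [j [C [HC C1 kL]]]] := stQ (Num.truncn `|B|).+1.
have := HC _ _ (subspace_sub sS Sphi (stP _.+1).1) (phiP (Num.truncn `|B|).+2).
rewrite (linear_on_sub (lL j)) //; last exact: (stP _.+1).1.
move=> h; have {}h := le_trans h C1.
have t (z z' : R[i]) : normc z' <= normc z + normc (z - z').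
  by rewrite -{1}[z'](subKr z) -[normc (z - z')]normcN; exact: le_normcD.
have := t (L j phi) (L j (st (Num.truncn `|B|).+2).1).
have {}kL : (Num.truncn `|B|).+1%:R + 1 <= normc (L j (st (Num.truncn `|B|).+2).1) := kL.
have := HB j; have := truncnS_gt `|B|; have := ler_norm B.
move: (normc _) (normc _) (normc _) h kL => a b e h kL; lra.
Qed.

End UniformBoundedness.

(** * Completeness and uniform boundedness for Gelfand-Shilov spaces *)

Section GelfandShilov.
Context {R : realType} {d : nat} (M A : R^nat).
Hypotheses (M_gt0 : forall p, 0 < M p) (wA : weight_sequence A).
Notation rV := 'rV[R]_d.
Notation fct := (rV -> R[i]).
Notation normc := Normc.normc.
Notation E := (expassoc A).
Implicit Types (phi psi : fct) (h K : R).

Lemma gs_weight_ge0 h (x : rV) : 0 <= E (h * enorm x).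
Proof. exact: expassoc_ge0. Qed.

Lemma gs_weight_mono h h' (x : rV) : 0 <= h' -> h' <= h -> E (h' * enorm x) <= E (h * enorm x).
Proof.
move=> h'0 h'h; apply: expassoc_mono => //; first by rewrite mulr_ge0 ?enorm_ge0.
by rewrite ler_wpM2r ?enorm_ge0.
Qed.

Lemma gs_snorm_le_mono h h' phi K : 0 <= h' -> h' <= h -> gs_snorm_le M A h phi K -> gs_snorm_le M A h' phi K.
Proof.
move=> h'0 h'h; apply: (csnorm_le_weaken M_gt0 h'0 h'h ler01) => [x|]; last by rewrite mul1r.
by rewrite gs_weight_ge0 mul1r gs_weight_mono.
Qed.

Lemma gs_snorm_le_ge0 h phi K : gs_snorm_le M A h phi K -> 0 <= K.
Proof. by apply: csnorm_le_ge0 => //; exact: gs_weight_ge0. Qed.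

Lemma abs1R (a : R) : abs1 a%:C = `|a|.
Proof. by rewrite /abs1 /= normr0 addr0. Qed.

Lemma gs_subspace c : vsubspace (carrier (gelfand_shilov c M A : lcs R d)).
Proof.
have mono h h' : 0 < h' -> h' <= h -> forall x : rV, E (h' * enorm x) <= E (h * enorm x).
  by move=> h'0 h'h x; apply: gs_weight_mono => //; exact: ltW.
have [h0 h1] := space_index_cub_subspace M_gt0 c gs_weight_ge0 mono.
split; first exact/carrier_gsP.
move=> a phi psi /(carrier_gsP M_gt0) p /(carrier_gsP M_gt0) q.
by apply/(carrier_gsP M_gt0); apply: h1.
Qed.

(** A sequence hs tending to infinity gives the Fréchet space of the Beurling case, a constant one a
    Banach step of the Roumieu limit. Differences are controlled at hs k only from index k on, hence
    the shifted sequences. *)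
Lemma gs_snorm_le_complete (hs : nat -> R) (s : nat -> fct) (eps : R^nat) :
  (forall k, 0 < hs k) -> (forall k, hs k <= hs k.+1) ->
  (forall n k, exists K, gs_snorm_le M A (hs k) (s n) K) ->
  (forall k, 0 < eps k) -> (forall k, eps k.+1 <= eps k / 2) ->
  (forall k, gs_snorm_le M A (hs k) (s k.+1 - s k) (eps k)) ->
  exists phi, forall k, gs_snorm_le M A (hs k) (phi - s k) (2 * eps k).
Proof.
move=> hs0 hsS Ss eps0 epsS sC.
have hsmono n m : (n <= m)%N -> hs n <= hs m.
  by move=> nm; rewrite -(subnK nm); elim: (m - n)%N => // k IH; apply: le_trans IH (hsS _).
have smooth_s n : smooth (s n).
  by have [K [[sr _] [si _]]] := Ss n 0%N; split.
(* As eps is at least halved at each step, eps n <= 2 eps n - 2 eps (n + 1), so the increments are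
   summed by telescoping. *)
have sC2 k n m : (k <= n)%N -> (n <= m)%N -> gs_snorm_le M A (hs k) (s m - s n) (2 * eps n - 2 * eps m).
  move=> kn nm; rewrite -(subnK nm); elim: (m - n)%N => [|i IH].
    by rewrite add0n !subrr; exact: cub0.
  rewrite addSn -[s _](subrK (s (i + n)%N)) -addrA.
  apply: (csnorm_le_le M_gt0 (ltW (hs0 k)) (gs_weight_ge0 _)
    (K := eps (i + n)%N + (2 * eps n - 2 * eps (i + n)%N))).
    by have := epsS (i + n)%N; rewrite ler_pdivlMr //; lra.
  apply: csnorm_le_add IH => //; [exact: ltW|exact: gs_weight_ge0|].
  apply: gs_snorm_le_mono (sC _); [exact: ltW|apply: hsmono; exact: leq_trans kn (leq_addl _ _)].
have eps_cvg : eps n @[n --> \oo] --> 0.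
  have le2 n : eps n <= eps 0%N * (1 / 2) ^+ n.
    elim: n => [|n IH]; first by rewrite expr0 mulr1.
    apply: le_trans (epsS n) _; rewrite exprSr mulrA; lra.
  apply: (@squeeze_cvgr _ _ _ _ (fun=> 0) (fun n => eps 0%N * (1 / 2) ^+ n)).
  - by near=> n; rewrite ltW // le2.
  - exact: cvg_cst.
  - rewrite -[X in _ --> X](mulr0 (eps 0%N)); apply: cvgMl_tmp.
    by apply: cvg_expr; rewrite ger0_norm; lra.
pose pe n := 2 * eps n * M 0%N.
have pe_cvg : pe n @[n --> \oo] --> 0.
  rewrite -[X in _ --> X](mul0r (M 0%N)); apply: cvgMr_tmp.
  by rewrite -[X in _ --> X](mulr0 2); apply: cvgMl_tmp.
have pC (part : fct -> rV -> R) (psi : fct) K x : snorm_le M (hs 0%N) (fun x => E (hs 0%N * enorm x)) (part psi) K ->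
    `|part psi x| <= K * M 0%N.
  move=> [_ /(_ [::] x)]; rewrite /= expr0 mul1r; apply: le_trans.
  by rewrite ler_peMr // expassoc_ge1.
have reC n m x : (n <= m)%N -> `|re_part (s m) x - re_part (s n) x| <= pe n.
  move=> nm; have [h1 _] := sC2 0%N n m (leq0n n) nm.
  have := pC _ _ _ x h1; rewrite /re_part -[(s m - s n) x]/(s m x - s n x).
  case: (s m x) (s n x) => a b [a' b'] /= /le_trans; apply.
  by rewrite /pe ler_wpM2r ?(ltW (M_gt0 _)) // gerBl mulr_ge0 // ltW.
have imC n m x : (n <= m)%N -> `|im_part (s m) x - im_part (s n) x| <= pe n.
  move=> nm; have [_ h1] := sC2 0%N n m (leq0n n) nm.
  have := pC _ _ _ x h1; rewrite /im_part -[(s m - s n) x]/(s m x - s n x).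
  case: (s m x) (s n x) => a b [a' b'] /= /le_trans; apply.
  by rewrite /pe ler_wpM2r ?(ltW (M_gt0 _)) // gerBl mulr_ge0 // ltW.
have cre x := cvg_of_cauchy_bound pe_cvg (fun n m nm => reC n m x nm).
have cim x := cvg_of_cauchy_bound pe_cvg (fun n m nm => imC n m x nm).
pose phi : fct := fun x => lim (re_part (s n) x @[n --> \oo]) +i* lim (im_part (s n) x @[n --> \oo]).
exists phi => k.
have e2 : 2 * eps (n + k)%N @[n --> \oo] --> 0.
  rewrite -[X in _ --> X](mulr0 2); apply: cvgMl_tmp.
  by have := eps_cvg; rewrite -(cvg_shiftn k).
have := @csnorm_le_limit R d M M_gt0 (hs k) (fun x => E (hs k * enorm x))
  (fun n => s (n + k)%N) (fun n => 2 * eps (n + k)%N) phi (hs0 k) _ _ e2 _ _ _ 0%N.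
rewrite add0n; apply.
- by move=> x; exact: expassoc_ge1.
- by move=> n; exact: smooth_s.
- move=> n m nm; apply: (csnorm_le_le M_gt0 (ltW (hs0 k)) (gs_weight_ge0 _) _
    (sC2 k (n + k)%N (m + k)%N (leq_addl _ _) _)); last by rewrite leq_add2r.
  by rewrite gerBl mulr_ge0 // ltW.
- by move=> x; have := cre x; rewrite -(cvg_shiftn k).
- by move=> x; have := cim x; rewrite -(cvg_shiftn k).
Unshelve. all: by end_near. Qed.

Lemma gs_uniform_boundedness c (J : Type) (L : J -> fct -> R[i]) :
  (forall j, linear_on (carrier (gelfand_shilov c M A)) (L j)) ->
  dual_index c (fun h => forall j, exists2 C : R, 0 <= C & forall phi K,
    carrier (gelfand_shilov c M A) phi -> gs_snorm_le M A h phi K -> normc (L j phi) <= C * K) ->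
  (forall phi, carrier (gelfand_shilov c M A) phi -> exists B, forall j, normc (L j phi) <= B) ->
  dual_index c (fun h => exists2 C : R, 0 <= C & forall j phi K,
    carrier (gelfand_shilov c M A) phi -> gs_snorm_le M A h phi K -> normc (L j phi) <= C * K).
Proof.
have main (S : set fct) (hs : nat -> R) :
  vsubspace S -> (forall k, 0 < hs k) -> (forall k, hs k <= hs k.+1) ->
  (forall phi, S phi <-> forall k, exists K, gs_snorm_le M A (hs k) phi K) ->
  (forall j, linear_on S (L j)) ->
  (forall j, exists2 C : R, 0 <= C & forall phi K,
    S phi -> gs_snorm_le M A (hs 0%N) phi K -> normc (L j phi) <= C * K) ->
  (forall phi, S phi -> exists B, forall j, normc (L j phi) <= B) ->
  exists k, exists2 C : R, 0 <= C & forall j phi K, S phi -> gs_snorm_le M A (hs k) phi K ->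
    normc (L j phi) <= C * K.
  move=> sS hs0 hsS SE lL Lb Lp.
  apply: (@uniform_boundedness R d S (fun k => gs_snorm_le M A (hs k))) => //.
  - by move=> k phi K; exact: gs_snorm_le_ge0.
  - by move=> k phi K K' KK; apply: csnorm_le_le => //; [exact: ltW|exact: gs_weight_ge0].
  - move=> k a phi K pK; rewrite -abs1R; apply: csnorm_le_scale => //; [exact: ltW|exact: gs_weight_ge0].
  move=> s eps Ss eps0 epsS sC.
  have [phi phiP] := gs_snorm_le_complete hs0 hsS (fun n => (SE (s n)).1 (Ss n)) eps0 epsS sC.
  exists phi; split=> [|k]; last first.
    apply: gs_snorm_le_mono (phiP k); first exact: ltW.
    by elim: k => // k IH; apply: le_trans IH (hsS _).
  apply/SE => k; have [K HK] := (SE (s k)).1 (Ss k) k; exists (2 * eps k + K).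
  rewrite -(subrK (s k) phi).
  by apply: csnorm_le_add => //; [exact: ltW|exact: gs_weight_ge0|exact: phiP].
case: c => lL Lb Lp /=.
  move: Lb => [h0 h00 Lb].
  have hs0 k : 0 < h0 + k%:R by rewrite ltr_wpDr.
  have hsS k : h0 + k%:R <= h0 + k.+1%:R by rewrite lerD2l ler_nat.
  have le0 : h0 <= h0 + 0%:R by rewrite addr0.
  have [|k [C C0 HC]] := main _ (fun k => h0 + k%:R) (gs_subspace Beurling) hs0 hsS _ lL
     (Lb _ le0) Lp.
  - move=> phi; split=> [/(carrier_gsP M_gt0) p k|p]; first exact: p.
    apply/(carrier_gsP M_gt0) => h hp.
    have [K HK] := p (Num.truncn h).+1; exists K; apply: gs_snorm_le_mono HK; first exact: ltW.
    by have := truncnS_gt h; lra.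
  exists (h0 + k%:R); first exact: hs0.
  move=> h hk; exists C; first exact: C0.
  move=> j phi K Sphi pK.
  exact: (HC j phi K Sphi (gs_snorm_le_mono (ltW (hs0 k)) hk pK)).
(* In the Roumieu case, boundedness on the limit is boundedness on each step; the functions of
   finite norm at the fixed h form a complete space, treated with a constant sequence. *)
move=> h hp.
have sub phi K : gs_snorm_le M A h phi K -> carrier (gelfand_shilov Roumieu M A) phi.
  by move=> pK; apply/(carrier_gsP M_gt0) => /=; exists h => //; exists K.
have [|||||k [C C0 HC]] := main [set phi | exists K, gs_snorm_le M A h phi K] (fun=> h) _
   (fun=> hp) (fun=> lexx h).
- split; first by exists 0; exact: cub0.
  move=> a phi psi [K HK] [K' HK']; exists (abs1 a * K + K'); apply: csnorm_le_lin => //.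
    exact: ltW.
  exact: gs_weight_ge0.
- by move=> phi; split=> [p _|/(_ 0%N)].
- by move=> j phi psi a [K HK] [K' HK']; apply: lL; [exact: sub HK|exact: sub HK'].
- move=> j; have [C C0 HC] := Lb h hp j; exists C => // phi K _ pK; apply: HC => //.
  exact: sub pK.
- by move=> phi [K HK]; apply: Lp; exact: sub HK.
by exists C => // j phi K _ pK; apply: HC => //; exists K.
Qed.

End GelfandShilov.

(** * Windows *)

Section Translations.
Context {R : realType} {d : nat} (M A : R^nat).
Hypotheses (M_gt0 : forall p, 0 < M p) (wA : weight_sequence A).
Notation rV := 'rV[R]_d.
Notation fct := (rV -> R[i]).
Notation normc := Normc.normc.
Notation E := (expassoc A).
Implicit Types (phi psi : fct) (h K : R) (y : rV).

Lemma gs_snorm_le_affine h phi K (a : R) y : a ^+ 2 = 1 -> 0 <= h -> gs_snorm_le M A (2 * h) phi K ->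
  gs_snorm_le M A h (fun t => phi (y + a *: t)) (E (2 * h * enorm y) * K).
Proof.
move=> a1 h0 pK; have hh : h <= 2 * h by rewrite ler_peMl // ler1n.
have := csnorm_le_affine y a1 pK.
apply: (csnorm_le_weaken M_gt0 h0 hh (expassoc_ge0 _ _)) => // t.
rewrite gs_weight_ge0 /= -(enorm_sign t a1) -(enormN y) [leRHS]mulrC.
by rewrite -[X in E (h * enorm X)](addKr y) addrC; exact: expassoc_enorm_add.
Qed.

Lemma gs_affine c phi (a : R) y : a ^+ 2 = 1 ->
  carrier (gelfand_shilov c M A) phi ->
  carrier (gelfand_shilov c M A) (fun t => phi (y + a *: t)).
Proof.
move=> a1 /(carrier_gsP M_gt0) p; apply/(carrier_gsP M_gt0).
apply: space_index_scale p => [|h h0 [K HK]]; first exact: (ltr0Sn _ 1).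
by exists (E (2 * h * enorm y) * K); apply: gs_snorm_le_affine => //; exact: ltW.
Qed.

End Translations.

Section BumpEstimates.
Context {R : realType} {d : nat} (M A : R^nat).
Hypotheses (M_gt0 : forall p, 0 < M p) (M1M : M1 M) (wA : weight_sequence A) (M2A : M2 A).
Notation rV := 'rV[R]_d.
Notation fct := (rV -> R[i]).
Notation normc := Normc.normc.
Notation E := (expassoc A).
Implicit Types (phi psi : fct) (h K : R) (y k x : rV).
Variable (c0 : R -> R).
Hypothesis chiK : forall h, 0 < h -> exists K,
  snorm_le M h (fun x : rV => E (h * enorm x)) (fun x => \prod_i c0 (x 0 i)) K.

Lemma chi_bound h l : 0 < h -> 0 < l -> exists2 K, 0 <= K &
  snorm_le M h (fun x : rV => E (l * enorm x)) (fun x => \prod_i c0 (x 0 i)) K.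
Proof.
move=> h0 l0; have m0 : 0 < Num.max h l by rewrite lt_max h0.
have [K HK] := chiK m0; exists K; first by apply: snorm_le_ge0 HK => //; exact: gs_weight_ge0.
apply: (snorm_le_weaken M_gt0 (ltW h0) _ ler01 _ _ HK); rewrite ?mul1r ?le_max ?lexx // => x.
by rewrite gs_weight_ge0 mul1r gs_weight_mono // ?le_max ?lexx ?orbT // ltW.
Qed.

(* Admissibility moves the weight from [k + s] to the centre [k] of the window. *)
Lemma chi_translate_gs_snorm_le (v vm : rV -> R) (C1 l h : R) : 0 < l -> 0 < C1 -> 0 < h ->
  (forall x, 0 < v x) -> (forall x, 0 < vm x) ->
  (forall x t, vm (x + t) <= C1 * v x * E (l * enorm t)) ->
  exists2 C, 0 <= C & forall phi K k, csnorm_le M (2 * h) v phi K ->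
    gs_snorm_le M A h (cmul (fun x => \prod_i c0 (x 0 i)) (fun s => phi (k + 1 *: s))) (C * K / vm k).
Proof.
move=> l0 C10 h0 v0 vm0 adm.
have [Ce [H [Ce1 H1 EE]]] := expassoc_sqr wA M2A.
(* The weight E(h |s|) to be reached and the loss E(l |s|) from admissibility are together at most
   E(mu |s|)^2 <= Ce E(H mu |s|), which the window pays for. *)
pose mu := Num.max h l.
have mu0 : 0 < mu by rewrite lt_max h0.
have H0 : 0 < H by apply: lt_le_trans H1.
have Ce0 : 0 < Ce by apply: lt_le_trans Ce1.
have h20 : 0 < 2 * h by rewrite mulr_gt0.
have [Kc Kc0 HKc] := chi_bound h20 (mulr_gt0 H0 mu0).
exists (M 0%N * (C1 * Ce * Kc)); first by rewrite !mulr_ge0 // ltW.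
move=> phi K k pK.
pose a := C1 * Ce / vm k.
have a0 : 0 <= a by rewrite divr_ge0 ?mulr_ge0 // ltW.
have chi1 : snorm_le M (2 * h) (fun x => a * E (H * mu * enorm x)) (fun x : rV => \prod_i c0 (x 0 i)) (a * Kc).
  apply: (snorm_le_weaken M_gt0 (ltW h20) (lexx _) a0 _ (lexx _) HKc) => x.
  by rewrite lexx andbT mulr_ge0 // gs_weight_ge0.
have pk : csnorm_le M (2 * h) (fun s => v (k + 1 *: s)) (fun s => phi (k + 1 *: s)) K.
  by apply: csnorm_le_affine => //; rewrite expr1n.
have := @csnorm_le_mul R d M M_gt0 (2 * h) (fun x => E (h * enorm x)) _ _ _ _ _ _ M1M h20 _ _ _ chi1 pk.
rewrite (_ : 2 * h / 2 = h); last by field.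
rewrite (_ : M 0%N * (a * Kc) * K = M 0%N * (C1 * Ce * Kc) * K / vm k).
  apply=> s; [by rewrite mulr_ge0 // gs_weight_ge0|by rewrite ltW|].
  rewrite gs_weight_ge0 /= [leRHS](_ : _ =
    C1 * Ce * E (H * mu * enorm s) * v (k + 1 *: s) / vm k); last by rewrite /a; ring.
  rewrite ler_pdivlMr //.
  have := adm (k + 1 *: s) (- s); rewrite scale1r addrK enormN => h1.
  apply: le_trans (ler_wpM2l (gs_weight_ge0 _ _ _) h1) _.
  rewrite [leRHS](_ : _ = C1 * v (k + s) * (Ce * E (H * (mu * enorm s)))); last by rewrite -[H * mu * _]mulrA; ring.
  rewrite mulrCA; apply: ler_wpM2l; first exact: (mulr_ge0 (ltW C10) (ltW (v0 _))).
  apply: le_trans (EE _ _); last by rewrite mulr_ge0 ?(ltW mu0) ?enorm_ge0.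
  have hmu : h <= mu by rewrite le_max lexx.
  have lmu : l <= mu by rewrite le_max lexx orbT.
  apply: ler_pM; [exact: gs_weight_ge0|exact: gs_weight_ge0| |].
    exact: (gs_weight_mono wA s (ltW h0) hmu).
  exact: (gs_weight_mono wA s (ltW l0) lmu).
by rewrite /a; ring.
Qed.

(** Recentres the window at the origin: the product is the translate by k of a function to which a
    bound on translates of f applies. *)
Lemma bumpE k phi : cmul (cbump c0 k) phi = (fun t =>
  cmul (fun x => \prod_i c0 (x 0 i)) (fun s => phi (k + 1 *: s)) (- k + 1 *: t)).
Proof.
apply/funext => t; rewrite /cmul /cbump !scale1r addNKr addrC; congr (_%:C * _).
by apply: eq_bigr => i _; rewrite !mxE addrC.
Qed.

(** The arithmetic of the next lemma, with P = prod_i (1 + k_i^2) and kw its inverse. *)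
Lemma weight_split (C Ce T P kw Ex Ek EH : R) : 0 <= C -> 0 < P -> kw * P = 1 -> 0 <= T ->
  0 <= Ex -> 0 <= Ek -> P <= T * (C * Ex * (C * Ek)) -> Ex * Ex <= Ce * EH ->
  Ex <= T * C * C * Ce * kw * Ek * EH.
Proof.
move=> C0 P0 kP T0 Ex0 Ek0 h1 h2; rewrite -(ler_pM2r P0).
rewrite (_ : _ * EH * P = T * C * C * Ek * (Ce * EH) * (kw * P)); last by ring.
rewrite kP mulr1; apply: le_trans (ler_wpM2l Ex0 h1) _.
rewrite (_ : Ex * _ = T * C * C * Ek * (Ex * Ex)); last by ring.
by rewrite ler_wpM2l // !mulr_ge0.
Qed.

(** Since 1 + k_i^2 <= 2 (1 + x_i^2) (1 + (x_i - k_i)^2), the summable factor in k is shared between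
    the decay of phi at x and that of the window at x - k. *)
Lemma bump_gs_snorm_le : exists2 l, 0 < l & forall h, 0 < h -> exists2 C, 0 <= C &
  forall phi K k, gs_snorm_le M A (l * h) phi K -> gs_snorm_le M A h (cmul (cbump c0 k) phi) (C * K * kweight k).
Proof.
have [Ce [H [Ce1 H1 EE]]] := expassoc_sqr wA M2A.
have Ce0 : 0 < Ce by apply: lt_le_trans Ce1.
have H0 : 0 < H by apply: lt_le_trans H1.
exists (Num.max 2 H) => [|h h0]; first by rewrite lt_max H0 orbT.
have h20 : 0 < 2 * h by rewrite mulr_gt0.
have [Kc Kc0 HKc] := chi_bound h20 h0.
have [C C0 HC] := @prod_sqr_le_expassoc R d A wA h h0.
pose L := Num.max 2 H * h.
have L2 : 2 * h <= L by rewrite /L ler_wpM2r ?(ltW h0) // le_max lexx.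
have LH : H * h <= L by rewrite /L ler_wpM2r ?(ltW h0) // le_max lexx orbT.
pose b := 2 ^+ d * C * C * Ce; have b0 : 0 <= b by rewrite !mulr_ge0 ?exprn_ge0 // ltW.
exists (M 0%N * (b * Kc)); first by rewrite !mulr_ge0 // ltW.
move=> phi K k pK.
have kw0 : 0 <= kweight k by apply: prodr_ge0 => i _; rewrite invr_ge0 addr_ge0 ?sqr_ge0.
have bk : snorm_le M (2 * h) (fun x => b * kweight k * E (h * enorm (- k + 1 *: x))) (cbump c0 k)
    (b * kweight k * Kc).
  have := snorm_le_affine (- k) (expr1n R 2) HKc.
  rewrite (_ : (fun x : rV => \prod_i c0 _) = cbump c0 k); last first.
    by apply/funext => x; apply: eq_bigr => i _; rewrite !mxE mul1r addrC.
  apply: (snorm_le_weaken M_gt0 (ltW h20) (lexx _) _ _ (lexx _)) => [|x]; first exact: mulr_ge0.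
  rewrite lexx andbT /=; apply: mulr_ge0; last exact: gs_weight_ge0.
  exact: mulr_ge0.
have pL : csnorm_le M (2 * h) (fun x => E (H * h * enorm x)) phi K.
  apply: (csnorm_le_weaken M_gt0 (ltW h20) L2 ler01 _ _ pK); rewrite ?mul1r // => x.
  rewrite gs_weight_ge0 mul1r; apply: (gs_weight_mono wA x _ LH).
  by rewrite mulr_ge0 // ltW.
have := @csnorm_le_mul R d M M_gt0 (2 * h) (fun x => E (h * enorm x)) _ _ _ _ _ _ M1M h20 _ _ _ bk pL.
rewrite (_ : 2 * h / 2 = h); last by field.
rewrite (_ : M 0%N * (b * kweight k * Kc) * K = M 0%N * (b * Kc) * K * kweight k);
  last by ring.
apply=> x; [|exact: gs_weight_ge0|].
  by apply: mulr_ge0; [exact: mulr_ge0|exact: gs_weight_ge0].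
rewrite gs_weight_ge0 /=.
have kp : 0 < \prod_i (1 + k 0 i ^+ 2) by apply: prodr_gt0 => i _; rewrite ltr_pwDl // sqr_ge0.
have kE : kweight k = (\prod_i (1 + k 0 i ^+ 2))^-1 by rewrite /kweight prodfV.
have h1 : \prod_i (1 + k 0 i ^+ 2) <= 2 ^+ d * (C * E (h * enorm x) * (C * E (h * enorm (- k + 1 *: x)))).
  apply: (@le_trans _ _ (2 ^+ d * (\prod_i (1 + x 0 i ^+ 2) * \prod_i (1 + (- k + 1 *: x) 0 i ^+ 2)))).
    rewrite -big_split /= -[X in 2 ^+ X](card_ord d) -prodr_const -big_split /=.
    apply: ler_prod => i _; rewrite addr_ge0 ?sqr_ge0 //= !mxE mul1r.
    move: (x 0 i) (k 0 i) => p q.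
    by have := sqr_ge0 (2 * p - q); have := sqr_ge0 (p * (p - q)); lra.
  rewrite ler_wpM2l ?exprn_ge0 //; apply: ler_pM; rewrite ?HC //.
    by apply: prodr_ge0 => i _; rewrite addr_ge0 ?sqr_ge0.
  by apply: prodr_ge0 => i _; rewrite addr_ge0 ?sqr_ge0.
have h2 := EE _ (mulr_ge0 (ltW h0) (enorm_ge0 x)); rewrite mulrA in h2.
have kP : kweight k * \prod_i (1 + k 0 i ^+ 2) = 1 by rewrite kE mulVf // gt_eqF.
exact: (weight_split (ltW C0) kp kP (exprn_ge0 d (ler0n R 2)) (gs_weight_ge0 A h x)
  (gs_weight_ge0 A h _) h1 h2).
Qed.

End BumpEstimates.

(** * Consequences of admissibility and decay of the weights *)

Section WeightSystems.
Context {R : realType} {d : nat} (A : R^nat) (V : nat -> 'rV[R]_d -> R).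
Hypotheses (wA : weight_sequence A) (hV : decreasing_weight_system V).
Notation rV := 'rV[R]_d.
Notation E := (expassoc A).
Implicit Types (x t : rV).

Lemma weight_mono n m x : (n <= m)%N -> V m x <= V n x.
Proof.
have [_ _ dV] := hV.
by move=> nm; rewrite -(subnK nm); elim: (m - n)%N => // k; apply: le_trans; exact: dV.
Qed.

(** Puts both forms of admissibility under one quantifier; in the Beurling case a larger l only
    weakens the inequality. *)
Lemma admissible_dual_index c : admissible c A V -> forall n, dual_index c (fun l =>
  exists2 m, (n <= m)%N & exists2 C : R, 0 < C &
    forall x t, V m (x + t) <= C * V n x * E (l * enorm t)).
Proof.
have [V0 _ _] := hV.
case: c => adm n /=; last by move=> l; exact: adm.
have [l l0 [m nm [C C0 H]]] := adm n.
exists l; [exact: l0|move=> l' ll'; exists m; first exact: nm].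
exists C; [exact: C0|move=> x t; apply: le_trans (H x t) _].
apply: ler_wpM2l; first by rewrite mulr_ge0 // ltW.
by apply: (gs_weight_mono wA t _ ll'); exact: ltW.
Qed.

(** Two steps of decay give |x|^(-2 (d + 1)), which beats prod_i (1 + x_i^2) far from the origin. On
    the remaining ball that product is bounded and monotonicity of the system is enough. *)
Lemma decay_kweight : decay_condition V -> forall n, exists2 m, (n <= m)%N &
  exists2 C : R, 0 < C & forall x, V m x <= C * V n x * kweight x.
Proof.
have [V0 _ _] := hV.
move=> dec n; have [m1 nm1 [C1 [r1 [C10 r10 H1]]]] := dec n.
have [m2 m12 [C2 [r2 [C20 r20 H2]]]] := dec m1.
pose r := 1 + r1 + r2.
have r0 : 0 < r by rewrite /r; lra.
pose Ca := C1 * C2 * 2 ^+ d.+1; pose Cb := 2 ^+ d * (1 + r ^+ (2 * d)).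
have Ca0 : 0 < Ca by rewrite !mulr_gt0 ?exprn_gt0.
have Cb0 : 0 < Cb by rewrite mulr_gt0 ?exprn_gt0 // addr_gt0 ?exprn_gt0.
exists m2; first exact/ltnW/(ltn_trans nm1).
exists (Ca + Cb); first exact: addr_gt0.
move=> x; have kp : 0 < \prod_i (1 + x 0 i ^+ 2) by apply: prodr_gt0 => i _; rewrite ltr_pwDl // sqr_ge0.
rewrite /kweight prodfV ler_pdivlMr //.
have P1 := prod_sqr_le x; set P := \prod_i _ in kp P1 *.
have Vn0 := ltW (V0 n x).
have [xr|xr] := leP r (enorm x).
  have x1 : 1 <= enorm x by apply: le_trans xr; rewrite /r; lra.
  have x0 : 0 < enorm x by apply: lt_le_trans x1.
  have q0 : 0 < enorm x ^+ d.+1 by rewrite exprn_gt0.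
  have h1 : V m1 x * enorm x ^+ d.+1 <= C1 * V n x.
    have := H1 x (le_trans _ xr); rewrite ler_pdivrMr // mulrAC ler_pdivlMr //.
    by apply; rewrite /r; lra.
  have h2 : V m2 x * enorm x ^+ d.+1 <= C2 * V m1 x.
    have := H2 x (le_trans _ xr); rewrite ler_pdivrMr // mulrAC ler_pdivlMr //.
    by apply; rewrite /r; lra.
  have P2 : P <= 2 ^+ d.+1 * (enorm x ^+ d.+1 * enorm x ^+ d.+1).
    apply: le_trans P1 _; rewrite exprSr -mulrA ler_wpM2l ?exprn_ge0 //.
    rewrite -exprD.
    have : enorm x ^+ (2 * d) <= enorm x ^+ (d.+1 + d.+1).
      by apply: ler_weXn2l; [exact: x1|rewrite mul2n -addnn leq_add // leqnSn].
    have : 1 <= enorm x ^+ (d.+1 + d.+1) by apply: exprn_ege1.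
    by move: (enorm x ^+ _) (enorm x ^+ _) => a b; lra.
  apply: (@le_trans _ _ (Ca * V n x)); last by rewrite ler_wpM2r // lerDl ltW.
  apply: le_trans (ler_wpM2l (ltW (V0 m2 x)) P2) _.
  have h3 : V m2 x * enorm x ^+ d.+1 * enorm x ^+ d.+1 <= C2 * (C1 * V n x).
    apply: le_trans (ler_wpM2r (ltW q0) h2) _.
    by rewrite -mulrA ler_wpM2l // ltW.
  rewrite mulrCA [V m2 x * _]mulrA.
  have -> : Ca * V n x = 2 ^+ d.+1 * (C2 * (C1 * V n x)) by rewrite /Ca; ring.
  by apply: ler_wpM2l h3; rewrite exprn_ge0.
apply: (@le_trans _ _ (Cb * V n x)); last by rewrite ler_wpM2r // lerDr ltW.
rewrite mulrC; apply: ler_pM; rewrite ?(ltW kp) ?(ltW (V0 _ _)) //.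
  apply: le_trans P1 _; rewrite ler_wpM2l ?exprn_ge0 // lerD2l.
  by apply: lerXn2r; rewrite ?nnegrE ?enorm_ge0 ?(ltW r0) ?(ltW xr).
by apply: weight_mono; exact/ltnW/(ltn_trans nm1).
Qed.

End WeightSystems.

(** * Extension of the functional *)

Section Extension.
Context {R : realType} {d : nat} (c : ucase) (M A : R^nat) (V : nat -> 'rV[R]_d -> R).
Hypotheses (d_gt0 : (0 < d)%N) (M_gt0 : forall p, 0 < M p) (M1M : M1 M).
Hypotheses (wA : weight_sequence A) (M2A : M2 A) (hV : decreasing_weight_system V).
Notation rV := 'rV[R]_d.
Notation fct := (rV -> R[i]).
Notation normc := Normc.normc.
Notation E := (expassoc A).
Notation S := (carrier (gelfand_shilov c M A : lcs R d)).
Implicit Types (phi psi : fct) (h K : R) (k x : rV).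

Variable (f : fct -> R[i]).
Hypothesis lf : linear_on S f.
Hypothesis f_bounded : dual_index c (fun h => exists2 C : R, 0 <= C & forall phi K,
  S phi -> gs_snorm_le M A h phi K -> normc (f phi) <= C * K).
Hypothesis f_pointwise : forall n phi, S phi ->
  exists B, forall x, normc (convolution f phi x) * (V n x)^-1 <= B.
Hypothesis adm : admissible c A V.
Hypothesis dec : decay_condition V.

Let V_gt0 n x : 0 < V n x. Proof. by have [V0 _ _] := hV. Qed.
Let sS : vsubspace S. Proof. exact: gs_subspace. Qed.

(** Uniform boundedness for the functionals phi |-> f(phi(. - x)) / V_n(x), indexed by x. Each is
    bounded because translation is; on a fixed phi they are values of the convolution with the
    reflected phi. *)
Lemma translate_bound n : dual_index c (fun h => exists2 C : R, 0 <= C & forall x phi K,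
  S phi -> gs_snorm_le M A h phi K -> normc (f (fun t => phi (- x + 1 *: t))) <= C * V n x * K).
Proof.
have sq1 : (1 : R) ^+ 2 = 1 by rewrite expr1n.
have sqN1 : (-1 : R) ^+ 2 = 1 by rewrite sqrrN expr1n.
pose L x phi := ((V n x)^-1)%:C * f (fun t => phi (- x + 1 *: t)).
have LE x phi : normc (L x phi) = normc (f (fun t => phi (- x + 1 *: t))) * (V n x)^-1.
  by rewrite Normc.normcM normcR mulrC ger0_norm // invr_ge0 ltW.
suff U : dual_index c (fun h => exists2 C : R, 0 <= C & forall x phi K,
    S phi -> gs_snorm_le M A h phi K -> normc (L x phi) <= C * K).
  apply: dual_index_imp U => h h0 [C C0 HC]; exists C => // x phi K Sphi pK.
  have := HC x phi K Sphi pK; rewrite LE ler_pdivrMr // => /le_trans; apply.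
  by rewrite mulrAC.
apply: gs_uniform_boundedness => //.
- move=> x phi psi a Sphi Spsi.
  rewrite /L -[fun t => (a *: phi + psi) _]/(a *: (fun t => phi (- x + 1 *: t)) +
    (fun t => psi (- x + 1 *: t))) lf; [|exact: gs_affine|exact: gs_affine].
  by rewrite mulrDr mulrCA.
- have := dual_index_scale (_ : 0 < 1 / 2) f_bounded; rewrite divr_gt0 // => /(_ isT).
  apply: dual_index_imp => h h0 [C C0 HC] x.
  exists (C * E (2 * (1 / 2 * h) * enorm (- x)) * (V n x)^-1).
    by rewrite !mulr_ge0 ?invr_ge0 ?(ltW (V_gt0 _ _)) // gs_weight_ge0.
  move=> phi K Sphi pK; rewrite LE [leRHS]mulrAC ler_wpM2r ?invr_ge0 ?(ltW (V_gt0 _ _)) //.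
  rewrite -[leRHS]mulrA; apply: HC; first exact: gs_affine.
  have hh : 2 * (1 / 2 * h) = h by field.
  have h20 : 0 <= 1 / 2 * h by rewrite mulr_ge0 // ?divr_ge0 // ltW.
  by apply: (gs_snorm_le_affine M_gt0 wA _ sq1 h20); rewrite hh.
- move=> phi Sphi.
  have Sr : S (fun t => phi (0 + -1 *: t)) by apply: gs_affine.
  have [B HB] := f_pointwise n Sr; exists B => x; rewrite LE.
  apply: le_trans (HB x); rewrite le_eqVlt; apply/orP; left; apply/eqP.
  congr (normc (f _) * _); apply/funext => t; congr (phi _).
  by rewrite add0r scaleN1r opprB scale1r addrC.
Qed.

Variable (c0 : R -> R).
Hypothesis chiK : forall h, 0 < h -> exists K,
  snorm_le M h (fun x : rV => E (h * enorm x)) (fun x => \prod_i c0 (x 0 i)) K.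
Hypothesis chi_sum :
  forall s : R, \sum_(j < 2 * N) c0 (s - zenum j) @[N --> \oo] --> (1 : R).

Lemma dual_index_ex (P : R -> Prop) : dual_index c P -> exists2 h, 0 < h & P h.
Proof.
move=> eP; have tt1 : space_index c (fun _ : R => True) by case: (c) => //=; exists 1.
by have [h [h0 Ph _]] := dual_index_fr eP tt1; exists h.
Qed.

Lemma window_gs_snorm_le n h : 0 < h -> exists2 m, (n <= m)%N & exists2 C : R, 0 <= C &
  forall phi K k, csnorm_le M (2 * h) (V n) phi K ->
  gs_snorm_le M A h (cmul (fun x : rV => \prod_i c0 (x 0 i)) (fun s => phi (k + 1 *: s))) (C * K / V m k).
Proof.
move=> h0; have [l l0 [m nm [C1 C10 H]]] := dual_index_ex (admissible_dual_index wA hV adm n).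
exists m; first exact: nm.
exact: (chi_translate_gs_snorm_le M_gt0 M1M wA M2A chiK l0 C10 h0 (V_gt0 n) (V_gt0 m) H).
Qed.

Lemma bump_member n phi k : carrier (Bw c M (V n)) phi -> S (cmul (cbump c0 k) phi).
Proof.
have Vn0 x : 0 <= V n x by exact/ltW/V_gt0.
move=> /(carrier_BwP M_gt0 _ _ Vn0) p.
rewrite (bumpE c0 k phi); apply: gs_affine => //; first by rewrite expr1n.
apply/(carrier_gsP M_gt0); apply: space_index_scale p => [|h h0 [K HK]]; first exact: (ltr0Sn _ 1).
have [m _ [C C0 HC]] := window_gs_snorm_le n h0.
by exists (C * K / V m k); exact: HC.
Qed.

(** Three indices are chained: admissibility gives m and the norm O(1 / V_m(k)) of the recentred
    window, decay gives m' with V_m' / V_m = O([kweight]), and f is bounded on translates by k with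
    factor V_m'(k). *)
Lemma bump_functional n : dual_index c (fun h => exists2 C : R, 0 <= C & forall phi K k,
  carrier (Bw c M (V n)) phi -> csnorm_le M h (V n) phi K ->
  normc (f (cmul (cbump c0 k) phi)) <= C * K * kweight k).
Proof.
have [l l0 [m nm [C1 C10 H]]] := dual_index_ex (admissible_dual_index wA hV adm n).
have [m' mm' [C2 C20 H2]] := decay_kweight hV dec m.
have := dual_index_scale (_ : 0 < 1 / 2) (translate_bound m'); rewrite divr_gt0 // => /(_ isT).
apply: dual_index_imp => h h0 [C C0 HC].
have h20 : 0 < 1 / 2 * h by rewrite mulr_gt0 // divr_gt0.
have [C3 C30 H3] := chi_translate_gs_snorm_le M_gt0 M1M wA M2A chiK l0 C10 h20 (V_gt0 n) (V_gt0 m) H.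
exists (C * C2 * C3); first by rewrite !mulr_ge0 // ltW.
have hh : 2 * (1 / 2 * h) = h by field.
rewrite hh in H3.
move=> phi K k Bphi pK; have g := H3 phi K k pK.
have Sz : S (cmul (fun x : rV => \prod_i c0 (x 0 i)) (fun s => phi (k + 1 *: s))).
  have := bump_member k Bphi.
  rewrite (bumpE c0 k phi) => /(gs_affine M_gt0 wA k (expr1n R 2)).
  congr (S _); apply/funext => t; congr (cmul _ _ _).
  by rewrite !scale1r addKr.
have := HC k _ _ Sz g; rewrite (bumpE c0 k phi) => /le_trans; apply.
have K0 := csnorm_le_ge0 M_gt0 (ltW (V_gt0 n 0)) pK.
have := H2 k; have := V_gt0 m k; move: (V m k) (V m' k) (kweight k) => v v' w v0 vv'.
rewrite (_ : C * v' * (C3 * K / v) = C * C3 * K * (v' / v)); last by ring.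
rewrite (_ : C * C2 * C3 * K * w = C * C3 * K * (C2 * w)); last by ring.
apply: ler_wpM2l; first by rewrite !mulr_ge0.
by rewrite ler_pdivrMr // mulrAC.
Qed.

Let F phi N := f (cmul (cutoff c0 N) phi).

(** No index n enters, so the definition is automatically consistent over the union of the
    spaces. *)
Definition extension phi : R[i] :=
  lim (complex.Re (F phi N) @[N --> \oo]) +i* lim (complex.Im (F phi N) @[N --> \oo]).

Notation B := (carrier (Bind c M V)).

Lemma complex_re_sub (z z' : R[i]) : complex.Re (z - z') = complex.Re z - complex.Re z'.
Proof. by case: z z' => ? ? []. Qed.

Lemma complex_im_sub (z z' : R[i]) : complex.Im (z - z') = complex.Im z - complex.Im z'.
Proof. by case: z z' => ? ? []. Qed.

Lemma extension_of_cvg phi (z : R[i]) :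
  complex.Re (F phi N) @[N --> \oo] --> complex.Re z ->
  complex.Im (F phi N) @[N --> \oo] --> complex.Im z -> extension phi = z.
Proof.
case: z => a b /= ca cb; rewrite /extension; congr (_ +i* _).
  exact: (cvg_lim (@norm_hausdorff _ _) ca).
exact: (cvg_lim (@norm_hausdorff _ _) cb).
Qed.

Lemma cutoff_member n phi N : carrier (Bw c M (V n)) phi -> S (cmul (cutoff c0 N) phi).
Proof. by move=> Bphi; apply: subspace_cutoff => // k; exact: bump_member Bphi. Qed.

Lemma F0 phi : F phi 0 = 0.
Proof. by rewrite /F cmul_cutoff0 //; exact: (linear_on0 sS lf). Qed.

Lemma F_diff n phi K N N' : carrier (Bw c M (V n)) phi ->
  (forall k, normc (f (cmul (cbump c0 k) phi)) <= K * kweight k) -> (N <= N')%N ->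
  normc (F phi N' - F phi N) <= K * (box_weight d N' - box_weight d N).
Proof.
move=> Bphi fK NN.
exact: (functional_cutoff_diff d_gt0 sS lf (fun k => bump_member k Bphi) fK NN).
Qed.

Lemma bump_K n phi : carrier (Bw c M (V n)) phi -> exists K, 0 <= K /\
  forall k, normc (f (cmul (cbump c0 k) phi)) <= K * kweight k.
Proof.
move=> Bphi; have Vn0 x : 0 <= V n x by exact/ltW/V_gt0.
have [h [h0 [C C0 HC] [K pK]]] := dual_index_fr (bump_functional n) ((carrier_BwP M_gt0 _ _ Vn0).1 Bphi).
exists (C * K); split; last by move=> k; exact: HC.
by rewrite mulr_ge0 // (csnorm_le_ge0 M_gt0 _ pK).
Qed.

Lemma F_cvg phi : B phi ->
  complex.Re (F phi N) @[N --> \oo] --> complex.Re (extension phi) /\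
  complex.Im (F phi N) @[N --> \oo] --> complex.Im (extension phi).
Proof.
move=> [n _ Bphi]; have [K [K0 HK]] := bump_K Bphi.
have [eps eps0 We] := @box_weight_cvg R d.
have e0 : K * eps N @[N --> \oo] --> 0.
  by rewrite -[X in _ --> X](mulr0 K); apply: cvgMl_tmp.
have FC N N' : (N <= N')%N -> normc (F phi N' - F phi N) <= K * eps N.
  move=> NN; apply: le_trans (F_diff Bphi HK NN) _.
  by apply: ler_wpM2l => //; exact: We.
split=> /=; apply: (cvg_of_cauchy_bound e0) => N N' NN.
  by rewrite -complex_re_sub (le_trans (normc_ge_re _)) // FC.
by rewrite -complex_im_sub (le_trans (normc_ge_im _)) // FC.
Qed.

Lemma extension_linear : linear_on B extension.
Proof.
move=> phi psi a Bphi Bpsi; have [n _ phin] := Bphi; have [m _ psim] := Bpsi.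
have FE N : F (a *: phi + psi) N = a * F phi N + F psi N.
  rewrite /F -lf; [|exact: cutoff_member phin|exact: cutoff_member psim].
  congr f; apply/funext => x; rewrite /cmul.
  rewrite -[(a *: phi + psi) x]/(a * phi x + psi x).
  rewrite -[RHS]/(a * (_ * phi x) + _ * psi x); ring.
have [r1 i1] := F_cvg Bphi; have [r2 i2] := F_cvg Bpsi.
move: (extension phi) (extension psi) r1 i1 r2 i2 => z w r1 i1 r2 i2.
apply: extension_of_cvg.
  have -> : (fun N => complex.Re (F (a *: phi + psi) N)) = (fun N =>
    complex.Re a * complex.Re (F phi N) - complex.Im a * complex.Im (F phi N) + complex.Re (F psi N)).
    by apply/funext => N; rewrite FE; case: (a) (F phi N) (F psi N) => ? ? [? ?] [].
  have -> : complex.Re (a * z + w) =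
    complex.Re a * complex.Re z - complex.Im a * complex.Im z + complex.Re w.
    by case: (a) (z) (w) => ? ? [? ?] [].
  by apply: cvgD => //; apply: cvgB; apply: cvgMl_tmp.
have -> : (fun N => complex.Im (F (a *: phi + psi) N)) = (fun N =>
  complex.Re a * complex.Im (F phi N) + complex.Im a * complex.Re (F phi N) + complex.Im (F psi N)).
  by apply/funext => N; rewrite FE; case: (a) (F phi N) (F psi N) => ? ? [? ?] []; rewrite /= => *; ring.
have -> : complex.Im (a * z + w) =
  complex.Re a * complex.Im z + complex.Im a * complex.Re z + complex.Im w.
  by case: (a) (z) (w) => ? ? [? ?] []; rewrite /= => *; ring.
by apply: cvgD => //; apply: cvgD; apply: cvgMl_tmp.
Qed.

Lemma extension_bounded n : dual_index c (fun h => exists2 C : R, 0 <= C & forall phi K,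
  carrier (Bw c M (V n)) phi -> csnorm_le M h (V n) phi K -> normc (extension phi) <= C * K).
Proof.
have [eps eps0 We] := @box_weight_cvg R d.
have e00 : 0 <= eps 0%N by apply: le_trans (We 0%N 0%N _); rewrite ?subrr.
apply: dual_index_imp (bump_functional n) => h h0 [C C0 HC].
exists (2 * (C * eps 0%N)); first by rewrite !mulr_ge0.
move=> phi K Bphi pK; have K0 := csnorm_le_ge0 M_gt0 (ltW (V_gt0 n 0)) pK.
(* The empty cutoff contributes 0, so the rate at index 0 bounds all the partial sums. *)
have FK N : normc (F phi N) <= C * K * eps 0%N.
  rewrite -[F phi N]subr0 -(F0 phi).
  apply: le_trans (F_diff Bphi (fun k => HC phi K k Bphi pK) (leq0n N)) _.
  by apply: ler_wpM2l; [exact: mulr_ge0|exact: We].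
have [r i] : `|complex.Re (extension phi)| <= C * K * eps 0%N /\
    `|complex.Im (extension phi)| <= C * K * eps 0%N.
  have [r i] := F_cvg (ex_intro2 _ _ n I Bphi).
  split; [apply: (cvgr_to_le (cvg_norm r))|apply: (cvgr_to_le (cvg_norm i))];
    apply: nearW => N; apply: le_trans (FK N); [exact: normc_ge_re|exact: normc_ge_im].
apply: le_trans (normc_le _) _; apply: le_trans (lerD r i) _.
by rewrite le_eqVlt; apply/orP; left; apply/eqP; ring.
Qed.

(** The cutoffs of phi are Cauchy in a norm that controls f, and converge pointwise to phi because
    the translates sum to 1; hence they converge to phi in that norm. *)
Lemma cutoff_rate phi : S phi -> exists2 eps : R^nat, eps N @[N --> \oo] --> 0 &
  forall N, normc (F phi N - f phi) <= eps N.
Proof.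
move=> Sphi; have := Sphi => /(carrier_gsP M_gt0) p.
have [l l0 Hl] := bump_gs_snorm_le M_gt0 M1M wA M2A chiK.
have [eps eps0 We] := @box_weight_cvg R d.
have Sb k : S (cmul (cbump c0 k) phi).
  apply/(carrier_gsP M_gt0); apply: space_index_scale p => [|h h0 [K HK]]; first exact: l0.
  have [C C0 HC] := Hl h h0.
  by exists (C * K * kweight k); apply: HC.
have SN N : S (cmul (cutoff c0 N) phi) by apply: subspace_cutoff.
have p' : space_index c (fun h => exists K, gs_snorm_le M A (l * h) phi K).
  by apply: space_index_scale p => [|h h0 HK]; [exact: l0|exact: HK].
have [h [h0 [Cf Cf0 Hf] [K pK]]] := dual_index_fr f_bounded p'.
have [C C0 HC] := Hl h h0; have K0 := gs_snorm_le_ge0 M_gt0 pK.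
have w0 := @gs_weight_ge0 R d A h.
have bK k := HC phi K k pK.
have smooth_gsb (psi : fct) K' : gs_snorm_le M A h psi K' -> smooth psi.
  by move=> [[sr _] [si _]]; split.
have e0 : C * K * eps N @[N --> \oo] --> 0.
  by rewrite -[X in _ --> X](mulr0 (C * K)); apply: cvgMl_tmp.
have cut_re N x : re_part (cmul (cutoff c0 N) phi) x = cutoff c0 N x * re_part phi x.
  by rewrite /re_part /cmul; case: (phi x) => a b /=; rewrite mul0r subr0.
have cut_im N x : im_part (cmul (cutoff c0 N) phi) x = cutoff c0 N x * im_part phi x.
  by rewrite /im_part /cmul; case: (phi x) => a b /=; rewrite mul0r addr0.
have cut_cvg x (a : R) : cutoff c0 N x * a @[N --> \oo] --> a.
  by rewrite -[X in _ --> X]mul1r; apply: cvgMr_tmp; exact: cutoff_cvg.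
have diff N N' : (N <= N')%N ->
    gs_snorm_le M A h (cmul (cutoff c0 N') phi - cmul (cutoff c0 N) phi) (C * K * eps N).
  move=> NN; have b := csnorm_le_cutoff_diff (ltW h0) w0 bK NN.
  apply: (csnorm_le_le M_gt0 (ltW h0) w0 _ b).
  by apply: ler_wpM2l; [exact: mulr_ge0|exact: We].
have lim_diff N : gs_snorm_le M A h (phi - cmul (cutoff c0 N) phi) (C * K * eps N).
  apply: (csnorm_le_limit M_gt0 h0 _ _ e0 diff).
  - by move=> x; exact: expassoc_ge1.
  - move=> m; apply: smooth_gsb; rewrite -[cmul _ _]subr0 -(cmul_cutoff0 d_gt0 c0 phi).
    exact: (csnorm_le_cutoff_diff (ltW h0) w0 bK (leq0n m)).
  - by move=> x; under eq_fun do rewrite cut_re; exact: cut_cvg.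
  - by move=> x; under eq_fun do rewrite cut_im; exact: cut_cvg.
exists (fun N => Cf * (C * K * eps N)).
  by rewrite -[X in _ --> X](mulr0 Cf); apply: cvgMl_tmp.
move=> N; rewrite -normcN opprB -(linear_on_sub lf Sphi (SN N)).
exact: Hf (subspace_sub sS Sphi (SN N)) (lim_diff N).
Qed.

Lemma extension_eq phi : S phi -> extension phi = f phi.
Proof.
move=> Sphi; have [eps e0 HN] := cutoff_rate Sphi.
have sq (a : R^nat) l : (forall N, `|a N - l| <= eps N) -> a N @[N --> \oo] --> l.
  move=> al; apply/cvgrPdist_le => e ep; have /cvgrPdist_le/(_ _ ep) := e0.
  apply: filterS => N; rewrite sub0r normrN distrC => eN.
  exact: le_trans (al N) (le_trans (ler_norm _) eN).
apply: extension_of_cvg; apply: sq => N.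
  by rewrite -complex_re_sub (le_trans (normc_ge_re _)).
by rewrite -complex_im_sub (le_trans (normc_ge_im _)).
Qed.

End Extension.

(** * Convolution *)

Section ConvolutionSmooth.
Context {R : realType} {d : nat} (c : ucase) (M A : R^nat).
Hypotheses (M_gt0 : forall p, 0 < M p) (wA : weight_sequence A).
Variables (C0 H : R).
Hypotheses (C01 : 1 <= C0) (H1 : 1 <= H).
Hypothesis M2M : forall p q, M (p + q)%N <= C0 * H ^+ (p + q) * M p * M q.
Notation rV := 'rV[R]_d.
Notation fct := (rV -> R[i]).
Notation normc := Normc.normc.
Notation E := (expassoc A).
Notation S := (carrier (gelfand_shilov c M A : lcs R d)).
Notation e i := (delta_mx 0 i : rV).
Implicit Types (phi psi : fct) (h K : R) (x y : rV) (i : 'I_d).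

Let H_gt0 : 0 < H. Proof. exact: lt_le_trans H1. Qed.

Lemma gs_snorm_le_partials h phi K s : 0 < h -> gs_snorm_le M A (H * h) phi K ->
  gs_snorm_le M A h (cpartials s phi) (K * (C0 * h ^- size s * M (size s))).
Proof.
move=> h0 pK; have Hh0 : 0 < H * h by rewrite mulr_gt0.
have := csnorm_le_partials M_gt0 s C01 H1 M2M Hh0 (fun x => gs_weight_ge0 A (H * h) x) pK.
have -> : H * h / H = h by field; rewrite gt_eqF.
have -> : H / (H * h) = h^-1 by field; rewrite !gt_eqF.
rewrite exprVn.
apply: (csnorm_le_weaken M_gt0 (ltW h0) (lexx _) ler01) => [x|]; last by rewrite mul1r.
rewrite gs_weight_ge0 mul1r; apply: (gs_weight_mono wA x (ltW h0)).
by rewrite ler_peMl ?(ltW h0).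
Qed.

Lemma gs_partials phi s : S phi -> S (cpartials s phi).
Proof.
move=> /(carrier_gsP M_gt0) p; apply/(carrier_gsP M_gt0).
apply: space_index_scale p => [|h h0 [K HK]]; first exact: H_gt0.
by exists (K * (C0 * h ^- size s * M (size s))); apply: gs_snorm_le_partials.
Qed.

Lemma gs_smooth phi : S phi -> smooth phi.
Proof.
move=> /(carrier_gsP M_gt0) p.
have [h [_ _ [K [[sr _] [si _]]]]] : exists h, [/\ 0 < h, True & exists K, gs_snorm_le M A h phi K].
  by apply: dual_index_fr p; case: (c) => //=; exists 1.
by split.
Qed.

(* Written with [-1 *: t] to be an instance of the affine substitutions above. *)
Definition creflect phi x : fct := fun t => phi (x + -1 *: t).

Let sqN1 : (-1 : R) ^+ 2 = 1. Proof. by rewrite sqrrN expr1n. Qed.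

Lemma gs_reflect phi x : S phi -> S (creflect phi x).
Proof. exact: gs_affine. Qed.

Lemma convolutionE (f : fct -> R[i]) phi x : convolution f phi x = f (creflect phi x).
Proof.
by congr f; apply/funext => t; rewrite /creflect scaleN1r.
Qed.

(* The Taylor remainder of [t |-> u (x + t e_i - .)]. *)
Lemma taylor_snorm_le (u : rV -> R) h K x i t : 0 < h -> smooth_real u ->
  snorm_le M (2 * h) (fun x => E (2 * h * enorm x)) (partials [:: i; i] u) K -> `|t| <= 1 ->
  snorm_le M h (fun x => E (h * enorm x))
    (fun y => u (x + t *: e i + -1 *: y) - u (x + -1 *: y) - t * partials [:: i] u (x + -1 *: y))
    (E (4 * h * enorm x) * E (4 * h) * K * t ^+ 2).
Proof.
move=> h0 su [sD DK] t1.
have [s1 E1] := smooth_affine (-1) (x + t *: e i) su.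
have [s2 E2] := smooth_affine (-1) x su.
have [s3 E3] := smooth_affine (-1) x (smooth_partials [:: i] su).
have [s4 E4] := partials_sub s1 s2.
have [s5 E5] := smooth_lin (- t) s3 s4.
rewrite (_ : (fun y => _ - t * _) = (fun y => - t * partials [:: i] u (x + -1 *: y) +
  (u (x + t *: e i + -1 *: y) - u (x + -1 *: y)))); last first.
  by apply/funext => y; rewrite mulNr addrC.
split=> // s y; rewrite E5 E4 E1 E2 E3.
set n := size s; set z := x + -1 *: y.
have sgn (b p q : R) : `|- t * ((-1) ^+ n * b) + ((-1) ^+ n * p - (-1) ^+ n * q)| =
    `|p - q - b * t|.
  have -> : - t * ((-1) ^+ n * b) + ((-1) ^+ n * p - (-1) ^+ n * q) = (-1) ^+ n * (p - q - b * t).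
    by move: ((-1) ^+ n) => sg; ring.
  by rewrite normrM normrX normrN1 expr1n mul1r.
rewrite sgn {sgn}.
have -> : partials s (partials [:: i] u) z = partials (i :: s) u z.
  rewrite -partials_cat; congr (_ z); apply: partials_perm => //.
  by rewrite -[i :: s]cat1s perm_catC.
have gd (r : R) := @smooth_line R d u s i z su r.
have gdd (r : R) := @smooth_line R d u (i :: s) i z su r.
have M0 := M_gt0 n.
have [B BE] : exists B, B = E (4 * h * enorm x) * E (4 * h) * K * M n by eexists.
have w0 : 0 < h ^+ n * E (h * enorm y) by rewrite mulr_gt0 ?exprn_gt0 ?expassoc_gt0.
have bnd (r : R) : `|r| <= `|t| -> `|partials [:: i, i & s] u (z + r *: e i)| <=
    B / (h ^+ n * E (h * enorm y)).
  move=> rt; rewrite ler_pdivlMr // mulrC.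
  have Dz := DK s (z + r *: e i); rewrite -/n in Dz.
  have E0 : partials s (partials [:: i; i] u) = partials [:: i, i & s] u.
    rewrite -partials_cat; apply: partials_perm => //.
    by rewrite -[[:: i, i & s]]/([:: i; i] ++ s) perm_catC.
  rewrite E0 in Dz; move: (partials _ u (z + _)) Dz => D Dz.
  (* Here y = x + r e_i - (z + r e_i). Two splittings of the weight leave the decay at z + r e_i and
     constants that depend only on x, since |r| <= 1. *)
  have Ey : E (h * enorm y) <= E (2 * h * enorm (z + r *: e i)) * (E (4 * h * enorm x) * E (4 * h)).
    rewrite -(enormN y) (_ : - y = (z + r *: e i) + - (x + r *: e i)); last first.
      by rewrite /z scaleN1r opprD addrACA addrN addr0 addrAC addrN add0r.
    apply: le_trans (expassoc_enorm_add wA _ _ (ltW h0)) _.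
    apply: ler_wpM2l; first exact: gs_weight_ge0.
    rewrite enormN; apply: le_trans (expassoc_enorm_add wA _ _ _) _.
      by rewrite mulr_ge0 // ltW.
    rewrite (_ : 2 * (2 * h) = 4 * h); last by ring.
    apply: ler_wpM2l; first exact: gs_weight_ge0.
    apply: expassoc_mono => //; first by rewrite !mulr_ge0 ?enorm_ge0 // ltW.
    rewrite enorm_delta -[leRHS]mulr1 ler_wpM2l ?mulr_ge0 ?(ltW h0) //.
    exact: le_trans rt t1.
  apply: (@le_trans _ _ ((2 * h) ^+ n * `|D| * E (2 * h * enorm (z + r *: e i)) *
      (E (4 * h * enorm x) * E (4 * h)))).
    rewrite [leLHS](_ : _ = h ^+ n * `|D| * E (h * enorm y)); last by ring.
    rewrite -[leRHS]mulrA; apply: ler_pM => //; rewrite ?mulr_ge0 ?exprn_ge0 ?expassoc_ge0 ?(ltW h0) //.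
    apply: ler_wpM2r => //; apply: lerXn2r; rewrite ?nnegrE ?mulr_ge0 ?(ltW h0) //.
    by rewrite ler_peMl ?(ltW h0) // ler1n.
  have Ex0 : 0 <= E (4 * h * enorm x) * E (4 * h) by rewrite mulr_ge0 // expassoc_ge0.
  apply: le_trans (ler_wpM2r Ex0 Dz) _.
  by rewrite BE le_eqVlt; apply/orP; left; apply/eqP; ring.
have := taylor2_bound gd gdd bnd; rewrite scale0r addr0.
rewrite -[x + t *: e i + _]addrA [t *: _ + _]addrC [x + (_ + _)]addrA -/z.
move: (partials s u _) (partials s u _) (partials (i :: s) u z) => p q b rem.
rewrite mulrAC; apply: le_trans (ler_wpM2l (ltW w0) rem) _.
rewrite mulrA [_ * (B / _)]mulrC divfK; last by rewrite gt_eqF.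
rewrite real_normK ?num_real // BE.
by rewrite le_eqVlt; apply/orP; left; apply/eqP; ring.
Qed.

Lemma taylor_gs_snorm_le phi h K x i t : 0 < h -> smooth phi ->
  gs_snorm_le M A (2 * h) (cpartials [:: i; i] phi) K -> `|t| <= 1 ->
  gs_snorm_le M A h (creflect phi (x + t *: e i) - creflect phi x - t%:C *: creflect (cpartials [:: i] phi) x)
    (E (4 * h * enorm x) * E (4 * h) * K * t ^+ 2).
Proof.
move=> h0 [sr si] [rK iK] t1.
have rK' : snorm_le M (2 * h) (fun x => E (2 * h * enorm x)) (partials [:: i; i] (re_part phi)) K.
  exact: rK.
have iK' : snorm_le M (2 * h) (fun x => E (2 * h * enorm x)) (partials [:: i; i] (im_part phi)) K.
  exact: iK.
split.
  rewrite (_ : re_part _ = (fun y => re_part phi (x + t *: e i + -1 *: y) -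
    re_part phi (x + -1 *: y) - t * partials [:: i] (re_part phi) (x + -1 *: y))).
    exact: (taylor_snorm_le x h0 sr rK' t1).
  apply/funext => y; rewrite /re_part.
  rewrite -[(_ - _) y]/(phi (x + t *: e i + -1 *: y) - phi (x + -1 *: y) -
    t%:C * cpartials [:: i] phi (x + -1 *: y)).
  rewrite /cpartials; case: (phi _) (phi _) => a b [a' b'] /=.
  by rewrite mul0r subr0.
rewrite (_ : im_part _ = (fun y => im_part phi (x + t *: e i + -1 *: y) -
  im_part phi (x + -1 *: y) - t * partials [:: i] (im_part phi) (x + -1 *: y))).
  exact: (taylor_snorm_le x h0 si iK' t1).
apply/funext => y; rewrite /im_part.
rewrite -[(_ - _) y]/(phi (x + t *: e i + -1 *: y) - phi (x + -1 *: y) -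
  t%:C * cpartials [:: i] phi (x + -1 *: y)).
rewrite /cpartials; case: (phi _) (phi _) => a b [a' b'] /=.
by rewrite mul0r addr0.
Qed.

Variable (f : fct -> R[i]).
Hypothesis lf : linear_on S f.
Hypothesis f_bounded : dual_index c (fun h => exists2 C : R, 0 <= C & forall phi K,
  S phi -> gs_snorm_le M A h phi K -> normc (f phi) <= C * K).

Let sS : vsubspace S. Proof. exact: gs_subspace. Qed.

(** Differentiation under the pairing: the remainder is of order t^2 in one norm that controls f, so
    f can be applied to it. *)
Lemma convolution_taylor phi x i : S phi -> exists2 B, 0 <= B & forall t : R, `|t| <= 1 ->
  normc (convolution f phi (x + t *: e i) - convolution f phi x -
    t%:C * convolution f (cpartials [:: i] phi) x) <= B * t ^+ 2.
Proof.
move=> Sphi; have := Sphi => /(carrier_gsP M_gt0) p.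
have p' : space_index c (fun h => exists K, gs_snorm_le M A (H * (2 * h)) phi K).
  apply: (space_index_scale (L := H * 2)) p; first by rewrite mulr_gt0.
  by move=> h h0; rewrite -mulrA.
have [h [h0 [Cf Cf0 Hf] [K pK]]] := dual_index_fr f_bounded p'.
have h20 : 0 < 2 * h by rewrite mulr_gt0.
have [K' D] : exists K', gs_snorm_le M A (2 * h) (cpartials [:: i; i] phi) K'.
  by eexists; exact: gs_snorm_le_partials pK.
have K'0 := gs_snorm_le_ge0 M_gt0 D.
exists (Cf * (E (4 * h * enorm x) * E (4 * h) * K')).
  by rewrite !mulr_ge0 ?expassoc_ge0.
move=> t t1; rewrite !convolutionE.
have S1 := gs_reflect (x + t *: e i) Sphi.
have S2 := gs_reflect x Sphi.
have S3 := gs_reflect x (gs_partials [:: i] Sphi).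
have S12 := subspace_sub sS S1 S2.
have S4 := subspace_scale t%:C sS S3.
rewrite -(linear_on_sub lf S1 S2) -(linear_on_scale sS lf _ S3) -(linear_on_sub lf S12 S4).
rewrite -[leRHS]mulrA; apply: Hf; first exact: subspace_sub.
exact: (taylor_gs_snorm_le x h0 (gs_smooth Sphi) D t1).
Qed.

Lemma convolution_locally_bounded phi x : S phi -> exists r B : R, 0 < r /\
  forall z : rV, (forall i, `|z 0 i| < r) -> normc (convolution f phi (x + z)) <= B.
Proof.
move=> Sphi; have := Sphi => /(carrier_gsP M_gt0) p.
have p' : space_index c (fun h => exists K, gs_snorm_le M A (2 * h) phi K).
  by apply: (space_index_scale (L := 2)) p; first exact: ltr0Sn.
have [h [h0 [Cf Cf0 Hf] [K pK]]] := dual_index_fr f_bounded p'.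
have K0 := gs_snorm_le_ge0 M_gt0 pK.
exists 1, (Cf * ((E (2 * (2 * h) * enorm x) * E (2 * (2 * h) * d%:R)) * K)); split=> // z z1.
rewrite convolutionE; apply: le_trans (Hf _ _ (gs_reflect _ Sphi)
  (gs_snorm_le_affine M_gt0 wA (x + z) sqN1 (ltW h0) pK)) _.
rewrite ler_wpM2l // ler_wpM2r //.
apply: le_trans (expassoc_enorm_add wA _ _ _) _; first by rewrite mulr_ge0 // ltW.
rewrite ler_wpM2l ?gs_weight_ge0 //; apply: expassoc_mono => //.
  by rewrite !mulr_ge0 ?enorm_ge0 // ltW.
rewrite ler_wpM2l ?mulr_ge0 ?(ltW h0) // -[leRHS]mulr1.
by apply: enorm_le_coord => i; exact: ltW.
Qed.

(** The abstract [part] stands for the real or the imaginary part; only its additivity, real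
    homogeneity and contractivity enter. *)
Lemma convolution_derive phi x i (part : R[i] -> R) :
  (forall z w, part (z - w) = part z - part w) ->
  (forall (a : R) z, part (a%:C * z) = a * part z) ->
  (forall z, `|part z| <= normc z) -> S phi ->
  is_derive x (e i) (fun x => part (convolution f phi x))
    (part (convolution f (cpartials [:: i] phi) x)).
Proof.
move=> pB pZ pN Sphi; rewrite -[X in is_derive X](addr0 x) -(scale0r (e i)).
apply/is_derive_line/is_derive0P => eps eps0.
have [B B0 HB] := convolution_taylor x i Sphi.
exists (Num.min 1 (eps / (B + 1))); first by rewrite lt_min ltr01 divr_gt0 // ltr_wpDl.
move=> t; rewrite lt_min => /andP[t1 t2].
rewrite scale0r addr0 [_ * t]mulrC -pZ -!pB; apply: le_trans (pN _) _.
apply: le_trans (HB t (ltW t1)) _.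
rewrite -real_normK ?num_real // expr2 mulrA ler_wpM2r //.
move: t2; rewrite ltr_pdivlMr ?ltr_wpDl // => t2.
by rewrite mulrC (le_trans _ (ltW t2)) // ler_wpM2l // lerDl.
Qed.

Lemma convolution_part_smooth (part : R[i] -> R) :
  (forall z w, part (z - w) = part z - part w) ->
  (forall (a : R) z, part (a%:C * z) = a * part z) ->
  (forall z, `|part z| <= normc z) -> forall phi, S phi ->
  smooth_real (fun x => part (convolution f phi x)) /\ forall s,
  partials s (fun x => part (convolution f phi x)) =
  (fun x => part (convolution f (cpartials s phi) x)).
Proof.
move=> pB pZ pN phi Sphi.
have D s i x : is_derive x (e i) (fun x => part (convolution f (cpartials s phi) x))
    (part (convolution f (cpartials (i :: s) phi) x)).
  exact: (convolution_derive x i pB pZ pN (gs_partials s Sphi)).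
have E0 : cpartials [::] phi = phi by exact: fct_eq.
have := @smooth_of_family R d (fun s x => part (convolution f (cpartials s phi) x)).
rewrite E0; apply => s.
apply: (continuous_of_bounded_partials (D s)) => x.
have bnd i := convolution_locally_bounded x (gs_partials (i :: s) Sphi).
have /choice[r /choice[B rB]] := bnd.
have [d0|d0] := posnP d.
  by exists 1, 0; split=> // z _ i; have := ltn_ord i; rewrite {2}d0.
pose r0 := \big[Num.min/1]_i r i; pose B0 := \sum_i `|B i|.
exists r0, B0; split.
  rewrite /r0; elim/big_ind: _ => // [p q p0 q0|i _]; first by rewrite lt_min p0.
  by have [] := rB i.
move=> z zr i; apply: le_trans (pN _) _.
have [_ Hi] := rB i; apply: le_trans (Hi z _) _ => [j|].
  by apply: lt_le_trans (zr j) _; rewrite /r0 (bigD1 i) //= ge_min lexx.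
by rewrite (le_trans (ler_norm _)) // /B0 (bigD1 i) //= lerDl sumr_ge0.
Qed.

Lemma convolution_re phi : S phi -> smooth_real (re_part (convolution f phi)) /\
  forall s, partials s (re_part (convolution f phi)) = re_part (convolution f (cpartials s phi)).
Proof.
apply: convolution_part_smooth => [|a [p q] /=|]; [exact: complex_re_sub| |exact: normc_ge_re].
by rewrite mul0r subr0.
Qed.

Lemma convolution_im phi : S phi -> smooth_real (im_part (convolution f phi)) /\
  forall s, partials s (im_part (convolution f phi)) = im_part (convolution f (cpartials s phi)).
Proof.
apply: convolution_part_smooth => [|a [p q] /=|]; [exact: complex_im_sub| |exact: normc_ge_im].
by rewrite mul0r addr0.
Qed.

End ConvolutionSmooth.

Section ConvolutionBounds.
Context {R : realType} {d : nat} (c : ucase) (M A : R^nat) (V : nat -> 'rV[R]_d -> R).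
Hypotheses (M_gt0 : forall p, 0 < M p) (wA : weight_sequence A).
Hypothesis hV : decreasing_weight_system V.
Hypothesis adm : admissible c A V.
Variables (C0 H : R).
Hypotheses (C01 : 1 <= C0) (H1 : 1 <= H).
Hypothesis M2M : forall p q, M (p + q)%N <= C0 * H ^+ (p + q) * M p * M q.
Notation rV := 'rV[R]_d.
Notation fct := (rV -> R[i]).
Notation normc := Normc.normc.
Notation E := (expassoc A).
Notation S := (carrier (gelfand_shilov c M A : lcs R d)).
Implicit Types (phi psi : fct) (h K : R) (x y : rV).

Variables (f g : fct -> R[i]).
Hypothesis lf : linear_on S f.
Hypothesis f_bounded : dual_index c (fun h => exists2 C : R, 0 <= C & forall phi K,
  S phi -> gs_snorm_le M A h phi K -> normc (f phi) <= C * K).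
Hypothesis g_bounded : forall n, dual_index c (fun h => exists2 C : R, 0 <= C & forall phi K,
  carrier (Bw c M (V n)) phi -> csnorm_le M h (V n) phi K -> normc (g phi) <= C * K).
Hypothesis gf : forall phi, S phi -> g phi = f phi.

Let V_gt0 n x : 0 < V n x. Proof. by have [V0 _ _] := hV. Qed.
Let V_ge0 n x : 0 <= V n x. Proof. exact/ltW/V_gt0. Qed.

(** Admissibility with increment t - x gives V_m(t) <= C V_n(x) E(l |t - x|), and the decay of phi
    at x - t absorbs the last factor because l <= h. *)
Lemma creflect_csnorm_le h l C n m phi K x : 0 < l -> l <= h -> 0 < C ->
  (forall x t, V m (x + t) <= C * V n x * E (l * enorm t)) ->
  gs_snorm_le M A h phi K -> csnorm_le M h (V m) (creflect phi x) (C * V n x * K).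
Proof.
move=> l0 lh C_gt0 Hadm pK; have h0 : 0 < h by apply: lt_le_trans lh.
have sqN1 : (-1 : R) ^+ 2 = 1 by rewrite sqrrN expr1n.
have CV0 : 0 <= C * V n x by exact: mulr_ge0 (ltW C_gt0) (V_ge0 n x).
apply: (csnorm_le_weaken M_gt0 (ltW h0) (lexx h) CV0 _ (lexx _) (csnorm_le_affine x sqN1 pK)) => t.
rewrite V_ge0 /=; have := Hadm x (t - x); rewrite addrC subrK => /le_trans; apply.
apply: (ler_wpM2l CV0); rewrite -(enormN (t - x)) opprB scaleN1r.
exact: (gs_weight_mono wA _ (ltW l0) lh).
Qed.

Lemma convolution_bound n : dual_index c (fun h => exists2 C : R, 0 <= C & forall phi K x,
  S phi -> gs_snorm_le M A h phi K -> normc (convolution f phi x) <= C * V n x * K).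
Proof.
have key h l C C' m phi K x : 0 < l -> l <= h -> 0 < C -> 0 <= C' ->
    (forall x t, V m (x + t) <= C * V n x * E (l * enorm t)) ->
    (forall phi K, carrier (Bw c M (V m)) phi -> csnorm_le M h (V m) phi K -> normc (g phi) <= C' * K) ->
    carrier (Bw c M (V m)) (creflect phi x) ->
    S phi -> gs_snorm_le M A h phi K -> normc (convolution f phi x) <= C' * C * V n x * K.
  move=> l0 lh C_gt0 C'0 Hadm Hg Bphi Sphi pK.
  rewrite convolutionE -gf; last exact: gs_reflect.
  apply: le_trans (Hg _ _ Bphi (creflect_csnorm_le x l0 lh C_gt0 Hadm pK)) _.
  by rewrite !mulrA.
have adm_n := admissible_dual_index wA hV adm n.
case: (c) adm_n g_bounded key => /= adm_n gB key.
  (* Beurling case: l and m are fixed first and h is taken large. Membership asks for all h', so phi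
     is measured at max(l, h'). *)
  have [l l0 Hl] := adm_n.
  have [m nm [C C_gt0 Hadm]] := Hl l (lexx l).
  have [h0 h00 Hh0] := gB m.
  exists (Num.max l h0); first by rewrite lt_max l0.
  move=> h; rewrite ge_max => /andP[lh h0h].
  have [C' C'0 HC'] := Hh0 h h0h.
  exists (C' * C); first exact: mulr_ge0 C'0 (ltW C_gt0).
  move=> phi K x Sphi pK; apply: (key h l C C' m) => //.
  apply/(carrier_BwP M_gt0 Beurling _ (V_ge0 m)) => h' h'0.
  have p := (carrier_gsP M_gt0 A Beurling phi).1 Sphi.
  have m0 : 0 < Num.max l h' by rewrite lt_max l0.
  have [K' HK'] := p _ m0.
  have lm : l <= Num.max l h' by rewrite le_max lexx.
  have hm : h' <= Num.max l h' by rewrite le_max lexx orbT.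
  exists (C * V n x * K').
  apply: (csnorm_le_weaken M_gt0 (ltW h'0) hm ler01 _ _ (creflect_csnorm_le x l0 lm C_gt0 Hadm HK')).
    by move=> y; rewrite V_ge0 mul1r lexx.
  by rewrite mul1r.
(* Roumieu case: h is given first and admissibility is used with l = h, so that m depends on h. *)
move=> h h0; have [m nm [C C_gt0 Hadm]] := adm_n h h0.
have [C' C'0 HC'] := gB m h h0.
exists (C' * C); first exact: mulr_ge0 C'0 (ltW C_gt0).
move=> phi K x Sphi pK; apply: (key h h C C' m) => //.
apply/(carrier_BwP M_gt0 Roumieu _ (V_ge0 m)); exists h => //.
by exists (C * V n x * K); exact: creflect_csnorm_le Hadm pK.
Qed.

(** The pointwise bound is applied to every derivative of phi, since derivatives pass onto phi; the
    factor H in the source parameter is the cost of (M.2). *)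
Lemma convolution_csnorm_le n : dual_index c (fun h => exists2 C : R, 0 <= C & forall phi K,
  S phi -> gs_snorm_le M A (H * h) phi K ->
  csnorm_le M h (fun x => (V n x)^-1) (convolution f phi) (C * K)).
Proof.
apply: dual_index_imp (convolution_bound n) => h h0 [C C_ge0 HC].
have C00 : 0 <= C0 by apply: le_trans C01.
exists (C * C0); first exact: mulr_ge0.
move=> phi K Sphi pK.
have bnd s x : h ^+ size s * normc (convolution f (cpartials s phi) x) * (V n x)^-1 <=
    C * C0 * K * M (size s).
  have pK' := gs_snorm_le_partials M_gt0 wA C01 H1 M2M s h0 pK.
  have Sp := gs_partials M_gt0 wA C01 H1 M2M s Sphi.
  have := HC _ _ x Sp pK'; rewrite ler_pdivrMr // => b.
  have h_s : 0 < h ^+ size s by rewrite exprn_gt0.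
  apply: le_trans (ler_wpM2l (ltW h_s) b) _.
  move: (h ^+ size s) (V n x) (M (size s)) h_s => a v m a0.
  rewrite (_ : a * _ = C * C0 * K * m * v) //; field; rewrite gt_eqF //.
have [sr Er] := convolution_re M_gt0 wA C01 H1 M2M lf f_bounded Sphi.
have [si Ei] := convolution_im M_gt0 wA C01 H1 M2M lf f_bounded Sphi.
split; split=> // s x; rewrite ?Er ?Ei; apply: le_trans (bnd s x).
  apply: ler_wpM2r; first by rewrite invr_ge0.
  by apply: ler_wpM2l; [rewrite exprn_ge0 // ltW|exact: normc_ge_re].
apply: ler_wpM2r; first by rewrite invr_ge0.
by apply: ler_wpM2l; [rewrite exprn_ge0 // ltW|exact: normc_ge_im].
Qed.

End ConvolutionBounds.

(** * Topologies *)

Section Topology.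
Context {R : realType} {d : nat} (M : R^nat) (M_gt0 : forall p, 0 < M p).
Notation rV := 'rV[R]_d.
Notation fct := (rV -> R[i]).
Notation normc := Normc.normc.
Implicit Types (phi psi : fct) (h K : R) (x y : rV) (c : ucase) (U W : set fct).

(* Covers [gelfand_shilov], where the weight depends on [h], and [Bw]. *)
Definition limit_space c (w : R -> rV -> R) : lcs R d := match c with
  | Beurling => projlim (fun h : {posnum R} => Bh M h%:num (w h%:num))
  | Roumieu => indlim (fun h : {posnum R} => Bh M h%:num (w h%:num))
  end.

Lemma limit_space_gs c A : gelfand_shilov c M A = limit_space c (fun h x => expassoc A (h * enorm x)).
Proof. by case: c. Qed.

Lemma limit_space_Bw c v : Bw c M v = limit_space c (fun _ => v).
Proof. by case: c. Qed.

Section Fam.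
Variable w : R -> rV -> R.
Hypothesis w0 : forall h x, 0 <= w h x.
Hypothesis wmono : forall h h', 0 < h' -> h' <= h -> forall x, w h' x <= w h x.

Lemma csnorm_le_mono h h' phi K : 0 < h' -> h' <= h -> csnorm_le M h (w h) phi K -> csnorm_le M h' (w h') phi K.
Proof.
move=> h'0 h'h; apply: (csnorm_le_weaken M_gt0 (ltW h'0) h'h ler01) => [x|]; last by rewrite mul1r.
by rewrite w0 mul1r wmono.
Qed.

Lemma carrier_limit_spaceP c phi : carrier (limit_space c w) phi <-> space_index c (fun h => exists K, csnorm_le M h (w h) phi K).
Proof.
case: c => /=; split.
- by move=> P h h0; apply/(carrier_BhP M_gt0 _ (ltW h0) (w0 h)); exact: (P (PosNum h0)).
- by move=> P h _; apply/(carrier_BhP M_gt0 _ (ge0 h) (w0 h%:num)); exact: (P h%:num (gt0 h)).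
- by move=> [h _ /(carrier_BhP M_gt0 _ (ge0 h) (w0 h%:num)) P]; exists h%:num.
- by move=> [h h0 P]; exists (PosNum h0) => //; exact/(carrier_BhP M_gt0 _ (ltW h0) (w0 h)).
Qed.

Lemma limit_space_subspace c : vsubspace (carrier (limit_space c w)).
Proof.
have [h0 h1] := space_index_cub_subspace M_gt0 c w0 wmono.
split; first exact/carrier_limit_spaceP.
by move=> a phi psi /carrier_limit_spaceP p /carrier_limit_spaceP q; apply/carrier_limit_spaceP; apply: h1.
Qed.

Lemma nbhs0_limit_space_elim c U : nbhs0 (limit_space c w) U ->
  dual_index c (fun h => exists2 eps, 0 < eps & forall phi, carrier (limit_space c w) phi ->
    csnorm_le M h (w h) phi eps -> U phi).
Proof.
case: c => /=; last first.
  move=> [V [_ nV VU]] h h0.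
  have [eps e0 He] := (nbhs0_BhP M_gt0 V (ltW h0) (w0 h)).1 (nV (PosNum h0)).
  by exists eps => // phi _ pe; apply/VU/He.
move=> [s [V [nV sV]]].
have [h [h0 [eps e0 He]]] : exists h, 0 < h /\ exists2 eps, 0 < eps & forall phi h', h <= h' ->
    csnorm_le M h' (w h') phi eps -> forall i, i \in s -> V i phi.
  elim: s {sV} => [|i s [h [h0 [eps e0 He]]]]; first by exists 1; split=> //; exists 1.
  have [e' e'0 He'] := (nbhs0_BhP M_gt0 (V i) (ge0 i) (w0 i%:num)).1 (nV i).
  exists (Num.max h i%:num); split; first by rewrite lt_max h0.
  exists (Num.min eps e'); first by rewrite lt_min e0.
  move=> phi h'; rewrite ge_max => /andP[hh ih] p j; rewrite inE => /orP[/eqP ->|js].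
    apply: He'; apply: csnorm_le_le (csnorm_le_mono (gt0 i) ih p) => //.
    by rewrite ge_min lexx orbT.
  apply: (He phi h' hh _ j js).
  have h'0 : 0 < h' by apply: lt_le_trans hh.
  by apply: csnorm_le_le p => //; [exact: ltW|rewrite ge_min lexx].
exists h => // h' hh'; exists eps => // phi Pphi pe; apply: sV; split=> //= i.
exact: He pe i.
Qed.

Lemma nbhs0_Beurling_intro U h eps : 0 < h -> 0 < eps ->
  (forall phi, carrier (limit_space Beurling w) phi -> csnorm_le M h (w h) phi eps -> U phi) ->
  nbhs0 (limit_space Beurling w) U.
Proof.
move=> h0 e0 HU; exists [:: PosNum h0].
(* Only the index h is constrained; at all others the chosen set imposes nothing. *)
exists (fun i : {posnum R} => [set phi | i = PosNum h0 -> csnorm_le M h (w h) phi eps]); split.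
  move=> i; apply/(nbhs0_BhP M_gt0 _ (ge0 i) (w0 i%:num)).
  have [->|ih] := eqVneq i (PosNum h0); first by exists eps => // phi p _; exact: p.
  by exists 1 => // phi _ ihE; move: ih; rewrite ihE eqxx.
by move=> phi [Pphi pe]; apply: HU => //; apply: pe; rewrite ?inE.
Qed.

Lemma nbhs0_limit_space_intro c U W : absolutely_convex W -> W `<=` U ->
  dual_index c (fun h => exists2 eps, 0 < eps & forall phi, carrier (limit_space c w) phi ->
    csnorm_le M h (w h) phi eps -> W phi) ->
  nbhs0 (limit_space c w) U.
Proof.
move=> aW WU; case: c => /=.
  move=> [h h0 /(_ h (lexx h))[eps e0 He]].
  by apply: (nbhs0_Beurling_intro h0 e0) => phi Pphi pe; apply/WU/He.
move=> HW; exists W; split=> // h; apply/(nbhs0_BhP M_gt0 _ (ge0 h) (w0 h%:num)).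
have [eps e0 He] := HW h%:num (gt0 h); exists eps => // phi pe; apply: He => //.
exists h => //; apply/(carrier_BhP M_gt0 _ (ge0 h) (w0 h%:num)); by exists eps.
Qed.

Lemma dual_index_of_unit_ball c (g : fct -> R[i]) : linear_on (carrier (limit_space c w)) g ->
  dual_index c (fun h => exists2 eps, 0 < eps & forall phi, carrier (limit_space c w) phi ->
    csnorm_le M h (w h) phi eps -> normc (g phi) <= 1) ->
  dual_index c (fun h => exists2 C : R, 0 <= C & forall phi K, carrier (limit_space c w) phi ->
    csnorm_le M h (w h) phi K -> normc (g phi) <= C * K).
Proof.
move=> lg; apply: dual_index_imp => h h0 [eps e0 He].
exists eps^-1; first by rewrite invr_ge0 ltW.
move=> phi K Pphi pK; have K0 := csnorm_le_ge0 M_gt0 (w0 h 0) pK.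
(* K may be 0, so the rescaling to norm eps divides by dl + K, and dl > 0 is arbitrary. *)
rewrite mulrC ler_pdivlMr //; apply/ler_addgt0Pl => dl dl0.
have Kd : 0 < dl + K by rewrite ltr_pwDl.
have pKd : csnorm_le M h (w h) phi (dl + K) by apply: csnorm_le_le pK => //; [exact: ltW|rewrite lerDr ltW].
pose a : R := eps / (dl + K); have a0 : 0 < a by rewrite divr_gt0.
have Sa : carrier (limit_space c w) (a%:C *: phi) by apply: subspace_scale => //; exact: limit_space_subspace.
have aE : eps = a * (dl + K) by rewrite /a divfK // gt_eqF.
have pa : csnorm_le M h (w h) (a%:C *: phi) eps.
  rewrite aE -[X in X * _](gtr0_norm a0) -abs1R; apply: csnorm_le_scale pKd; [exact: ltW|exact: w0].
have := He _ Sa pa.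
rewrite (linear_on_scale (limit_space_subspace c) lg) // Normc.normcM normcR gtr0_norm // => b.
by rewrite aE mulrA ger_pMl // mulrC.
Qed.

End Fam.

Lemma dual_nbhs0 (F : lcs R d) (g : fct -> R[i]) : lcs_dual F g -> vsubspace (carrier F) ->
  linear_on (carrier F) g /\ forall eps, 0 < eps ->
    nbhs0 F [set psi | normc (g (0 + psi) - g 0) < eps].
Proof.
move=> [lg cg] [S0 _]; split=> // eps e0.
have b : nbhs (g 0 : R[i]^o) [set z | normc (z - g 0) < eps].
  apply/nbhs_ballP; exists eps%:C => /=; first by rewrite ltcR.
  by move=> z /=; rewrite /ball /= distrC normcE_norm ltcR.
exact: (cg 0 S0 _ b).
Qed.

Lemma indlim_up (I : Type) (F : I -> lcs R d) U U' : U `<=` U' ->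
  nbhs0 (indlim F) U -> nbhs0 (indlim F) U'.
Proof. by move=> UU [V [aV nV VU]]; exists V; split=> //; exact: subset_trans UU. Qed.

Lemma dual_indlim_intro (I : Type) (F : I -> lcs R d) (g : fct -> R[i]) :
  linear_on (carrier (indlim F)) g ->
  (forall phi eps, carrier (indlim F) phi -> 0 < eps ->
    nbhs0 (indlim F) [set psi | normc (g (phi + psi) - g phi) < eps]) ->
  lcs_dual (indlim F) g.
Proof.
move=> lg cg; split=> // phi Fphi U /nbhs_ballP[z /= z0 zU].
(* A positive element of the ordered complex numbers is real, so complex radii reduce to real
   ones. *)
have z0' : 0 < complex.Re z by move: z0; case: (z) => a b; rewrite ltcE /= => /andP[].
have zE : z = (complex.Re z)%:C.
  by move: z0; case: (z) => a b; rewrite ltcE /= => /andP[/eqP -> _].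
apply: indlim_up (cg phi _ Fphi z0') => psi /= b; apply: zU.
by rewrite /ball /= distrC normcE_norm zE ltcR.
Qed.

Section InductiveLimit.
Variables (c : ucase) (V : nat -> rV -> R).
Hypothesis hV : decreasing_weight_system V.
Let V_ge0 n x : 0 <= V n x. Proof. by have [V0 _ _] := hV; exact/ltW/V0. Qed.

Lemma Bw_mono n m phi : (n <= m)%N -> carrier (Bw c M (V n)) phi -> carrier (Bw c M (V m)) phi.
Proof.
move=> nm /(carrier_BwP M_gt0 _ _ (V_ge0 n)) p; apply/(carrier_BwP M_gt0 _ _ (V_ge0 m)).
apply: space_index_scale p => [|h h0 [K HK]]; first exact: ltr01.
rewrite mul1r in HK; exists (1 * K).
apply: (csnorm_le_weaken M_gt0 (ltW h0) (lexx h) ler01 _ (lexx _) HK) => x.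
by rewrite V_ge0 mul1r weight_mono.
Qed.

Lemma Bind_subspace : vsubspace (carrier (Bind c M V)).
Proof.
have sub n : vsubspace (carrier (Bw c M (V n))).
  by rewrite limit_space_Bw; apply: limit_space_subspace => // *; exact: lexx.
split; first by exists 0%N => //; exact: (sub 0%N).1.
move=> a phi psi [n _ p] [m _ q]; exists (maxn n m) => //; apply: (sub _).2.
  by apply: Bw_mono p; exact: leq_maxl.
by apply: Bw_mono q; exact: leq_maxr.
Qed.

Lemma Bind_dual_bounded g : lcs_dual (Bind c M V) g ->
  linear_on (carrier (Bind c M V)) g /\ forall n, dual_index c (fun h => exists2 C : R, 0 <= C &
    forall phi K, carrier (Bw c M (V n)) phi -> csnorm_le M h (V n) phi K -> normc (g phi) <= C * K).
Proof.
move=> dg; have [lg ng] := dual_nbhs0 dg Bind_subspace; split=> // n.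
have [W [_ nW WU]] := ng 1 ltr01.
have := nW n; rewrite limit_space_Bw => nWn.
have w0 (h : R) x : 0 <= V n x by [].
have wm (h h' : R) : 0 < h' -> h' <= h -> forall x, V n x <= V n x by move=> *; exact: lexx.
have gn : linear_on (carrier (limit_space c (fun _ => V n))) g.
  by rewrite -limit_space_Bw => phi psi a p q; apply: lg; exists n.
apply: (dual_index_of_unit_ball w0 wm gn).
apply: dual_index_imp (nbhs0_limit_space_elim w0 wm nWn) => h h0 [eps e0 He].
exists eps => // phi Pphi pe; have := WU _ (He phi Pphi pe).
by rewrite /= (linear_on0 Bind_subspace lg) subr0 add0r => /ltW.
Qed.

Lemma Bind_dual_intro g : linear_on (carrier (Bind c M V)) g ->
  (forall n, dual_index c (fun h => exists2 C : R, 0 <= C &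
    forall phi K, carrier (Bw c M (V n)) phi -> csnorm_le M h (V n) phi K -> normc (g phi) <= C * K)) ->
  lcs_dual (Bind c M V) g.
Proof.
move=> lg bg; apply: dual_indlim_intro => // phi eps Bphi e0.
(* An absolutely convex neighbourhood that does not depend on phi; linearity carries it from the
   origin to phi. *)
pose W : set fct := [set psi | carrier (Bind c M V) psi /\ normc (g psi) < eps].
have aW : absolutely_convex W.
  move=> p q a b [Bp gp] [Bq gq] ab; split.
    by apply: Bind_subspace.2 => //; apply: subspace_scale => //; exact: Bind_subspace.
  rewrite lg //; last by apply: subspace_scale => //; exact: Bind_subspace.
  rewrite (linear_on_scale Bind_subspace lg) //.
  apply: le_lt_trans (le_normcD _ _) _; rewrite !Normc.normcM.
  move: ab; rewrite !normcE_norm -rmorphD /= lecR.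
  have := normc_ge0 a; have := normc_ge0 b.
  move: (normc a) (normc b) (normc (g p)) (normc (g q)) gp gq => A B P Q PE QE B0 A0 AB.
  set m := Num.max P Q; have mE : m < eps by rewrite gt_max PE.
  have Pm : P <= m by rewrite le_max lexx.
  have Qm : Q <= m by rewrite le_max lexx orbT.
  have h1 := ler_wpM2l A0 Pm; have h2 := ler_wpM2l B0 Qm.
  have [m0|m0] := leP 0 m; first by have := ler_wpM2r m0 AB; rewrite mulrDl mul1r; lra.
  have h3 : A * m <= 0 by rewrite mulr_ge0_le0 // ltW.
  have h4 : B * m <= 0 by rewrite mulr_ge0_le0 // ltW.
  lra.
have WU : W `<=` [set psi | normc (g (phi + psi) - g phi) < eps].
  move=> psi [Bpsi gpsi] /=; rewrite (linear_on_add lg) //.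
  by rewrite addrC addKr.
exists W; split=> // n; rewrite limit_space_Bw.
have w0 (h : R) x : 0 <= V n x by [].
apply: (nbhs0_limit_space_intro w0 aW (@subset_refl _ W)).
apply: dual_index_imp (bg n) => h h0 [C C0 HC].
exists (eps / (C + 1)); first by rewrite divr_gt0 // ltr_wpDl.
move=> psi; rewrite -limit_space_Bw => Bpsi pK; split; first by exists n.
apply: le_lt_trans (HC _ _ Bpsi pK) _.
rewrite mulrCA gtr_pMr // ltr_pdivrMr ?ltr_wpDl // mul1r ltrDl //.
Qed.

End InductiveLimit.

End Topology.

Lemma carrier_projlimP {R : realType} {d : nat} (I : eqType) (F : I -> lcs R d) u :
  carrier (projlim F) u <-> forall i, carrier (F i) u.
Proof. by rewrite /projlim /=; split=> [h i|h i _]; [exact: (h i Logic.I)|exact: h]. Qed.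

(** * Continuity of linear maps, tested at the origin *)

Section ContinuityAtZero.
Context {R : realType} {d : nat} (M : R^nat) (M_gt0 : forall p, 0 < M p).
Notation rV := 'rV[R]_d.
Notation fct := (rV -> R[i]).
Variables (c : ucase) (w : R -> rV -> R).
Hypothesis w0 : forall h x, 0 <= w h x.
Hypothesis wmono : forall h h', 0 < h' -> h' <= h -> forall x, w h' x <= w h x.
Notation S := (limit_space M c w).
Variable T : fct -> fct.
Hypothesis T_lin : forall phi psi (a : R[i]), carrier S phi -> carrier S psi ->
  T (a *: phi + psi) = a *: T phi + T psi.

(** Membership in the source is kept in the neighbourhood because T is linear only there, and
    linearity is what transports continuity to other points. *)
Definition cont0 (F : lcs R d) := forall U, nbhs0 F U ->
  nbhs0 S [set psi | carrier S psi /\ U (T psi)].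

Lemma limit_space_up (U U' : set fct) : U `<=` U' -> nbhs0 S U -> nbhs0 S U'.
Proof.
move=> UU; case: (c) => /=; last first.
  by move=> [W [aW nW WU]]; exists W; split=> //; exact: subset_trans UU.
by move=> [s [W [nW WU]]]; exists s, W; split=> //; exact: subset_trans UU.
Qed.

Lemma limit_space_inter (U U' : set fct) : nbhs0 S U -> nbhs0 S U' -> nbhs0 S (U `&` U').
Proof.
case: (c); last first.
  move=> [W [aW nW WU]] [W' [aW' nW' WU']]; exists (W `&` W'); split.
  - by move=> p q a b [p1 p2] [q1 q2] ab; split; [exact: aW|exact: aW'].
  - move=> h; apply/(nbhs0_BhP M_gt0 _ (ge0 h) (w0 h%:num)).
    have [e e0 He] := (nbhs0_BhP M_gt0 _ (ge0 h) (w0 h%:num)).1 (nW h).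
    have [e' e'0 He'] := (nbhs0_BhP M_gt0 _ (ge0 h) (w0 h%:num)).1 (nW' h).
    exists (Num.min e e'); first by rewrite lt_min e0.
    move=> phi pe; split.
      by apply: He; apply: (csnorm_le_le M_gt0 (ge0 h) (w0 _) _ pe); rewrite ge_min lexx.
    by apply: He'; apply: (csnorm_le_le M_gt0 (ge0 h) (w0 _) _ pe); rewrite ge_min lexx orbT.
  - by move=> p [p1 p2]; split; [exact: WU|exact: WU'].
move=> /(nbhs0_limit_space_elim M_gt0 w0 wmono) n1 /(nbhs0_limit_space_elim M_gt0 w0 wmono) n2.
have [h h0 /(_ h (lexx h))[[e e0 He] [e' e'0 He']]] := dual_index_and n1 n2.
have m0 : 0 < Num.min e e' by rewrite lt_min e0.
apply: (nbhs0_Beurling_intro M_gt0 w0 h0 m0) => phi Pphi pe; split.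
  by apply: He => //; apply: (csnorm_le_le M_gt0 (ltW h0) (w0 _) _ pe); rewrite ge_min lexx.
by apply: He' => //; apply: (csnorm_le_le M_gt0 (ltW h0) (w0 _) _ pe); rewrite ge_min lexx orbT.
Qed.

Lemma subspace_absolutely_convex (W : set fct) : vsubspace W -> absolutely_convex W.
Proof. by move=> sW p q a b Wp Wq _; apply: sW.2 => //; exact: subspace_scale. Qed.

Lemma limit_space_carrier : nbhs0 S (carrier S).
Proof.
apply: (nbhs0_limit_space_intro M_gt0 w0 (subspace_absolutely_convex (limit_space_subspace M_gt0 w0 wmono c)) (@subset_refl _ _)).
have : dual_index c (fun _ : R => True) by case: (c) => //=; exists 1.
by apply: dual_index_imp => h _ _; exists 1.
Qed.

Lemma cont0_projlim (I : eqType) (F : I -> lcs R d) :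
  (forall phi, carrier S phi -> carrier (projlim F) (T phi)) ->
  (forall i, cont0 (F i)) -> cont0 (projlim F).
Proof.
move=> mF cF U [s [W [nW sW]]].
have : nbhs0 S [set psi | carrier S psi /\ forall i, i \in s -> W i (T psi)].
  elim: s {sW} => [|i s IH].
    by apply: limit_space_up limit_space_carrier => psi p; split.
  apply: limit_space_up (limit_space_inter (cF i _ (nW i)) IH) => psi [[p1 p2] [_ p3]]; split=> // j.
  by rewrite inE => /orP[/eqP ->|/p3].
apply: limit_space_up => psi [p1 p2]; split=> //; apply: sW; split=> //; exact: mF.
Qed.

Lemma cont0_continuous (F : lcs R d) : cont0 F -> lcs_continuous S F T.
Proof.
move=> cF phi Sphi U nU.
apply: limit_space_up (cF _ nU) => psi [Spsi] /=.
by have := T_lin 1 Sphi Spsi; rewrite !scale1r => ->.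
Qed.

End ContinuityAtZero.

(** * The implications between the five statements *)

Section Equivalence.
Context {R : realType} {d : nat} (c : ucase) (M A : R^nat) (V : nat -> 'rV[R]_d -> R).
Hypotheses (M_gt0 : forall p, 0 < M p) (wA : weight_sequence A).
Hypothesis hV : decreasing_weight_system V.
Hypothesis adm : admissible c A V.
Variables (C0 H : R).
Hypotheses (C01 : 1 <= C0) (H1 : 1 <= H).
Hypothesis M2M : forall p q, M (p + q)%N <= C0 * H ^+ (p + q) * M p * M q.
Notation rV := 'rV[R]_d.
Notation fct := (rV -> R[i]).
Notation normc := Normc.normc.
Notation E := (expassoc A).
Notation GS := (gelfand_shilov c M A : lcs R d).
Notation S := (carrier GS).
Notation VC := (WC (dual_system V)).
Notation BV := (Bproj c M (dual_system V)).
Notation gsw := (fun h (x : rV) => E (h * enorm x)).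
Implicit Types (phi psi : fct) (h K : R) (x y : rV).

Let V_gt0 n x : 0 < V n x. Proof. by have [V0 _ _] := hV. Qed.
Let V_ge0 n x : 0 <= V n x. Proof. exact/ltW/V_gt0. Qed.
Let W_ge0 n x : 0 <= dual_system V n x. Proof. by rewrite /dual_system invr_ge0. Qed.
Let H_gt0 : 0 < H. Proof. exact: lt_le_trans H1. Qed.
Let gw0 h x : 0 <= gsw h x. Proof. exact: gs_weight_ge0. Qed.
Let gwmono h h' : 0 < h' -> h' <= h -> forall x, gsw h' x <= gsw h x.
Proof. by move=> h'0 h'h x; apply: gs_weight_mono => //; exact: ltW. Qed.

Lemma gs_dual_bounded f : lcs_dual GS f -> linear_on S f /\
  dual_index c (fun h => exists2 C : R, 0 <= C & forall phi K,
    S phi -> gs_snorm_le M A h phi K -> normc (f phi) <= C * K).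
Proof.
move=> df; have [lf nf] := dual_nbhs0 df (gs_subspace M_gt0 wA c); split=> //.
have := nf 1 ltr01; rewrite limit_space_gs => n1.
have lf' := lf; rewrite limit_space_gs in lf'.
apply: (dual_index_of_unit_ball M_gt0 gw0 gwmono lf').
apply: dual_index_imp (nbhs0_limit_space_elim M_gt0 gw0 gwmono n1) => h h0 [eps e0 He].
exists eps => // phi Sphi pe; have := He phi Sphi pe.
by rewrite /= (linear_on0 (gs_subspace M_gt0 wA c) lf) subr0 add0r => /ltW.
Qed.

Lemma WC_bounded u n : carrier VC u -> exists B, forall x, normc (u x) * (V n x)^-1 <= B.
Proof.
move=> /(_ n I)[_ /=]; set s := ereal_sup _ => s_fin.
have le_s x : ((normc (u x) * (V n x)^-1)%:E <= s)%E.
  by apply: ereal_sup_ubound; exists x.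
case: s s_fin le_s => [B|//|] _ le_s; last by exists 0 => x; have := le_s x.
by exists B => x; have := le_s x; rewrite lee_fin.
Qed.

Lemma sup_norm_le u n (B : R) : (forall x, normc (u x) * (V n x)^-1 <= B) ->
  (ereal_sup [set (normc (u x) * dual_system V n x)%:E | x in setT] <= B%:E)%E.
Proof. by move=> uB; apply: ge_ereal_sup => _ [x _ <-]; rewrite lee_fin uB. Qed.

Lemma continuous_complex u : continuous (re_part u) -> continuous (im_part u) ->
  continuous (u : rV -> R[i]^o).
Proof.
move=> cr ci x U /nbhs_ballP[z /= z0 zU].
have z0' : 0 < complex.Re z by move: z0; case: (z) => a b; rewrite ltcE /= => /andP[].
have zE : z = (complex.Re z)%:C.
  by move: z0; case: (z) => a b; rewrite ltcE /= => /andP[/eqP -> _].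
have z20 : 0 < complex.Re z / 2 by rewrite divr_gt0.
have n1 : nbhs x [set y | `|re_part u x - re_part u y| < complex.Re z / 2].
  by move/cvgrPdist_lt: (cr x) => /(_ _ z20).
have n2 : nbhs x [set y | `|im_part u x - im_part u y| < complex.Re z / 2].
  by move/cvgrPdist_lt: (ci x) => /(_ _ z20).
apply: filterS (filterI n1 n2) => y [h1 h2]; apply: zU.
rewrite /ball /= normcE_norm zE ltcR; apply: le_lt_trans (normc_le _) _.
by rewrite complex_re_sub complex_im_sub [ltRHS]splitr ltrD.
Qed.

Variable (f : fct -> R[i]).
Hypothesis lf : linear_on S f.
Hypothesis f_bounded : dual_index c (fun h => exists2 C : R, 0 <= C & forall phi K,
  S phi -> gs_snorm_le M A h phi K -> normc (f phi) <= C * K).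

Lemma convolution_continuous phi : S phi -> continuous (convolution f phi : rV -> R[i]^o).
Proof.
move=> Sphi; apply: continuous_complex.
  have [sr _] := convolution_re M_gt0 wA C01 H1 M2M lf f_bounded Sphi.
  exact: (smooth_continuous (s := [::]) sr).
have [si _] := convolution_im M_gt0 wA C01 H1 M2M lf f_bounded Sphi.
exact: (smooth_continuous (s := [::]) si).
Qed.

Lemma convolution_WC phi : S phi ->
  (forall n, exists B, forall x, normc (convolution f phi x) * (V n x)^-1 <= B) ->
  carrier VC (convolution f phi).
Proof.
move=> Sphi b; apply/carrier_projlimP => n; split; first exact: convolution_continuous.
by have [B HB] := b n; apply: le_lt_trans (sup_norm_le HB) _; rewrite ltry.
Qed.

Lemma convolution_lin phi psi (a : R[i]) : S phi -> S psi ->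
  convolution f (a *: phi + psi) = a *: convolution f phi + convolution f psi.
Proof.
move=> Sphi Spsi; apply/funext => x.
rewrite -[RHS]/(a * convolution f phi x + convolution f psi x) !convolutionE.
by rewrite -(lf a (gs_reflect M_gt0 wA x Sphi) (gs_reflect M_gt0 wA x Spsi)).
Qed.

(** A bound at order zero for a single h already gives boundedness against each weight. *)
Lemma maps_BV_VC : lcs_maps GS BV (convolution f) -> lcs_maps GS VC (convolution f).
Proof.
move=> mB phi Sphi; apply: convolution_WC => // n.
have [h [h0 [K HK]]] : exists h, 0 < h /\ exists K, csnorm_le M h (dual_system V n) (convolution f phi) K.
  have := mB phi Sphi; case: (c) => /=.
    move=> P; exists 1; split=> //.
    exact/(carrier_BhP M_gt0 _ ler01 (W_ge0 n))/(P (PosNum ltr01) I n I).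
  move=> [h _ P]; exists h%:num; split=> //.
  exact/(carrier_BhP M_gt0 _ (ge0 h) (W_ge0 n))/(P n I).
exists (2 * (K * M 0%N)) => x; have [[_ rK] [_ iK]] := HK.
have := rK [::] x; have := iK [::] x; rewrite /= expr0 !mul1r => b1 b2.
apply: le_trans (ler_wpM2r _ (normc_le _)) _; first by rewrite invr_ge0.
by rewrite mulrDl mulr2n mulrDl mul1r lerD.
Qed.

Section FromDual.
Variable (g : fct -> R[i]).
Hypothesis g_bounded : forall n, dual_index c (fun h => exists2 C : R, 0 <= C & forall phi K,
  carrier (Bw c M (V n)) phi -> csnorm_le M h (V n) phi K -> normc (g phi) <= C * K).
Hypothesis gf : forall phi, S phi -> g phi = f phi.

Let c_bound := convolution_bound M_gt0 wA hV adm g_bounded gf.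
Let c_cub := convolution_csnorm_le M_gt0 wA hV adm C01 H1 M2M lf f_bounded g_bounded gf.

Lemma maps_VC : lcs_maps GS VC (convolution f).
Proof.
move=> phi Sphi; apply: convolution_WC => // n.
have [h [h0 [C C_ge0 HC] [K pK]]] := dual_index_fr (c_bound n) ((carrier_gsP M_gt0 A c phi).1 Sphi).
exists (C * K) => x; rewrite ler_pdivrMr // mulrAC; exact: HC.
Qed.

Lemma continuous_VC : lcs_continuous GS VC (convolution f).
Proof.
have lin := convolution_lin; have mVC := maps_VC; rewrite limit_space_gs in lin mVC *.
apply: (cont0_continuous lin).
apply: (cont0_projlim M_gt0 gw0 gwmono mVC) => n U [e /= e0 eU].
(* The bound e / 2 makes the supremum strictly less than e, while the set stays absolutely
   convex. *)
pose W : set fct := [set psi | S psi /\ forall x, normc (convolution f psi x) * (V n x)^-1 <= e / 2].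
have aW : absolutely_convex W.
  move=> p q a b [Sp bp] [Sq bq] ab.
  have sS : vsubspace S by exact: gs_subspace.
  have Sbq := subspace_scale b sS Sq.
  split=> [|x]; first exact: sS.2.
  rewrite convolution_lin //.
  have -> : convolution f (b *: q) = b *: convolution f q.
    have := convolution_lin b Sq sS.1; rewrite addr0 => ->.
    have := convolution_lin 1 sS.1 sS.1; rewrite !scale1r addr0 => /eqP.
    by rewrite -subr_eq0 opprD addrA subrr sub0r oppr_eq0 => /eqP ->; rewrite addr0.
  rewrite -[(_ + _) x]/(a * convolution f p x + b * convolution f q x).
  have v0 : 0 <= (V n x)^-1 by rewrite invr_ge0.
  apply: le_trans (ler_wpM2r v0 (le_normcD _ _)) _; rewrite !Normc.normcM mulrDl -!mulrA.
  move: ab; rewrite !normcE_norm -rmorphD /= lecR => ab.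
  apply: le_trans (lerD (ler_wpM2l (normc_ge0 a) (bp x)) (ler_wpM2l (normc_ge0 b) (bq x))) _.
  by rewrite -mulrDl ler_piMl // divr_ge0 // ltW.
have WU : W `<=` [set psi | carrier (limit_space M c gsw) psi /\ U (convolution f psi)].
  move=> psi [Spsi b]; split; first by rewrite -limit_space_gs.
  apply: eU; split.
    by split; [exact: convolution_continuous|apply: le_lt_trans (sup_norm_le b) _; rewrite ltry].
  by apply: le_lt_trans (sup_norm_le b) _; rewrite lte_fin ltr_pdivrMr // ltr_pMr // ltr1n.
apply: (nbhs0_limit_space_intro M_gt0 gw0 aW WU).
apply: dual_index_imp (c_bound n) => h h0 [C C_ge0 HC].
exists (e / 2 / (C + 1)); first by rewrite !divr_gt0 // ltr_wpDl.
move=> psi; rewrite -limit_space_gs => Spsi pe; split=> // x.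
rewrite ler_pdivrMr //; apply: le_trans (HC _ _ x Spsi pe) _.
rewrite mulrAC ler_wpM2r // mulrCA ger_pMr ?divr_gt0 //.
by rewrite ler_pdivrMr ?ltr_wpDl // mul1r lerDl.
Qed.

Lemma maps_BV : lcs_maps GS BV (convolution f).
Proof.
move=> phi Sphi; have p := (carrier_gsP M_gt0 A c phi).1 Sphi.
case: (c) p Sphi c_cub => /= p Sphi cc.
  move=> h' _ n _; apply/(carrier_BhP M_gt0 _ (ge0 h') (W_ge0 n)).
  have [h h0 Hh] := cc n.
  pose k := Num.max h h'%:num.
  have k0 : 0 < k by rewrite lt_max h0.
  have hk : h <= k by rewrite le_max lexx.
  have h'k : h'%:num <= k by rewrite le_max lexx orbT.
  have [C C_ge0 HC] := Hh k hk; have [K pK] := p _ (mulr_gt0 H_gt0 k0).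
  exists (1 * (C * K)).
  apply: (csnorm_le_weaken M_gt0 (ge0 h') h'k ler01 _ (lexx _) (HC _ _ Sphi pK)) => x.
  by rewrite W_ge0 mul1r lexx.
have [h h0 [K pK]] := p.
have hH : 0 < h / H by rewrite divr_gt0.
exists (PosNum hH) => // n _; apply/(carrier_BhP M_gt0 _ (ltW hH) (W_ge0 n)).
have [C C_ge0 HC] := cc n _ hH; exists (C * K).
have pK' : gs_snorm_le M A (H * (h / H)) phi K by rewrite mulrC divfK // gt_eqF.
exact: HC Sphi pK'.
Qed.

(** A neighbourhood in a projective limit constrains finitely many weights, so one radius serves all
    of them. *)
Lemma finite_min (s : seq nat) (e : nat -> R) : (forall n, 0 < e n) ->
  exists2 eps, 0 < eps & forall n, n \in s -> eps <= e n.
Proof.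
move=> e0; elim: s => [|n s [eps eps0 IH]]; first by exists 1.
exists (Num.min eps (e n)); first by rewrite lt_min eps0 e0.
move=> m; rewrite inE => /orP[/eqP ->|/IH h]; first by rewrite ge_min lexx orbT.
by rewrite ge_min h.
Qed.

Lemma continuous_BV : lcs_continuous GS BV (convolution f).
Proof.
have lin := convolution_lin; have mBV := maps_BV; rewrite limit_space_gs in lin mBV *.
apply: (cont0_continuous lin).
have cS := @limit_space_gs R d M c A; have cc := c_cub.
case: (c) lin mBV cS cc => lin mBV cS cc.
  apply: (cont0_projlim M_gt0 gw0 gwmono mBV) => h'.
  apply: (cont0_projlim M_gt0 gw0 gwmono) => [phi Sphi|n U].
    exact: (mBV phi Sphi h' I).
  move=> /(nbhs0_BhP M_gt0 _ (ge0 h') (W_ge0 n)) [e e0 He].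
  have [h h0 Hh] := cc n.
  pose k := Num.max h h'%:num.
  have k0 : 0 < k by rewrite lt_max h0.
  have hk : h <= k by rewrite le_max lexx.
  have h'k : h'%:num <= k by rewrite le_max lexx orbT.
  have [C C_ge0 HC] := Hh k hk.
  have e'0 : 0 < e / (C + 1) by rewrite divr_gt0 // ltr_wpDl.
  apply: (nbhs0_Beurling_intro M_gt0 gw0 (mulr_gt0 H_gt0 k0) e'0) => psi Spsi pe.
  split=> //; apply: He; rewrite -cS in Spsi.
  apply: (csnorm_le_weaken M_gt0 (ge0 h') h'k ler01 _ _ (HC _ _ Spsi pe)) => [x|].
    by rewrite W_ge0 mul1r lexx.
  by rewrite mul1r mulrCA ger_pMr // ler_pdivrMr ?ltr_wpDl // mul1r lerDl.
move=> U [W' [aW' nW' W'U]].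
have sS := limit_space_subspace M_gt0 gw0 gwmono Roumieu.
(* The preimage of an absolutely convex set under a linear map is absolutely convex, so it may
   define a neighbourhood in the inductive limit. *)
pose W : set fct := [set psi | carrier (limit_space M Roumieu gsw) psi /\ W' (convolution f psi)].
have aW : absolutely_convex W.
  move=> p q a b [Sp bp] [Sq bq] ab; have Sbq := subspace_scale b sS Sq.
  split; first exact: sS.2.
  rewrite lin //.
  have -> : convolution f (b *: q) = b *: convolution f q.
    have := lin _ _ b Sq sS.1; rewrite addr0 => ->.
    have := lin _ _ 1 sS.1 sS.1; rewrite !scale1r addr0 => /eqP.
    by rewrite -subr_eq0 opprD addrA subrr sub0r oppr_eq0 => /eqP ->; rewrite addr0.
  exact: aW'.
have WU : W `<=` [set psi | carrier (limit_space M Roumieu gsw) psi /\ U (convolution f psi)].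
  by move=> psi [Spsi b]; split=> //; exact: W'U.
apply: (nbhs0_limit_space_intro (c := Roumieu) M_gt0 gw0 aW WU) => h h0.
(* The source step h is mapped into the target step h / H, in accordance with the loss in (M.2). *)
have hH : 0 < h / H by rewrite divr_gt0.
have [s [U' [nU' sU']]] := nW' (PosNum hH).
have eU' n : exists e, 0 < e /\ forall psi, csnorm_le M (h / H) (dual_system V n) psi e -> U' n psi.
  by have [e e0 He] := (nbhs0_BhP M_gt0 _ (ltW hH) (W_ge0 n)).1 (nU' n); exists e.
have /choice[e eP] := eU'.
have bC n : exists C, 0 <= C /\ forall phi K, carrier (limit_space M Roumieu gsw) phi ->
    gs_snorm_le M A h phi K -> csnorm_le M (h / H) (dual_system V n) (convolution f phi) (C * K).
  have [C C_ge0 HC] := cc n _ hH; exists C; split; first exact: C_ge0.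
  move=> phi K Sphi pK; have pK' : gs_snorm_le M A (H * (h / H)) phi K by rewrite mulrC divfK // gt_eqF.
  by apply: HC pK'; rewrite cS.
have /choice[C CP] := bC.
have eC0 n : 0 < e n / (C n + 1).
  by rewrite divr_gt0 ?(eP n).1 // ltr_wpDl // (CP n).1.
have [eps eps0 epsP] := finite_min s eC0.
exists eps => // psi Spsi pe; split=> //; apply: sU'; split=> [n _|n ns].
  apply/(carrier_BhP M_gt0 _ (ltW hH) (W_ge0 n)); exists (C n * eps); exact: (CP n).2 pe.
apply: (eP n).2; apply: (csnorm_le_le M_gt0 (ltW hH) (W_ge0 n) _ ((CP n).2 _ _ Spsi pe)).
have Cn0 := (CP n).1; apply: le_trans (ler_wpM2l Cn0 (epsP n ns)) _.
by rewrite mulrCA ger_pMr ?(eP n).1 // ler_pdivrMr ?ltr_wpDl // mul1r lerDl.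
Qed.

End FromDual.

End Equivalence.

Theorem theorem4p20 (R : realType) (d : nat) (c : ucase)
    (M A : nat -> R) (V : nat -> 'rV[R]_d -> R)
    (f : ('rV[R]_d -> R[i]) -> R[i])
    (hd : (0 < d)%N)
    (wM : weight_sequence M) (wA : weight_sequence A)
    (M1M : M1 M) (M1A : M1 A) (M2M : M2 M) (M2A : M2 A)
    (hfact : seq_prec (fun p => p`!%:R) (fun p => M p * A p))
    (hnz : exists2 phi : 'rV[R]_d -> R[i],
       carrier (gelfand_shilov Beurling M A) phi & phi <> 0)
    (hV : decreasing_weight_system V)
    (hdecay : decay_condition V)
    (hadm : admissible c A V)
    (hf : lcs_dual (gelfand_shilov c M A) f) :
  let S := gelfand_shilov c M A in
  let VC := WC (dual_system V) in
  let BV := Bproj c M (dual_system V) in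
  [<-> in_dual_of S (Bind c M V) f ;
       lcs_maps S VC (convolution f) ;
       lcs_maps S VC (convolution f) /\ lcs_continuous S VC (convolution f) ;
       lcs_maps S BV (convolution f) ;
       lcs_maps S BV (convolution f) /\ lcs_continuous S BV (convolution f)].
Proof.
move=> S VC BV.
have M_gt0 := wM.1; have [C0 [H [C01 H1 M2M']]] := M2M.
have [lf f_bounded] := gs_dual_bounded M_gt0 wA hf.
have dual_all : in_dual_of S (Bind c M V) f ->
    (lcs_maps S VC (convolution f) /\ lcs_continuous S VC (convolution f)) /\
    (lcs_maps S BV (convolution f) /\ lcs_continuous S BV (convolution f)).
  move=> [g dg gf]; have [_ g_bounded] := Bind_dual_bounded M_gt0 hV dg.
  split; split.
  - exact: (maps_VC M_gt0 wA hV hadm C01 H1 M2M' lf f_bounded g_bounded gf).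
  - exact: (continuous_VC M_gt0 wA hV hadm C01 H1 M2M' lf f_bounded g_bounded gf).
  - exact: (maps_BV M_gt0 wA hV hadm C01 H1 M2M' lf f_bounded g_bounded gf).
  - exact: (continuous_BV M_gt0 wA hV hadm C01 H1 M2M' lf f_bounded g_bounded gf).
have maps_dual : lcs_maps S VC (convolution f) -> in_dual_of S (Bind c M V) f.
  move=> mVC; have [phi Sphi phi0] := hnz.
  (* The nonzero element comes from the Beurling space in both cases, so the window satisfies its
     estimates for every h. *)
  have [c0 [chiK chi_sum]] := exists_partition hd M_gt0 M1M wA Sphi phi0.
  have f_pointwise n psi : carrier S psi -> exists B, forall x,
      Normc.normc (convolution f psi x) * (V n x)^-1 <= B.
    by move=> Spsi; apply: WC_bounded; exact: mVC.
  exists (extension f c0).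
    apply: (Bind_dual_intro M_gt0 hV).
      exact: (extension_linear hd M_gt0 M1M wA M2A hV lf f_bounded f_pointwise hadm hdecay chiK).
    exact: (extension_bounded hd M_gt0 M1M wA M2A hV lf f_bounded f_pointwise hadm hdecay chiK).
  exact: (extension_eq hd M_gt0 M1M wA M2A lf f_bounded chiK chi_sum).
have BV_VC := maps_BV_VC M_gt0 wA hV C01 H1 M2M' lf f_bounded.
(* Each arrow of the cycle starts at, ends at or passes through the first statement, which yields
   all the others at once. *)
tfae.
- by move=> /dual_all[[]].
- by move=> /maps_dual/dual_all[].
- by move=> [/maps_dual/dual_all[_ []]].
- by move=> /BV_VC/maps_dual/dual_all[].
- by move=> [/BV_VC/maps_dual].
Qed.
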